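(* Let $k\in I$ and let $\mathbf{v}^1,\mathbf{v}^2\in\mathbb{Z}_{\ge0}^I$ be dimension vectors with $\mathbf{v}^2=\mathbf{v}^1+\delta_k$. Under the closed embedding $p\times q\times t(\mathbf{v}^1,\mathbf{v}^2)$, $\mathfrak{P}(\mathbf{v}^1,\mathbf{v}^2)$ is a Lagrangian of $\mathfrak{M}(\mathbf{v}^1,\mathbf{w})\times\mathfrak{M}(\mathbf{v}^2,\mathbf{w})\times\mathbf{L}_k$. Thus $$\dim\mathfrak{P}(\mathbf{v}^1,\mathbf{v}^2)=\tfrac12\big(\dim\mathfrak{M}(\mathbf{v}^1,\mathbf{w})+\dim\mathfrak{M}(\mathbf{v}^2,\mathbf{w})+2g_k\big).$$
   Context: We work over $\mathbb{C}$. $Q=(I,E)$ is a finite quiver with source and target maps $in,out:E\to I$; for $e\in E$ let $\bar e$ be the reversed arrow, $E^{\#}=E\sqcup\overline E$, $\bar{\bar e}=e$, and fix $\epsilon:E^{\#}\to\mathbb{C}^*$ with $\epsilon(h)+\epsilon(\bar h)=0$. For $k\in I$, $\delta_k=(\delta_{kj})_{j\in I}$, $g_k$ is the number of loops of $E$ at $k$, $E_k^{\#}=\{l\in E^{\#}:in(l)=out(l)=k\}$ (so $|E_k^{\#}|=2g_k$), and $\mathbf{L}_k=\mathbb{C}^{E_k^{\#}}\cong\mathbb{C}^{2g_k}$ with symplectic form $\omega_k(x,x')=\sum_{l\in E_k^{\#}}\epsilon(l)x_lx'_{\bar l}$. Fix $\mathbf{w}\in\mathbb{Z}_{\ge0}^I$,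 $\mathbf{w}\ne0$. For $\mathbf{v}\in\mathbb{Z}_{\ge0}^I$ put $V_k=\mathbb{C}^{\mathbf{v}_k}$, $W_k=\mathbb{C}^{\mathbf{w}_k}$. Consider ADHM data $\mathcal{B}=(B,i,j)$ with $B\in\bigoplus_{h\in E^{\#}}\mathrm{Hom}(V_{in(h)},V_{out(h)})$, $i\in\bigoplus_k\mathrm{Hom}(W_k,V_k)$, $j\in\bigoplus_k\mathrm{Hom}(V_k,W_k)$, satisfying $\sum_{out(h)=k}\epsilon(h)B_hB_{\bar h}+i_kj_k=0$ for all $k$. Such a datum is stable if the only $I$-graded subspace $S\subset V$ with $B_hS_{in(h)}\subset S_{out(h)}$ for all $h$ and $S\subset\ker j$ is $S=0$. The group $\prod_kGL(V_k)$ acts by $(gBg^{-1},gi,jg^{-1})$, freely on stable data, and the quotient of the stable locus is the Nakajima quiver variety $\mathfrak{M}(\mathbf{v},\mathbf{w})$, a smooth variety; the form $\sum_{h\in E^{\#}}\epsilon(h)\,tr(B_hB'_{\bar h})+tr(ij'-i'j)$ descends to a symplectic form $\Omega(\mathbf{v})$ on it. For $[\mathcal{B}^l]\in\mathfrak{M}(\mathbf{v}^l,\mathbf{w})$, $l=1,2$, write $[\mathcal{B}^1]\subset[\mathcal{B}^2]$ if there is $\zeta=(\zeta_k:V^1_k\to V^2_k)_k$ with $\zeta B^1=B^2\zeta$, $\zeta i^1=i^2$, $j^1=j^2\zeta$ (then $\zeta$ is unique and injective). For $\mathbf{v}^2=\mathbf{v}^1+\delta_k$ the Hecke correspondence $\mathfrak{P}(\mathbf{v}^1,\mathbf{v}^2)\subset\mathfrak{M}(\mathbf{v}^1,\mathbf{w})\times\mathfrak{M}(\mathbf{v}^2,\mathbf{w})$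 is the closed smooth subvariety of pairs $[\mathcal{B}^1]\subset[\mathcal{B}^2]$; $p,q$ are its projections to $\mathfrak{M}(\mathbf{v}^1,\mathbf{w})$ and $\mathfrak{M}(\mathbf{v}^2,\mathbf{w})$, and $t(\mathbf{v}^1,\mathbf{v}^2):\mathfrak{P}(\mathbf{v}^1,\mathbf{v}^2)\to\mathbf{L}_k$ is $([\mathcal{B}^1],[\mathcal{B}^2])\mapsto(tr(B^2_l)-tr(B^1_l))_{l\in E_k^{\#}}$. The product $\mathfrak{M}(\mathbf{v}^1,\mathbf{w})\times\mathfrak{M}(\mathbf{v}^2,\mathbf{w})\times\mathbf{L}_k$ is regarded as a symplectic variety through the forms $\Omega(\mathbf{v}^1)$, $\Omega(\mathbf{v}^2)$, $\omega_k$ on its three factors; the statement does not specify the signs with which their pullbacks are combined. *)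

(* Defs.v *)
From HB Require Import structures.
From mathcomp Require Import all_boot all_order all_algebra.
From mathcomp Require Import reals complex mpoly.

Set Implicit Arguments.
Unset Strict Implicit.
Unset Printing Implicit Defensive.

Import GRing.Theory.
Local Open Scope ring_scope.

Definition point (C : fieldType) (T : finType) := {ffun T -> C}.
Definition polyfun (C : fieldType) (T : finType) := {mpoly C[#|T|]}.

Section Affine.
Variables (C : fieldType) (T : finType).
Implicit Types (f g : polyfun C T) (x y u : point C T) (X Y : point C T -> Prop).

Definition evalp f x : C := f.@[fun a => x (enum_val a)].

Definition partial_at f x (a : 'I_#|T|) : C := evalp (mderiv a f) x.

Definition differential f x u : C :=
  \sum_(a < #|T|) partial_at f x a * u (enum_val a).

Definition vanishes_on f X := forall y, X y -> evalp f y = 0.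

Definition zariski_closure X x := forall f, vanishes_on f X -> evalp f x = 0.

Definition closed_in X Y :=
  (forall x, X x -> Y x) /\ (forall x, Y x -> zariski_closure X x -> X x).

(* Zariski tangent space, with reduced structure, of a locally closed X at a
   point x of X: X and its closure have the same tangent space at x. *)
Definition tangent X x u := forall f, vanishes_on f X -> differential f x u = 0.

(* X is smooth of dimension d at x: on a principal Zariski-open neighbourhood
   of x, X is the zero locus of #|T| - d polynomials whose differentials at x
   are linearly independent. *)
Definition smooth_at X (d : nat) x :=
  exists (r : nat) (F : 'I_r -> polyfun C T) (g : polyfun C T),
  [/\ (r + d)%N = #|T|,
      evalp g x <> 0,
      forall y, evalp g y <> 0 -> (X y <-> forall a, evalp (F a) y = 0)
    & \rank (\matrix_(a < r, b < #|T|) partial_at (F a) x b) = r].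

End Affine.

Definition regular_map (C : fieldType) (T T' : finType)
    (f : point C T -> point C T') :=
  exists F : T' -> polyfun C T, forall x t, f x t = evalp (F t) x.

(* A quotient variety X / G is presented by a locally closed subset X of an
   affine space, the orbit relation of an algebraic group G acting freely on X,
   and dim G.  The quotient map X -> X / G being a principal bundle,
   - subvarieties of X / G are the G-stable subvarieties of X, and closedness
     and smoothness can be tested on X;
   - dim (X / G) = dim X - dim G;
   - T_[x] (X / G) = T_x X / T_x (G x). *)

Record qvariety (C : fieldType) := QVariety {
  coords : finType;
  locus : point C coords -> Prop;
  orbit_rel : point C coords -> point C coords -> Prop;
  group_dim : nat
}.
Arguments locus {C} _ _.
Arguments orbit_rel {C} _ _ _.

Section Quotients.
Variable C : fieldType.
Implicit Types M N : qvariety C.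

Definition qpoint M := point C (coords M).

(* M is smooth of pure dimension d; the empty variety has every pure
   dimension. *)
Definition smooth_of_dim M (d : nat) :=
  forall x : qpoint M, locus M x -> smooth_at (locus M) (d + group_dim M) x.

Definition closed_subvariety N (Z : qpoint N -> Prop) :=
  (forall x y, Z x -> locus N y -> orbit_rel N x y -> Z y) /\
  closed_in Z (locus N).

Definition embedded_image M N (f : qpoint M -> qpoint N) (z : qpoint N) :=
  exists2 x, locus M x & z = f x.

(* f induces M / G -> N / H, injective with closed image, and a regular map
   inverts it on the image. *)
Definition closed_embedding M N (f : qpoint M -> qpoint N) :=
  [/\ regular_map f,
      forall x y, locus M x -> locus M y ->
        (orbit_rel M x y <-> orbit_rel N (f x) (f y)),
      closed_subvariety (embedded_image f)
    & exists2 g : qpoint N -> qpoint M,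
        regular_map g & forall x, locus M x -> g (f x) = x].

(* omega is a symplectic form on the quotient N, given by its pull-back to the
   total space (so that its radical at z is the tangent space to the orbit of
   z).  Z is Lagrangian if it is a smooth closed subvariety and the image L of
   its tangent space in T_z N / T_z (orbit z) satisfies L = L^perp. *)
Definition lagrangian N (omega : qpoint N -> qpoint N -> C)
    (Z : qpoint N -> Prop) :=
  closed_subvariety Z /\
  forall z, Z z ->
    (exists d, smooth_at Z d z) /\
    (forall u, tangent (locus N) z u ->
       ((exists2 o : qpoint N,
           tangent (orbit_rel N z) z o & tangent Z z (u + o)) <->
        (forall u', tangent Z z u' -> omega u u' = 0))).

Definition joinp (T1 T2 : finType) (x : point C T1) (y : point C T2) :
    point C (T1 + T2)%type :=
  [ffun s => match s with inl a => x a | inr b => y b end].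
Definition fstp (T1 T2 : finType) (z : point C (T1 + T2)%type) : point C T1 :=
  [ffun a => z (inl a)].
Definition sndp (T1 T2 : finType) (z : point C (T1 + T2)%type) : point C T2 :=
  [ffun b => z (inr b)].

Definition qprod M N : qvariety C :=
  @QVariety C (coords M + coords N)%type
    (fun z => locus M (fstp z) /\ locus N (sndp z))
    (fun z z' => orbit_rel M (fstp z) (fstp z') /\ orbit_rel N (sndp z) (sndp z'))
    (group_dim M + group_dim N).

Definition affine_space (T : finType) : qvariety C :=
  @QVariety C T (fun _ => True) (fun x y => x = y) 0.

End Quotients.
Arguments closed_subvariety {C} N Z.
Arguments embedded_image {C} M N f.
Arguments closed_embedding {C} M N f.
Arguments lagrangian {C} N omega Z.

(* [edge i j] is the set of arrows e with in(e) = i and out(e) = j. *)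
Record quiver := Quiver {
  vertex :> finType;
  edge : vertex -> vertex -> finType
}.

(* The arrows h of the doubled quiver with in(h) = i and out(h) = j; at a
   vertex k, [darrow k k] has 2 g_k elements. *)
Definition darrow (Q : quiver) (i j : Q) : finType := (edge i j + edge j i)%type.

Definition bar (Q : quiver) (i j : Q) (h : darrow i j) : darrow j i :=
  match h with inl e => inr e | inr e => inl e end.

Definition loops (Q : quiver) (k : Q) : nat := #|edge k k|.

Section ADHM.
Variables (C : fieldType) (Q : quiver).
Variable eps : forall i j : Q, darrow i j -> C.
Variable w : Q -> nat.

(* Matrix entries of B, i and j. *)
Definition adhm_coord (v : Q -> nat) : finType :=
  ({i : Q & {j : Q & (darrow i j * ('I_(v j) * 'I_(v i)))%type}}
   + {k : Q & ('I_(v k) * 'I_(w k))%type}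
   + {k : Q & ('I_(w k) * 'I_(v k))%type})%type.

Definition adhm (v : Q -> nat) := point C (adhm_coord v).

Section Data.
Variable v : Q -> nat.
Implicit Types x y : adhm v.

(* Linear maps are matrices acting on column vectors. *)
Definition Bmap x (i j : Q) (h : darrow i j) : 'M[C]_(v j, v i) :=
  \matrix_(a, b) x (inl (inl (existT _ i (existT _ j (h, (a, b)))))).
Definition imap x (k : Q) : 'M[C]_(v k, w k) :=
  \matrix_(a, b) x (inl (inr (existT _ k (a, b)))).
Definition jmap x (k : Q) : 'M[C]_(w k, v k) :=
  \matrix_(a, b) x (inr (existT _ k (a, b))).

Definition moment x (k : Q) : 'M[C]_(v k) :=
  \sum_(l : Q) \sum_(h : darrow l k) eps h *: (Bmap x h *m Bmap x (bar h))
  + imap x k *m jmap x k.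

Definition stable x :=
  forall S : forall k : Q, {vspace 'cV[C]_(v k)},
    (forall (i j : Q) (h : darrow i j) s, s \in S i -> Bmap x h *m s \in S j) ->
    (forall (k : Q) s, s \in S k -> jmap x k *m s = 0) ->
    forall k, S k = 0%VS.

Definition gauge_equiv x y :=
  exists g : forall k : Q, 'M[C]_(v k),
  [/\ forall k, g k \in unitmx,
      forall (i j : Q) (h : darrow i j),
        Bmap y h = g j *m Bmap x h *m invmx (g i),
      forall k, imap y k = g k *m imap x k
    & forall k, jmap y k = jmap x k *m invmx (g k)].

Definition quiver_variety : qvariety C :=
  @QVariety C (adhm_coord v)
    (fun x => (forall k, moment x k = 0) /\ stable x)
    gauge_equiv
    (\sum_k v k ^ 2)%N.

Definition Omega x y : C :=
  \sum_(i : Q) \sum_(j : Q) \sum_(h : darrow i j)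
     eps h * \tr (Bmap x h *m Bmap y (bar h))
  + \sum_(k : Q) \tr (imap x k *m jmap y k - imap y k *m jmap x k).

End Data.

(* [x1] is contained in [x2]; this only depends on the gauge orbits. *)
Definition sub_adhm (v1 v2 : Q -> nat) (x1 : adhm v1) (x2 : adhm v2) :=
  exists zeta : forall k : Q, 'M[C]_(v2 k, v1 k),
  [/\ forall (i j : Q) (h : darrow i j),
        zeta j *m Bmap x1 h = Bmap x2 h *m zeta i,
      forall k, zeta k *m imap x1 k = imap x2 k
    & forall k, jmap x1 k = jmap x2 k *m zeta k].

Section Hecke.
Variables (v1 v2 : Q -> nat) (k : Q).

Definition variety_pair := qprod (quiver_variety v1) (quiver_variety v2).

Definition hecke : qvariety C :=
  @QVariety C (coords variety_pair)
    (fun z => locus variety_pair z /\ sub_adhm (fstp z) (sndp z))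
    (orbit_rel variety_pair)
    (group_dim variety_pair).

Definition loop_space : qvariety C := affine_space C (darrow k k).

Definition omega (x y : qpoint loop_space) : C :=
  \sum_(l : darrow k k) eps l * x l * y (bar l).

Definition trace_diff (z : qpoint hecke) : qpoint loop_space :=
  [ffun l : darrow k k => \tr (Bmap (sndp z) l) - \tr (Bmap (fstp z) l)].

Definition hecke_target : qvariety C := qprod variety_pair loop_space.

Definition hecke_embedding (z : qpoint hecke) : qpoint hecke_target :=
  joinp z (trace_diff z).

(* Tangent vectors to the Hecke correspondence satisfy
   Omega(v2) = Omega(v1) + omega; with the traces taken as tr B2 - tr B1 these
   are, up to a common sign, the signs for which its image is isotropic. *)
Definition target_form (u u' : qpoint hecke_target) : C :=
  Omega (fstp (fstp u)) (fstp (fstp u'))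
  - Omega (sndp (fstp u)) (sndp (fstp u'))
  + omega (sndp u) (sndp u').

End Hecke.
End ADHM.
Arguments hecke_embedding {C Q} eps w v1 v2 k z.
Arguments target_form {C Q} eps w v1 v2 k u u'.

(* Main.v *)
(** Let (x, y) be a pair of stable data.  It lies on the Hecke correspondence iff
    the inhomogeneous linear system alpha(zeta) = s of the complex
    L(V1,V2) -> E(V1,V2) -> L(V1,V2) + C is solvable, where alpha is injective
    by stability.  Eliminating zeta by Cramer's rule gives polynomial equations,
    closed on the product of the two varieties; at a point of the correspondence
    the second map is onto, which tells how many of the equations are redundant,
    and leaves r of them, where #coordinates = 2 r + 2 g_k.

    A tangent vector to the correspondence can be moved, by an infinitesimal
    gauge transformation of V2, to a pair of deformations intertwined by zeta;
    for such pairs Omega(v2) - Omega(v1) is a trace on the line V2_k / V1_k, that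
    is, the form omega_k of the differences of traces.  So the graph T of the
    trace map over the tangent space is isotropic for the nondegenerate form on
    the ambient affine space A(v1) x A(v2) x L_k, whose dimension is twice the
    number of equations of T.  Hence these equations are independent, which is
    smoothness and the dimension formula, and T is its own orthogonal.

    That the kernel of the differentials of independent equations is the whole
    Zariski tangent space of their zero locus is obtained from actual points of
    the locus, constructed by Newton's method over the complex numbers. *)

Require Import Defs.
From mathcomp Require Import all_boot all_order all_algebra.
From mathcomp Require Import boolp reals complex mpoly ring lra zify.

Set Implicit Arguments.
Unset Strict Implicit.
Unset Printing Implicit Defensive.

Import Order.TTheory GRing.Theory Num.Theory.
Local Open Scope ring_scope.

(** * Polynomial functions and their differentials *)

(** The danger is circularity: the linearised equations describe the Zariski tangent space only once
    they are known to be independent. Isotropy breaks the circle, because it is proved for all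
    solutions of the linearised equations, tangent or not; a count then forces independence. The
    count is exact. Of the dim E(V1,V2) incidence equations, dim L(V1,V2) are lost to the
    elimination of zeta and dim L(V1,V2) + 1 to the second map. Since dim L(V1,V1) + dim L(V2,V2) =
    2 dim L(V1,V2) + 1, the moment equations compensate for this loss precisely, and r = dim
    E(V1,V2). The summand C of the complex is one trace relation; without it there would be one
    equation too many. Surjectivity onto L(V1,V2) + C is dual to an injectivity: an annihilator (xi,
    c) satisfies zeta xi = - c on V2, and c = 0 because V1_k is too small for a nonzero scalar of
    V2_k to factor through it. Tangent vectors are tested against every polynomial vanishing on the
    locus, not only against its equations, which is why actual points are needed. *)

Section PolynomialFunctions.
Variables (C : fieldType) (T : finType).
Implicit Types (f : point C T -> C) (df : point C T -> point C T -> C).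

(** Keeps the function, its differential and the representing polynomial apart, so that
    determinants, adjugates and traces are differentiated by the Leibniz rule without naming a
    polynomial. *)
Definition pdiff f df := exists F : polyfun C T,
  (forall x, f x = evalp F x) /\ (forall x u, df x u = differential F x u).

Definition pfun f := exists df, pdiff f df.

Lemma pfun_pdiff f df : pdiff f df -> pfun f.
Proof. by move=> fP; exists df. Qed.

Lemma pdiff_evalp (F : polyfun C T) : pdiff (evalp F) (differential F).
Proof. by exists F. Qed.

Lemma differentialM (F G : polyfun C T) x u :
  differential (F * G) x u
  = differential F x u * evalp G x + evalp F x * differential G x u.
Proof.
rewrite /differential mulr_suml mulr_sumr -big_split; apply: eq_bigr => a _ /=.
by rewrite /partial_at /evalp mderivM mevalD !mevalM; ring.
Qed.

Lemma pdiff_const c : pdiff (fun=> c) (fun _ _ => 0).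
Proof.
exists c%:MP; split=> [x|x u]; first by rewrite /evalp mevalC.
by rewrite /differential big1 // => a _; rewrite /partial_at /evalp mderivC meval0 mul0r.
Qed.

Lemma pdiff_coord t : pdiff (fun x => x t) (fun _ u => u t).
Proof.
exists 'X_(enum_rank t); split=> [x|x u].
  by rewrite /evalp mevalXU enum_rankK.
rewrite /differential (bigD1 (enum_rank t)) //= big1 => [|a neq_a].
  rewrite /partial_at /evalp mderivX mnmE eqxx mevalZ.
  by rewrite -{1}[U_(_)%MM]add0m addmK mpolyX0 meval1 !mul1r enum_rankK addr0.
rewrite /partial_at /evalp mderivX mnmE eq_sym (negPf neq_a) /=.
by rewrite scale0r meval0 mul0r.
Qed.

Lemma pdiffD f g df dg :
  pdiff f df -> pdiff g dg ->
  pdiff (fun x => f x + g x) (fun x u => df x u + dg x u).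
Proof.
move=> [F [fE dfE]] [G [gE dgE]]; exists (F + G); split=> [x|x u].
  by rewrite /evalp mevalD fE gE.
rewrite dfE dgE /differential -big_split; apply: eq_bigr => a _ /=.
by rewrite /partial_at /evalp mderivD mevalD mulrDl.
Qed.

Lemma pdiffM f g df dg :
  pdiff f df -> pdiff g dg ->
  pdiff (fun x => f x * g x) (fun x u => df x u * g x + f x * dg x u).
Proof.
move=> [F [fE dfE]] [G [gE dgE]]; exists (F * G); split=> [x|x u].
  by rewrite /evalp mevalM fE gE.
by rewrite dfE dgE differentialM fE gE.
Qed.

Lemma pdiffZ c f df :
  pdiff f df -> pdiff (fun x => c * f x) (fun x u => c * df x u).
Proof.
move=> /(pdiffM (pdiff_const c)); congr pdiff.
by apply: funext => x; apply: funext => u; rewrite mul0r add0r.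
Qed.

Lemma pdiffN f df : pdiff f df -> pdiff (fun x => - f x) (fun x u => - df x u).
Proof.
move=> /(pdiffZ (-1)); congr pdiff; first by apply: funext => x; rewrite mulN1r.
by apply: funext => x; apply: funext => u; rewrite mulN1r.
Qed.

Lemma pdiffB f g df dg :
  pdiff f df -> pdiff g dg ->
  pdiff (fun x => f x - g x) (fun x u => df x u - dg x u).
Proof. by move=> fP /pdiffN; apply: pdiffD. Qed.

Lemma pdiff_sum (I : Type) (r : seq I) (P : pred I) (f : I -> point C T -> C)
    (df : I -> point C T -> point C T -> C) :
  (forall i, pdiff (f i) (df i)) ->
  pdiff (fun x => \sum_(i <- r | P i) f i x) (fun x u => \sum_(i <- r | P i) df i x u).
Proof.
move=> fP; elim: r => [|i r IHr].
  have := pdiff_const 0; congr pdiff; first by apply: funext => x; rewrite big_nil.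
  by apply: funext => x; apply: funext => u; rewrite big_nil.
have: pdiff (fun x => if P i then f i x + \sum_(i <- r | P i) f i x
                      else \sum_(i <- r | P i) f i x)
            (fun x u => if P i then df i x u + \sum_(i <- r | P i) df i x u
                      else \sum_(i <- r | P i) df i x u).
  by case: (P i) => //; apply: pdiffD.
congr pdiff; first by apply: funext => x; rewrite big_cons.
by apply: funext => x; apply: funext => u; rewrite big_cons.
Qed.

Lemma pfun_const c : pfun (fun=> c).
Proof. exact: pfun_pdiff (pdiff_const c). Qed.

Lemma pfun_coord t : pfun (fun x => x t).
Proof. exact: pfun_pdiff (pdiff_coord t). Qed.

Lemma pfunM f g : pfun f -> pfun g -> pfun (fun x => f x * g x).
Proof. by move=> [df fP] [dg gP]; apply: pfun_pdiff (pdiffM fP gP). Qed.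

Lemma pfun_sum (I : Type) (r : seq I) (P : pred I) (f : I -> point C T -> C) :
  (forall i, pfun (f i)) -> pfun (fun x => \sum_(i <- r | P i) f i x).
Proof. by move=> /choice[df fP]; apply: pfun_pdiff (pdiff_sum r P fP). Qed.

Lemma pfun_prod (I : Type) (r : seq I) (P : pred I) (f : I -> point C T -> C) :
  (forall i, pfun (f i)) -> pfun (fun x => \prod_(i <- r | P i) f i x).
Proof.
move=> fP; elim: r => [|i r IHr].
  by have := pfun_const 1; congr pfun; apply: funext => x; rewrite big_nil.
have: pfun (fun x => if P i then f i x * \prod_(i <- r | P i) f i x
                      else \prod_(i <- r | P i) f i x).
  by case: (P i) => //; apply: pfunM.
by congr pfun; apply: funext => x; rewrite big_cons.
Qed.

(** Turns [pdiff] into an inductive predicate with four rules, so that analytic estimates and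
    pull-backs are proved without monomials. *)
Lemma pdiff_ind (P : (point C T -> C) -> (point C T -> point C T -> C) -> Prop) :
  (forall c, P (fun=> c) (fun _ _ => 0)) ->
  (forall t, P (fun x => x t) (fun _ u => u t)) ->
  (forall f g df dg, P f df -> P g dg ->
     P (fun x => f x + g x) (fun x u => df x u + dg x u)) ->
  (forall f g df dg, P f df -> P g dg ->
     P (fun x => f x * g x) (fun x u => df x u * g x + f x * dg x u)) ->
  forall f df, pdiff f df -> P f df.
Proof.
move=> Pc Px PD PM f df [F [/funext -> dfE]].
have -> : df = differential F by apply: funext => x; apply: funext => u.
pose K (F : polyfun C T) := P (evalp F) (differential F).
have KD G H : K G -> K H -> K (G + H).
  move=> KG KH; have := PD _ _ _ _ KG KH; rewrite /K; congr P.
    by apply: funext => x; rewrite /evalp mevalD.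
  apply: funext => x; apply: funext => u.
  rewrite /differential -big_split; apply: eq_bigr => a _ /=.
  by rewrite /partial_at /evalp mderivD mevalD mulrDl.
have KM G H : K G -> K H -> K (G * H).
  move=> KG KH; have := PM _ _ _ _ KG KH; rewrite /K; congr P.
    by apply: funext => x; rewrite /evalp mevalM.
  by apply: funext => x; apply: funext => u; rewrite differentialM.
have KC c : K c%:MP.
  have := Pc c; rewrite /K; congr P; first by apply: funext => x; rewrite /evalp mevalC.
  apply: funext => x; apply: funext => u; rewrite /differential big1 // => a _.
  by rewrite /partial_at /evalp mderivC meval0 mul0r.
have KX a : K 'X_a.
  have := Px (enum_val a); rewrite /K; congr P.
    by apply: funext => x; rewrite /evalp mevalXU.
  apply: funext => x; apply: funext => u.
  rewrite /differential (bigD1 a) //= big1 => [|b neq_b].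
    rewrite /partial_at /evalp mderivX mnmE eqxx mevalZ.
    by rewrite -{1}[U_(_)%MM]add0m addmK mpolyX0 meval1 !mul1r addr0.
  rewrite /partial_at /evalp mderivX mnmE eq_sym (negPf neq_b) /=.
  by rewrite scale0r meval0 mul0r.
rewrite -/(K F) (mpolyE F); apply: (big_ind K) => [|//|m _]; first by rewrite -mpolyC0; apply: KC.
rewrite -mul_mpolyC; apply: (KM) => //; rewrite mpolyXE_id.
apply: (big_ind K) => [|//|a _]; first by rewrite -mpolyC1; apply: KC.
by elim: (m a) => [|k IHk]; rewrite ?expr0 ?exprS; [rewrite -mpolyC1; apply: KC|apply: (KM)].
Qed.

End PolynomialFunctions.

(** * Linear forms and linear maps in coordinates *)

Section Linear.
Variables (C : fieldType) (T : finType).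

Definition lcomb (a : C) (u v : point C T) : point C T := [ffun t => a * u t + v t].

Definition unitp (t : T) : point C T := [ffun t' => (t' == t)%:R].

Definition linform (f : point C T -> C) :=
  forall a u v, f (lcomb a u v) = a * f u + f v.

Lemma linform_sum f : linform f -> forall u, f u = \sum_t u t * f (unitp t).
Proof.
move=> lf; have f0 : f 0 = 0.
  have := lf (-1) 0 0; have -> : lcomb (-1) 0 0 = 0.
    by apply/ffunP => t; rewrite !ffunE mulr0 addr0.
  by rewrite mulN1r addNr.
move=> u; have {1}-> : u = \sum_t [ffun t' => u t * unitp t t'].
  apply/ffunP => t; rewrite sum_ffunE (bigD1 t) //= big1 => [|t' neq_t].
    by rewrite !ffunE eqxx mulr1 addr0.
  by rewrite !ffunE eq_sym (negPf neq_t) mulr0.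
elim: (index_enum T) => [|t r IHr]; first by rewrite !big_nil.
rewrite !big_cons -IHr -lf; congr f.
by apply/ffunP => t'; rewrite !ffunE.
Qed.

Lemma linformD f u v : linform f -> f (u + v) = f u + f v.
Proof.
by move=> lf; rewrite !(linform_sum lf) -big_split; apply: eq_bigr => t _; rewrite ffunE mulrDl.
Qed.

Lemma linform0 f : linform f -> f 0 = 0.
Proof. by move=> /linform_sum ->; rewrite big1 // => t _; rewrite ffunE mul0r. Qed.

Lemma pdiff_linform f : linform f -> pdiff f (fun _ => f).
Proof.
move=> /linform_sum fE; have := pdiff_sum (index_enum T) xpredT (fun t =>
  pdiffZ (f (unitp t)) (@pdiff_coord C T t)).
congr pdiff; first by apply: funext => x; rewrite fE; apply: eq_bigr => t _; rewrite mulrC.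
apply: funext => _; apply: funext => x; rewrite fE; apply: eq_bigr => t _.
by rewrite mulrC.
Qed.

Lemma pfun_linform f : linform f -> pfun f.
Proof. by move=> /pdiff_linform /pfun_pdiff. Qed.

Lemma pdiff_bilin (b : point C T -> point C T -> C) :
  (forall x, linform (b x)) -> (forall y, linform (b^~ y)) ->
  pdiff (fun x => b x x) (fun x u => b u x + b x u).
Proof.
move=> lr ll; pose c t t' := b (unitp t) (unitp t').
have bE x y : b x y = \sum_t \sum_t' c t t' * (x t * y t').
  rewrite (linform_sum (ll y)); apply: eq_bigr => t _.
  rewrite (linform_sum (lr _)) mulr_sumr; apply: eq_bigr => t' _.
  by rewrite /c mulrA mulrC mulrA.
have := pdiff_sum (index_enum T) xpredT (fun t => pdiff_sum (index_enum T) xpredT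
  (fun t' => pdiffZ (c t t') (pdiffM (@pdiff_coord C T t) (@pdiff_coord C T t')))).
congr pdiff; first by apply: funext => x; rewrite bE.
apply: funext => x; apply: funext => u; rewrite !bE -big_split; apply: eq_bigr => t _.
by rewrite -big_split; apply: eq_bigr => t' _; rewrite mulrDr.
Qed.

End Linear.

Section LinearMaps.
Variables (C : fieldType).

Definition colp (T : finType) (u : point C T) : 'cV[C]_#|T| := \col_a u (enum_val a).
Definition pcol (T : finType) (c : 'cV[C]_#|T|) : point C T := [ffun t => c (enum_rank t) 0].

Lemma colpK T : cancel (@colp T) (@pcol T).
Proof. by move=> u; apply/ffunP => t; rewrite ffunE mxE enum_rankK. Qed.

Lemma pcolK T : cancel (@pcol T) (@colp T).
Proof. by move=> c; apply/matrixP => a j; rewrite mxE ffunE enum_valK ord1. Qed.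

Definition linmap (T S : finType) (psi : point C T -> point C S) :=
  forall s, linform (fun u => psi u s).

Definition mxof (T S : finType) (psi : point C T -> point C S) : 'M[C]_(#|S|, #|T|) :=
  \matrix_(a, b) psi (unitp C (enum_val b)) (enum_val a).

Lemma mxofE (T S : finType) (psi : point C T -> point C S) u :
  linmap psi -> mxof psi *m colp u = colp (psi u).
Proof.
move=> lpsi; apply/matrixP => a j; rewrite !mxE (linform_sum (lpsi _)).
rewrite (reindex (@enum_val T T)) /=; last exact/onW_bij/enum_val_bij.
by apply: eq_bigr => b _; rewrite !mxE mulrC.
Qed.

Lemma colp_eq0 (T : finType) (u : point C T) : colp u = 0 -> u = 0.
Proof.
by move=> u0; rewrite -[u]colpK u0; apply/ffunP => t; rewrite !ffunE mxE.
Qed.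

End LinearMaps.

(** * Matrices of polynomial functions *)

Section MatrixFunctions.
Variables (C : fieldType) (T : finType).

Definition mdiff (m n : nat) (A : point C T -> 'M[C]_(m, n))
    (dA : point C T -> point C T -> 'M[C]_(m, n)) :=
  forall i j, pdiff (fun x => A x i j) (fun x u => dA x u i j).

Definition mfun (m n : nat) (A : point C T -> 'M[C]_(m, n)) :=
  forall i j, pfun (fun x => A x i j).

Lemma mfun_mdiff m n (A : point C T -> 'M[C]_(m, n)) :
  mfun A -> exists dA, mdiff A dA.
Proof.
move=> fA; have /choice[d dP] : forall ij : 'I_m * 'I_n, exists df,
    pdiff (fun x => A x ij.1 ij.2) df by move=> ij; apply: fA.
exists (fun x u => \matrix_(i, j) d (i, j) x u) => i j.
have := dP (i, j); congr pdiff.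
by apply: funext => x; apply: funext => u; rewrite mxE.
Qed.

Lemma mdiff_mfun m n (A : point C T -> 'M[C]_(m, n)) dA : mdiff A dA -> mfun A.
Proof. by move=> dP i j; apply: pfun_pdiff (dP i j). Qed.

Lemma mdiff_const m n (A : 'M[C]_(m, n)) : mdiff (fun=> A) (fun _ _ => 0).
Proof.
move=> i j; have := pdiff_const T (A i j); congr pdiff.
by apply: funext => x; apply: funext => u; rewrite mxE.
Qed.

Lemma mdiffB m n (A B : point C T -> 'M[C]_(m, n)) dA dB :
  mdiff A dA -> mdiff B dB ->
  mdiff (fun x => A x - B x) (fun x u => dA x u - dB x u).
Proof.
move=> dAP dBP i j; have := pdiffB (dAP i j) (dBP i j); congr pdiff.
  by apply: funext => x; rewrite !mxE.
by apply: funext => x; apply: funext => u; rewrite !mxE.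
Qed.

Lemma mdiffM m n p (A : point C T -> 'M[C]_(m, n)) (B : point C T -> 'M[C]_(n, p)) dA dB :
  mdiff A dA -> mdiff B dB ->
  mdiff (fun x => A x *m B x) (fun x u => dA x u *m B x + A x *m dB x u).
Proof.
move=> dAP dBP i j; have := pdiff_sum (index_enum 'I_n) xpredT
  (fun k => pdiffM (dAP i k) (dBP k j)); congr pdiff.
  by apply: funext => x; rewrite !mxE.
apply: funext => x; apply: funext => u; rewrite !mxE -big_split.
by apply: eq_bigr => k _.
Qed.

Lemma mdiffZ m n (f : point C T -> C) (A : point C T -> 'M[C]_(m, n)) df dA :
  pdiff f df -> mdiff A dA ->
  mdiff (fun x => f x *: A x) (fun x u => df x u *: A x + f x *: dA x u).
Proof.
move=> dfP dAP i j; have := pdiffM dfP (dAP i j); congr pdiff.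
  by apply: funext => x; rewrite !mxE.
by apply: funext => x; apply: funext => u; rewrite !mxE.
Qed.

Lemma mfunM m n p (A : point C T -> 'M[C]_(m, n)) (B : point C T -> 'M[C]_(n, p)) :
  mfun A -> mfun B -> mfun (fun x => A x *m B x).
Proof. by move=> /mfun_mdiff[dA dAP] /mfun_mdiff[dB dBP]; apply/mdiff_mfun/mdiffM. Qed.

Lemma mfun_const m n (A : 'M[C]_(m, n)) : mfun (fun=> A).
Proof. exact: mdiff_mfun (mdiff_const A). Qed.

Lemma pfun_det n (A : point C T -> 'M[C]_n) : mfun A -> pfun (fun x => \det (A x)).
Proof.
move=> fA; apply: pfun_sum => s; apply: pfunM; first exact: pfun_const.
by apply: pfun_prod => i; apply: fA.
Qed.

Lemma mfun_adj n (A : point C T -> 'M[C]_n) : mfun A -> mfun (fun x => \adj (A x)).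
Proof.
move=> fA i j; have: pfun (fun x => cofactor (A x) j i).
  apply: pfunM; first exact: pfun_const.
  apply: pfun_det => k l; have := fA (lift j k) (lift i l); congr pfun.
  by apply: funext => x; rewrite !mxE.
by congr pfun; apply: funext => x; rewrite mxE.
Qed.

Lemma mfun_col_mx m n p (A : point C T -> 'M[C]_(m, p)) (B : point C T -> 'M[C]_(n, p)) :
  mfun A -> mfun B -> mfun (fun x => col_mx (A x) (B x)).
Proof.
move=> fA fB i j; have: pfun (fun x => match split i with inl k => A x k j | inr k => B x k j end).
  by case: (split i) => k; [apply: fA | apply: fB].
by congr pfun; apply: funext => x; rewrite mxE.
Qed.

Lemma mfun_castmx m n m' n' (e : (m = m') * (n = n')) (A : point C T -> 'M[C]_(m, n)) :
  mfun A -> mfun (fun x => castmx e (A x)).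
Proof.
move=> fA i j; have := fA (cast_ord (esym e.1) i) (cast_ord (esym e.2) j).
by congr pfun; apply: funext => x; rewrite castmxE.
Qed.

End MatrixFunctions.

(** * Zariski tangent spaces at smooth points *)

Lemma linform_pdiff (C : fieldType) (T : finType) (f : point C T -> C) df x :
  pdiff f df -> linform (df x).
Proof.
move=> [F [_ dfE]] a u v; rewrite !dfE /differential mulr_sumr -big_split.
by apply: eq_bigr => b _ /=; rewrite ffunE; ring.
Qed.

(** * First-order Taylor remainders of polynomials *)

Section Remainder.
Variables (C : numFieldType) (T : finType).
Implicit Types (f : point C T -> C) (df : point C T -> point C T -> C).

Lemma linform_bound (phi : point C T -> C) : linform phi ->
  exists2 K : C, 0 <= K & forall (r : C) (h : point C T),
    (forall t, `|h t| <= r) -> `|phi h| <= K * r.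
Proof.
move=> lphi; exists (\sum_t `|phi (unitp C t)|); first by apply: sumr_ge0.
move=> r h hr; rewrite (linform_sum lphi) mulr_suml.
apply: le_trans (ler_norm_sum _ _ _) _; apply: ler_sum => t _.
by rewrite normrM mulrC ler_wpM2l.
Qed.

Definition remainder f df x h := f (x + h) - f x - df x h.

Lemma remainder0 f df x : linform (df x) -> remainder f df x 0 = 0.
Proof. by move=> lf; rewrite /remainder addr0 subrr (linform0 lf) subr0. Qed.

(** On the ball of radius [r] the remainder has Lipschitz constant [M * r]. A small [r] makes
    Newton's map contracting, and [h' = 0] gives the quadratic bound on the remainder. *)
Lemma remainder_lipschitz f df x : pdiff f df ->
  exists2 M : C, 0 <= M & forall (r e : C) (h h' : point C T), 0 <= r -> r <= 1 -> 0 <= e ->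
    (forall t, `|h t| <= r) -> (forall t, `|h' t| <= r) ->
    (forall t, `|h t - h' t| <= e) ->
    `|remainder f df x h - remainder f df x h'| <= M * r * e.
Proof.
pose lip f df := exists2 M : C, 0 <= M & forall (r e : C) (h h' : point C T),
    0 <= r -> r <= 1 -> 0 <= e ->
    (forall t, `|h t| <= r) -> (forall t, `|h' t| <= r) ->
    (forall t, `|h t - h' t| <= e) ->
    `|remainder f df x h - remainder f df x h'| <= M * r * e.
pose P f df := linform (df x) /\ lip f df.
move=> fP; suff: P f df by case.
elim/pdiff_ind: f df / fP => [c|t|f g df dg [lf [M M0 fM]] [lg [N N0 gN]]|
  f g df dg [lf [M M0 fM]] [lg [N N0 gN]]].
- split=> [a u v|]; first by rewrite mulr0 addr0.
  by exists 0 => // r e h h' _ _ _ _ _ _; rewrite /remainder !subrr normr0 !mul0r.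
- split=> [a u v|]; first by rewrite ffunE.
  exists 0 => // r e h h' _ _ _ _ _ _; rewrite /remainder !ffunE.
  have -> : x t + h t - x t - h t - (x t + h' t - x t - h' t) = 0 by ring.
  by rewrite normr0 !mul0r.
- split=> [a u v|]; first by rewrite lf lg; ring.
  exists (M + N); first exact: addr_ge0.
  move=> r e h h' r0 r1 e0 hr hr' he; rewrite /remainder.
  set X := (X in `|X|); have -> : X =
      (remainder f df x h - remainder f df x h') + (remainder g dg x h - remainder g dg x h').
    by rewrite /X /remainder; ring.
  rewrite !mulrDl; apply: le_trans (ler_normD _ _) _.
  by apply: lerD; [apply: fM | apply: gN].
split=> [a u v|]; first by rewrite lf lg; ring.
have [K K0 fK] := linform_bound lf; have [L L0 gL] := linform_bound lg.
exists (`|f x| * N + `|g x| * M + ((K + M) * (L + N) + (K + M) * (L + N))).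
  by rewrite !addr_ge0 ?mulr_ge0 ?addr_ge0.
move=> r e h h' r0 r1 e0 hr hr' he.
(* [p h] and [q h] are the increments of [f] and [g] at [x]. The remainder of the product is [f x]
   times that of [g], plus [g x] times that of [f], plus [p h * q h]. *)
pose p h := df x h + remainder f df x h; pose q h := dg x h + remainder g dg x h.
have subE phi u v : linform phi -> phi u - phi v = phi (u - v) :> C.
  by move=> lphi; rewrite -{1}[u](subrK v) (linformD (u - v) v lphi) addrK.
have dif phi dphi Kp Mp u v d : linform (dphi x) ->
    (forall r (h : point C T), (forall t, `|h t| <= r) -> `|dphi x h| <= Kp * r) ->
    0 <= Mp -> 0 <= d ->
    `|remainder phi dphi x u - remainder phi dphi x v| <= Mp * r * d ->
    (forall t, `|u t - v t| <= d) ->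
    `|dphi x u + remainder phi dphi x u - (dphi x v + remainder phi dphi x v)| <= (Kp + Mp) * d.
  move=> lphi bphi Mp0 d0 rem_le uv_le; rewrite opprD addrACA subE // mulrDl.
  apply: le_trans (ler_normD _ _) _; apply: lerD; first by apply: bphi => t; rewrite !ffunE.
  by apply: le_trans rem_le _; rewrite -mulrA ler_wpM2l // ler_piMl.
have zero_le t : `|(0 : point C T) t| <= r by rewrite ffunE normr0.
have p_sub : `|p h - p h'| <= (K + M) * e by apply: dif => //; apply: fM.
have q_sub : `|q h - q h'| <= (L + N) * e by apply: dif => //; apply: gN.
have q_le : `|q h| <= (L + N) * r.
  have := @dif g dg L N h 0 r lg gL N0 r0 (gN _ _ _ _ r0 r1 r0 hr zero_le _).
  rewrite linform0 // remainder0 // addr0 subr0; apply=> t; rewrite ffunE subr0; exact: hr.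
have p_le : `|p h'| <= (K + M) * r.
  have := @dif f df K M h' 0 r lf fK M0 r0 (fM _ _ _ _ r0 r1 r0 hr' zero_le _).
  rewrite linform0 // remainder0 // addr0 subr0; apply=> t; rewrite ffunE subr0; exact: hr'.
rewrite [X in `|X|](_ : _ = f x * (remainder g dg x h - remainder g dg x h')
    + g x * (remainder f df x h - remainder f df x h')
    + ((p h - p h') * q h + p h' * (q h - q h'))); last first.
  by rewrite /p /q /remainder; ring.
rewrite [leRHS](_ : _ = (`|f x| * (N * r * e) + `|g x| * (M * r * e))
    + ((K + M) * e * ((L + N) * r) + (K + M) * r * ((L + N) * e))); last by ring.
apply: le_trans (ler_normD _ _) _; apply: lerD.
  apply: le_trans (ler_normD _ _) _; rewrite !normrM; apply: lerD.
    by rewrite ler_wpM2l // gN.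
  by rewrite ler_wpM2l // fM.
apply: le_trans (ler_normD _ _) _; rewrite !normrM.
by apply: lerD; apply: ler_pM.
Qed.

End Remainder.

(** * Limits and fixed points over the complex numbers *)

Section Completeness.
Variable R : realType.
Local Notation C := R[i].
Local Notation "x %:C" := (x%:C%C) (format "x %:C").

(** The radius [2 * c * 2^-1 ^+ n] is the tail of the geometric series, so the intervals of this
    radius around [a n] are nested; the limit is the supremum of their left ends. *)
Lemma real_geometric_limit (a : nat -> R) (c : R) :
  (forall n, `|a n.+1 - a n| <= c * 2^-1 ^+ n) ->
  exists l, forall n, `|l - a n| <= 2 * c * 2^-1 ^+ n.
Proof.
move=> ac; pose e n := 2 * c * 2^-1 ^+ n : R.
have eS n : e n = e n.+1 + c * 2^-1 ^+ n by rewrite /e exprS; field.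
have lo_le n m : (n <= m)%N -> a n - e n <= a m - e m.
  move=> /subnK <-; elim: (m - n)%N => // k IHk; rewrite addSn.
  apply: le_trans IHk _; have := ac (k + n)%N; rewrite ler_norml => /andP[ac1 _].
  have := eS (k + n)%N; lra.
have hi_le n m : (n <= m)%N -> a m + e m <= a n + e n.
  move=> /subnK <-; elim: (m - n)%N => // k IHk; rewrite addSn.
  apply: le_trans _ IHk; have := ac (k + n)%N; rewrite ler_norml => /andP[_ ac1].
  have := eS (k + n)%N; lra.
have e0 n : 0 <= e n.
  have c0 : 0 <= c by have := ac 0%N; rewrite expr0 mulr1; apply: le_trans.
  by rewrite /e !mulr_ge0 // exprn_ge0 // invr_ge0.
have lohi n m : a n - e n <= a m + e m.
  case: (leqP n m) => [/lo_le|/ltnW /hi_le] le_nm; have := e0 n; have := e0 m; lra.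
pose E x := exists n, x = a n - e n.
have E0 : E (a 0%N - e 0%N) by exists 0%N.
have Eub m x : E x -> x <= a m + e m by move=> [n ->].
exists (sup E) => n; rewrite -/(e n) ler_norml.
have := @ub_le_sup _ E (ex_intro _ _ (Eub 0%N)) _ (ex_intro _ n erefl).
have := @ge_sup _ E _ (ex_intro _ _ E0) (Eub n).
by move=> ? ?; apply/andP; split; lra.
Qed.

Lemma norm_le_ReIm (z : C) : `|z| <= (`|complex.Re z| + `|complex.Im z|)%:C.
Proof.
have normR (r : R) : `|r%:C| = `|r|%:C :> C.
  by rewrite normc_def /= expr0n addr0 sqrtr_sqr.
have normi : `|'i%C| = 1 :> C.
  by rewrite normc_def /= expr0n add0r expr1n sqrtr1.
rewrite {1}[z]complexE rmorphD; apply: le_trans (ler_normD _ _) _.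
by rewrite normrM normi mul1r !normR.
Qed.

Lemma Im_le_norm (z : C) : `|complex.Im z|%:C <= `|z|.
Proof. by rewrite normc_def lecR -sqrtr_sqr ler_wsqrtr // lerDr sqr_ge0. Qed.

(** The constant 4 is 2 + 2: real and imaginary parts converge separately and their errors are
    added. *)
Lemma complex_geometric_limit (a : nat -> C) (c : R) :
  (forall n, `|a n.+1 - a n| <= (c * 2^-1 ^+ n)%:C) ->
  exists l, forall n, `|l - a n| <= (4 * c * 2^-1 ^+ n)%:C.
Proof.
move=> ac.
have [n|x xP] := @real_geometric_limit (fun n => complex.Re (a n)) c.
  rewrite -lecR; apply: le_trans (ac n).
  by rewrite -raddfB normc_ge_Re.
have [n|y yP] := @real_geometric_limit (fun n => complex.Im (a n)) c.
  rewrite -lecR; apply: le_trans (ac n).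
  by rewrite -raddfB Im_le_norm.
exists (x +i* y)%C => n; apply: le_trans (norm_le_ReIm _) _.
rewrite lecR !raddfB /=; have := xP n; have := yP n; lra.
Qed.

Lemma geometric_le0 (x : C) (c : R) :
  (forall n, `|x| <= (c * 2^-1 ^+ n)%:C) -> x = 0.
Proof.
rewrite normc_def => xc; set r := Num.sqrt _ in xc.
have {}xc n : r <= c * 2^-1 ^+ n by have := xc n; rewrite lecR.
apply/eqP; rewrite -normr_eq0 normc_def -/r; apply/eqP; congr _%:C.
apply/eqP; rewrite eq_le sqrtr_ge0 andbT leNgt; apply/negP; rewrite -/r => r0.
have c0 : 0 <= c by have := xc 0%N; rewrite expr0 mulr1; apply: le_trans (ltW r0).
have := archi_boundP (divr_ge0 c0 (ltW r0)); set n := Num.bound _.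
rewrite ltr_pdivrMr // => /lt_le_trans lt_c.
have := xc n; rewrite exprVn ler_pdivlMr ?exprn_gt0 // leNgt => /negP; apply.
apply: lt_c; rewrite mulrC ler_wpM2l ?(ltW r0) // -natrX ler_nat.
exact/ltnW/ltn_expl.
Qed.

(** Banach iteration from 0 with ratio 1/2, norms being taken coordinatewise. The iterates stay
    within [2 * c], but the limit is only known to be within [4 * c], and it too must lie in the
    ball where [Phi] contracts. *)
Lemma fixpoint (I : finType) (Phi : point C I -> point C I) (tau c : C) :
  0 <= c -> 4 * c <= tau ->
  (forall (s s' : point C I) (e : C), 0 <= e ->
     (forall i, `|s i| <= tau) -> (forall i, `|s' i| <= tau) ->
     (forall i, `|s i - s' i| <= e) -> forall i, `|Phi s i - Phi s' i| <= e / 2) ->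
  (forall i, `|Phi 0 i| <= c) ->
  exists2 s : point C I, Phi s = s & forall i, `|s i| <= 4 * c.
Proof.
move=> c_ge0 c_le Phi_contr Phi0; pose s n := iter n Phi 0.
have [d d0 cE] : exists2 d : R, 0 <= d & c = d%:C.
  exists (complex.Re c); last by rewrite RRe_real // ger0_real.
  by have := c_ge0; rewrite lecE => /andP[].
pose h n := (d * 2^-1 ^+ n)%:C : C.
have h0 n : 0 <= h n by rewrite lecR mulr_ge0 // exprn_ge0 // invr_ge0.
have hS n : h n.+1 = h n / 2.
  by rewrite /h exprS mulrCA rmorphM mulrC fmorphV rmorph_nat.
have tau_ge0 : 0 <= tau by apply: le_trans c_le; rewrite mulr_ge0.
have sP n : (forall i, `|s n i| <= 2 * c - 2 * h n) /\ (forall i, `|s n.+1 i - s n i| <= h n).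
  elim: n => [|n [sn dsn]].
    split=> i; first by rewrite ffunE normr0 /h expr0 mulr1 -cE subrr.
    by rewrite /s /= ffunE subr0 /h expr0 mulr1 -cE.
  have sn1 i : `|s n.+1 i| <= 2 * c - 2 * h n.+1.
    rewrite -(subrK (s n i) (s n.+1 i)); apply: le_trans (ler_normD _ _) _.
    apply: le_trans (lerD (dsn i) (sn i)) _; rewrite hS.
    by rewrite [leLHS](_ : _ = 2 * c - 2 * (h n / 2)) //; field.
  split=> // i; rewrite hS; apply: Phi_contr => // j.
    apply: le_trans (sn1 j) _; apply: le_trans c_le; rewrite lerBlDr -[leLHS]addr0.
    by apply: lerD; rewrite ?mulr_ge0 // ler_wpM2r // ler_nat.
  apply: le_trans (sn j) _; apply: le_trans c_le; rewrite lerBlDr -[leLHS]addr0.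
  by apply: lerD; rewrite ?mulr_ge0 // ler_wpM2r // ler_nat.
have /choice[l lP] : forall i, exists l, forall n, `|l - s n i| <= (4 * d * 2^-1 ^+ n)%:C.
  by move=> i; apply: complex_geometric_limit => n; have [_] := sP n; apply.
have l_le i : `|[ffun i => l i] i| <= 4 * c.
  have := lP i 0%N; rewrite ffunE /s /= ffunE subr0 expr0 mulr1 rmorphM cE.
  by rewrite rmorph_nat.
exists [ffun i => l i] => //; apply/ffunP => i; apply/eqP; rewrite -subr_eq0; apply/eqP.
apply: (@geometric_le0 _ (4 * d)) => n; pose e := (4 * d * 2^-1 ^+ n.+1)%:C : C.
have e0 : 0 <= (4 * d * 2^-1 ^+ n)%:C :> C.
  by rewrite lecR !mulr_ge0 // exprn_ge0 // invr_ge0.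
rewrite -(subrK (s n.+1 i) (Phi _ i)) -addrA; apply: le_trans (ler_normD _ _) _.
have eE : (4 * d * 2^-1 ^+ n)%:C = (4 * d * 2^-1 ^+ n)%:C / 2 + (4 * d * 2^-1 ^+ n.+1)%:C :> C.
  by rewrite exprS mulrCA [X in _ = _ + X]rmorphM fmorphV rmorph_nat; field.
rewrite eE; apply: lerD; last by rewrite ffunE distrC lP.
apply: Phi_contr => // j; last by rewrite ffunE lP.
  exact: le_trans (l_le j) c_le.
have [sn _] := sP n; apply: le_trans (sn j) _; apply: le_trans c_le; rewrite lerBlDr -[leLHS]addr0.
by apply: lerD; rewrite ?mulr_ge0 // ler_wpM2r // ler_nat.
Qed.

End Completeness.

(** * Independent families of linear forms *)

Section Independence.
Variables (C : fieldType) (I T : finType).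
Implicit Types phi : I -> point C T -> C.

Definition independent phi :=
  forall lam : I -> C, (forall u, \sum_i lam i * phi i u = 0) -> forall i, lam i = 0.

Definition coef_mx phi : 'M[C]_(#|I|, #|T|) :=
  \matrix_(i, t) phi (enum_val i) (unitp C (enum_val t)).

Lemma coef_mxE phi u : (forall i, linform (phi i)) ->
  coef_mx phi *m colp u = colp [ffun i => phi i u].
Proof.
move=> lphi; rewrite -(@mxofE _ _ _ (fun u => [ffun i => phi i u])); last first.
  by move=> i a v w; rewrite !ffunE lphi.
by congr (_ *m _); apply/matrixP => i t; rewrite !mxE ffunE.
Qed.

Lemma row_free_indep phi : (forall i, linform (phi i)) ->
  row_free (coef_mx phi) <-> independent phi.
Proof.
move=> lphi; split=> [free_phi lam lam0 i|indep_phi].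
  pose L : 'rV_#|I| := (colp [ffun i => lam i])^T.
  suff L0 : L = 0.
    by have := congr1 (fun A : 'rV_#|I| => A 0 (enum_rank i)) L0; rewrite !mxE ffunE enum_rankK.
  apply: (row_free_inj free_phi); rewrite mul0mx; apply/matrixP => z b.
  rewrite !mxE -[RHS](lam0 (unitp C (enum_val b))).
  rewrite (reindex (@enum_val I I)) /=; last exact/onW_bij/enum_val_bij.
  by apply: eq_bigr => a _; rewrite !mxE ffunE.
rewrite -kermx_eq0; apply/rowV0P => L /sub_kermxP L0; apply/matrixP => z a.
rewrite ord1 mxE -[a]enum_valK; apply: (indep_phi (fun i => L 0 (enum_rank i))) => u.
have := congr1 (fun A : 'M_(1, _) => (A *m colp u) 0 0) L0.
rewrite -mulmxA coef_mxE // mul0mx !mxE => L0u; rewrite -[RHS]L0u.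
rewrite (reindex (@enum_val I I)) /=; last exact/onW_bij/enum_val_bij.
by apply: eq_bigr => b _; rewrite enum_valK !mxE ffunE.
Qed.

Lemma indep_dual phi : (forall i, linform (phi i)) -> independent phi ->
  exists a : I -> point C T, forall i j, phi i (a j) = (i == j)%:R.
Proof.
move=> lphi /(row_free_indep lphi) free_phi.
exists (fun j => pcol (col (enum_rank j) (pinvmx (coef_mx phi)))) => i j.
have := coef_mxE (pcol (col (enum_rank j) (pinvmx (coef_mx phi)))) lphi.
rewrite pcolK colE mulmxA mulmxVp // mul1mx => /colP/(_ (enum_rank i)).
by rewrite !mxE ffunE enum_rankK (inj_eq enum_rank_inj) andbT => <-.
Qed.

Lemma linform_comb (f : point C T -> C) (s : I -> C) (a : I -> point C T) : linform f ->
  f [ffun t => \sum_j s j * a j t] = \sum_j s j * f (a j).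
Proof.
move=> lf; rewrite (linform_sum lf).
rewrite (eq_bigr (fun t => \sum_j s j * a j t * f (unitp C t))) => [|t _]; last first.
  by rewrite ffunE mulr_suml.
rewrite exchange_big; apply: eq_bigr => j _ /=; rewrite (linform_sum lf (a j)) mulr_sumr.
by apply: eq_bigr => t _; rewrite mulrA.
Qed.

End Independence.

(** * Points of a zero locus along a tangent direction *)

Section Newton.
Variables (R : realType).
Local Notation C := R[i].
Variables (I T : finType) (F : I -> point C T -> C) (dF : I -> point C T -> point C T -> C).
Variable (z : point C T).
Hypothesis FP : forall i, pdiff (F i) (dF i).
Hypothesis Fz0 : forall i, F i z = 0.
Hypothesis indF : independent (fun i => dF i z).

(* With a_j dual to the differentials dF_i, the point z + tau u + sum_j s_j a_j is
   a zero of F iff s is a fixed point of s |-> - remainder, which contracts a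
   ball of radius tau; the fixed point has size O(tau^2). *)
Lemma newton (u : point C T) : (forall i, dF i z u = 0) ->
  exists K : C, exists2 tau0 : C, 0 <= K /\ 0 < tau0 & forall tau : C, 0 <= tau -> tau <= tau0 ->
  exists2 h : point C T, forall i, F i (z + h) = 0 &
    forall t, `|h t - tau * u t| <= K * tau ^+ 2.
Proof.
move=> dFu0; have lF i := linform_pdiff z (FP i).
have [a aP] := indep_dual lF indF.
have /choice[M0 MP] : forall i, exists M : C, 0 <= M /\ forall (r e : C) (h h' : point C T),
    0 <= r -> r <= 1 -> 0 <= e ->
    (forall t, `|h t| <= r) -> (forall t, `|h' t| <= r) ->
    (forall t, `|h t - h' t| <= e) ->
    `|remainder (F i) (dF i) z h - remainder (F i) (dF i) z h'| <= M * r * e.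
  by move=> i; have [M M_ge0 ?] := remainder_lipschitz z (FP i); exists M.
pose M : C := \sum_i M0 i.
have M_ge0 : 0 <= M by apply: sumr_ge0 => i _; case: (MP i).
have MM i : M0 i <= M.
  rewrite /M (bigD1 i) //= lerDl; apply: sumr_ge0 => j _; by case: (MP j).
pose A : C := \sum_j \sum_t `|a j t|; pose U : C := \sum_t `|u t|.
have A0 : 0 <= A by apply: sumr_ge0 => j _; apply: sumr_ge0.
have U0 : 0 <= U by apply: sumr_ge0.
have uU t : `|u t| <= U by rewrite /U (bigD1 t) //= lerDl; apply: sumr_ge0.
have aA (s : I -> C) (e : C) t : 0 <= e -> (forall j, `|s j| <= e) ->
    `|\sum_j s j * a j t| <= A * e.
  move=> e0 se; apply: le_trans (ler_norm_sum _ _ _) _; rewrite /A mulr_suml.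
  apply: ler_sum => j _; rewrite normrM mulrC; apply: ler_pM => //.
  by rewrite (bigD1 t) //= lerDl; apply: sumr_ge0.
pose B : C := U + A; have B0 : 0 <= B by apply: addr_ge0.
(* For [tau <= D^-1] one has both [B * tau <= 1], required by the remainder estimate since [B * tau]
   bounds the displacement, and [4 * (M * B * B) * tau <= 1], which gives the contraction. *)
pose D : C := 4 * (M * B * B) + B + 1.
have MBB0 : 0 <= M * B * B by rewrite !mulr_ge0.
have D0 : 0 < D by rewrite ltr_wpDl // addr_ge0 // mulr_ge0.
exists (A * (4 * (M * B * B))); exists D^-1; first by rewrite invr_gt0 !mulr_ge0.
move=> tau tau0 tauD.
have tauD1 : tau * D <= 1 by rewrite -ler_pdivlMr // div1r.
have Bt1 : B * tau <= 1.
  by apply: le_trans tauD1; rewrite mulrC ler_wpM2l // /D addrAC lerDr addr_ge0 // mulr_ge0.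
have MBBt : 4 * (M * B * B) * tau <= 1.
  by apply: le_trans tauD1; rewrite mulrC ler_wpM2l // /D -addrA lerDl addr_ge0.
pose h (s : point C I) : point C T := lcomb tau u [ffun t => \sum_j s j * a j t].
have dFh s i : dF i z (h s) = s i.
  rewrite lF dFu0 mulr0 add0r linform_comb // (bigD1 i) //= big1 => [|j neq_j].
    by rewrite aP eqxx mulr1 addr0.
  by rewrite aP eq_sym (negPf neq_j) mulr0.
have h_le (s : point C I) t : (forall i, `|s i| <= tau) -> `|h s t| <= B * tau.
  move=> s_le; rewrite !ffunE mulrDl; apply: le_trans (ler_normD _ _) _.
  apply: lerD; last exact: aA.
  by rewrite normrM mulrC (ger0_norm tau0) ler_wpM2r.
pose Phi s : point C I := [ffun i => - remainder (F i) (dF i) z (h s)].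
have rem_le i (r e : C) (h1 h2 : point C T) : 0 <= r -> r <= 1 -> 0 <= e ->
    (forall t, `|h1 t| <= r) -> (forall t, `|h2 t| <= r) ->
    (forall t, `|h1 t - h2 t| <= e) ->
    `|remainder (F i) (dF i) z h1 - remainder (F i) (dF i) z h2| <= M * r * e.
  move=> r0 r1 e0 h1r h2r h12; have [_ Mi] := MP i.
  apply: le_trans (Mi _ _ _ _ r0 r1 e0 h1r h2r h12) _.
  by rewrite ler_wpM2r // ler_wpM2r.
have Bt0 : 0 <= B * tau by rewrite mulr_ge0.
have z0 i : `|(0 : point C I) i| <= tau by rewrite ffunE normr0.
have [||s s' e e0 s_le s'_le ss' i|i|s Phis s_le] :=
    @fixpoint R I Phi tau (M * (B * tau) * (B * tau)).
- by rewrite !mulr_ge0.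
- rewrite [leLHS](_ : _ = 4 * (M * B * B) * tau * tau); last by ring.
  by rewrite ler_piMl.
- rewrite !ffunE opprK addrC.
  have := @rem_le i (B * tau) (B * e) (h s') (h s) Bt0 Bt1 (mulr_ge0 B0 e0)
    (fun t => h_le s' t s'_le) (fun t => h_le s t s_le) _.
  move=> le_rem; apply: le_trans (le_rem _) _.
    move=> t; rewrite !ffunE opprD addrACA subrr add0r -sumrB.
    rewrite (eq_bigr (fun j => (s' j - s j) * a j t)); last by move=> j _; rewrite mulrBl.
    apply: le_trans (aA _ e _ e0 _) _ => [j|]; first by rewrite distrC.
    by rewrite ler_wpM2r // /B lerDr.
  rewrite [leLHS](_ : _ = 4 * (M * B * B) * tau * (e / 4)); last by field.
  have e4 : 0 <= e / 4 by rewrite divr_ge0.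
  apply: le_trans (ler_piMl e4 MBBt) _.
  by rewrite ler_wpM2l // lef_pV2 ?posrE ?ltr0n // ler_nat.
- rewrite ffunE normrN -[X in `|X|]subr0 -[X in _ - X](remainder0 (F i) (lF i)).
  apply: rem_le => // t; first exact: h_le.
    by rewrite ffunE normr0.
  by rewrite [X in _ - X]ffunE subr0 h_le.
exists (h s) => [i|t].
  have := congr1 (fun f : point C I => f i) Phis; rewrite ffunE /remainder dFh Fz0.
  by move=> /eqP; rewrite subr0 opprB -subr_eq0 addrAC subrr add0r oppr_eq0 => /eqP.
rewrite !ffunE addrAC subrr add0r; apply: le_trans (aA _ _ _ _ s_le) _.
  by rewrite !mulr_ge0.
by rewrite [leRHS](_ : _ = A * (4 * (M * (B * tau) * (B * tau)))) //; ring.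
Qed.

Lemma pdiff_continuous (f : point C T -> C) df x : pdiff f df ->
  exists2 K : C, 0 <= K & forall (r : C) (h : point C T), 0 <= r -> r <= 1 ->
    (forall t, `|h t| <= r) -> `|f (x + h) - f x| <= K * r.
Proof.
move=> fP; have lf := linform_pdiff x fP.
have [M M0 fM] := remainder_lipschitz x fP; have [K K0 fK] := linform_bound lf.
exists (K + M) => [|r h r0 r1 h_le]; first exact: addr_ge0.
rewrite (_ : f (x + h) - f x = df x h + (remainder f df x h - remainder f df x 0)).
  rewrite mulrDl; apply: le_trans (ler_normD _ _) _; apply: lerD; first exact: fK.
  apply: le_trans (fM r r h 0 r0 r1 r0 h_le _ _) _ => [t|t|]; rewrite ?ffunE ?normr0 //.
    by rewrite subr0.
  by rewrite ler_piMr // mulr_ge0.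
by rewrite remainder0 // /remainder; ring.
Qed.

Lemma small_eq0 (x K tau0 : C) : 0 <= K -> 0 < tau0 ->
  (forall tau, 0 < tau -> tau <= tau0 -> `|x| <= K * tau) -> x = 0.
Proof.
move=> K0 tau0_gt0 x_le; apply/eqP/negPn/negP => x_neq0.
have x0 : 0 < `|x| by rewrite normr_gt0.
have d0 : 0 < `|x| + K * tau0 by rewrite ltr_wpDr // mulr_ge0 // ltW.
(* This value is at most [tau0], and [K] times it is less than the norm of [x]; it replaces a
   minimum of two bounds. *)
have := x_le (tau0 * `|x| / (`|x| + K * tau0)).
rewrite divr_gt0 ?mulr_gt0 // ler_pdivrMr // ler_wpM2l ?(ltW tau0_gt0) //.
  move=> /(_ erefl erefl); rewrite mulrA ler_pdivlMr // mulrDr.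
  rewrite -subr_ge0 (_ : _ - _ = - (`|x| * `|x|)); last by ring.
  by rewrite oppr_ge0 => /(lt_le_trans (mulr_gt0 x0 x0)); rewrite ltxx.
by rewrite lerDl mulr_ge0 // ltW.
Qed.

(** At the points [z + h] with [h = tau u + O(tau^2)] given by [newton], [f] vanishes, so its
    differential at [h] is [O(tau^2)] and so is [tau] times its differential at [u]. Dividing by
    [tau] and letting it tend to 0 gives the claim. Continuity of [g] keeps these points in the open
    set where the equations describe the locus. *)
Lemma tangent_of_kernel (g : point C T -> C) (f : polyfun C T) u : pfun g -> g z != 0 ->
  (forall y, g y != 0 -> (forall i, F i y = 0) -> evalp f y = 0) ->
  (forall i, dF i z u = 0) -> differential f z u = 0.
Proof.
move=> [dg gP] gz0 fX dFu0; have fP := pdiff_evalp f.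
have lf := linform_pdiff z fP.
have [K [tau0 [K0 tau0_gt0] curve]] := newton dFu0.
have [L L0 gL] := pdiff_continuous z gP.
have [M M0 fM] := remainder_lipschitz z fP; have [N N0 fN] := linform_bound lf.
pose U : C := \sum_t `|u t|; have U0 : 0 <= U by apply: sumr_ge0.
have uU t : `|u t| <= U by rewrite /U (bigD1 t) //= lerDl; apply: sumr_ge0.
pose B : C := U + K * tau0; have B0 : 0 <= B by rewrite addr_ge0 // mulr_ge0 // ltW.
have gz_gt0 : 0 < `|g z| by rewrite normr_gt0.
(* The bound [tau * D <= tau0] yields three conditions at once: [tau <= tau0], [B * tau <= 1], and
   [L * B * tau] smaller than the norm of [g z]. *)
pose E : C := tau0 * L * B / `|g z|; pose D : C := 1 + (tau0 * B + E).
have E0 : 0 <= E by rewrite divr_ge0 // !mulr_ge0 // ltW.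
have tB0 : 0 <= tau0 * B by rewrite mulr_ge0 // ltW.
have D0 : 0 < D by rewrite ltr_wpDr // addr_ge0.
apply: (@small_eq0 _ (M * B * B + N * K) (tau0 / D)).
- by rewrite addr_ge0 ?mulr_ge0.
- exact: divr_gt0.
move=> tau tau_gt0; rewrite ler_pdivlMr // => tauD; have tau_ge0 := ltW tau_gt0.
have tau_le : tau <= tau0.
  by apply: le_trans tauD; rewrite ler_pMr // lerDl addr_ge0.
have tauE : tau * (tau0 * B) + tau * E < tau0.
  by apply: lt_le_trans tauD; rewrite -mulrDr ltr_pM2l // ltrDr.
have [h Fh h_le] := curve tau tau_ge0 tau_le.
have Bt0 : 0 <= B * tau by rewrite mulr_ge0.
have Bt1 : B * tau <= 1.
  rewrite -(ler_pM2l tau0_gt0) mulr1; apply: ltW; apply: le_lt_trans tauE.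
  rewrite (_ : tau0 * (B * tau) = tau * (tau0 * B)); last by ring.
  by rewrite lerDl mulr_ge0.
have hB t : `|h t| <= B * tau.
  rewrite -(subrK (tau * u t) (h t)); apply: le_trans (ler_normD _ _) _.
  apply: le_trans (lerD (h_le t) (lexx _)) _; rewrite normrM (ger0_norm tau_ge0).
  rewrite /B mulrDl addrC; apply: lerD; first by rewrite mulrC ler_wpM2r.
  by rewrite expr2 mulrA ler_wpM2r // ler_wpM2l.
have gzh : g (z + h) != 0.
  apply/negP => /eqP gzh0; have := gL _ _ Bt0 Bt1 hB; rewrite gzh0 sub0r normrN.
  apply/negP; rewrite -real_ltNge ?realE ?normr_ge0 ?mulr_ge0 //.
  rewrite -(ltr_pM2l tau0_gt0) -ltr_pdivrMr //; apply: le_lt_trans _ tauE.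
  rewrite (_ : _ / _ = tau * E); first by rewrite lerDr mulr_ge0.
  by rewrite /E; field; rewrite gt_eqF.
have := fM (B * tau) (B * tau) h 0 Bt0 Bt1 Bt0 hB.
rewrite remainder0 // subr0 /remainder (fX _ gzh Fh) (fX _ gz0 Fz0) subr0 sub0r normrN.
move=> df_le; have {}df_le : `|differential f z h| <= M * (B * tau) * (B * tau).
  by apply: df_le => t; [rewrite ffunE normr0|rewrite [X in _ - X]ffunE subr0].
pose w : point C T := [ffun t => h t - tau * u t].
have hE : differential f z h = tau * differential f z u + differential f z w.
  by rewrite -lf; congr differential; apply/ffunP => t; rewrite !ffunE addrC subrK.
have dw : `|differential f z w| <= N * (K * tau ^+ 2) by apply: fN => t; rewrite ffunE.
rewrite -(ler_pM2l tau_gt0) -[X in X * `|_|](ger0_norm tau_ge0) -normrM.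
rewrite -[tau * _](addrK (differential f z w)) -hE; apply: le_trans (ler_normB _ _) _.
apply: le_trans (lerD df_le dw) _.
by rewrite le_eqVlt; apply/orP; left; apply/eqP; ring.
Qed.

End Newton.

Lemma differential_unitp (C : fieldType) (T : finType) (f : polyfun C T) x (b : 'I_#|T|) :
  differential f x (unitp C (enum_val b)) = partial_at f x b.
Proof.
rewrite /differential (bigD1 b) //= big1 => [|a neq_a].
  by rewrite ffunE eqxx mulr1 addr0.
by rewrite ffunE (inj_eq enum_val_inj) (negPf neq_a) mulr0.
Qed.

(** * Loci cut out by independent equations *)

Section SmoothPoints.
Variable R : realType.
Local Notation C := R[i].

(** The case of an empty system: the locus is the whole space and every vector is in the kernel.
    Consequently the differential depends only on the function, not on the polynomial chosen for
    it. *)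
Lemma pdiff_unique (T : finType) (f : point C T -> C) df x u :
  pdiff f df -> (forall y, f y = 0) -> df x u = 0.
Proof.
move=> [F [fE ->]] f0.
apply: (@tangent_of_kernel R void T (fun _ _ => 0) (fun _ _ _ => 0) x _ _ _ (fun=> 1)) => //.
- exact: pfun_const.
- by rewrite oner_eq0.
- by move=> y _ _; rewrite -fE.
Qed.

Lemma mdiff_unique (T : finType) m n (A : point C T -> 'M[C]_(m, n)) dA x u :
  mdiff A dA -> (forall y, A y = 0) -> dA x u = 0.
Proof.
move=> AP A0; apply/matrixP => i j; rewrite [RHS]mxE.
by apply: pdiff_unique (AP i j) _ => y; rewrite A0 mxE.
Qed.

Section Data.
Variables (T I : finType) (X : point C T -> Prop) (x : point C T).
Variables (F : I -> point C T -> C) (dF : I -> point C T -> point C T -> C).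

(** A form of [smooth_at] with any finite index type and with the differentials kept accessible. *)
Definition cut_out := [/\ forall i, pdiff (F i) (dF i),
  independent (fun i => dF i x) &
  exists g, [/\ pfun g, g x != 0 & forall y, g y != 0 -> (X y <-> forall i, F i y = 0)]].

Lemma cut_out_smooth d : cut_out -> (#|I| + d = #|T|)%N -> smooth_at X d x.
Proof.
case=> FP indF [g [[dg [G [gE _]]] gx gX]] dimE.
have /choice[P PP] i := FP i.
exists #|I|, (fun a => P (enum_val a)), G; split=> //.
- by rewrite -gE; apply/eqP.
- move=> y /eqP; rewrite -gE => /gX ->; split=> [Fy a|Fy j].
    by have [<- _] := PP (enum_val a).
  by have [-> _] := PP j; rewrite -[j]enum_rankK; apply: Fy.
have /(row_free_indep (fun i => linform_pdiff x (FP i))) /eqP := indF.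
apply: etrans; congr (\rank _); apply/matrixP => a b; rewrite !mxE -differential_unitp.
by have [_ ->] := PP (enum_val a).
Qed.

(** One direction is [tangent_of_kernel]. For the other, [F i] is known to vanish on [X] only where
    [g] does not, but [g * F i] vanishes on all of [X], and its differential at [x] is [g x] times
    that of [F i]. *)
Lemma cut_out_tangent u : cut_out -> X x -> tangent X x u <-> forall i, dF i x u = 0.
Proof.
case=> FP indF [g [gP gx gX]] Xx.
have Fx i : F i x = 0 by apply: (iffLR (gX x gx)).
split=> [Xu i|dFu f fX]; last first.
  by apply: (tangent_of_kernel FP Fx indF gP gx) => // y /gX Xy /Xy; apply: fX.
have [dg {}gP] := gP; have [H [HE dHE]] := pdiffM gP (FP i).
have := Xu H; rewrite -dHE Fx mulr0 add0r => dH0.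
apply: (mulfI gx); rewrite mulr0; apply: dH0 => y Xy; rewrite -HE.
have [->|/gX/iffLR/(_ Xy) ->] := eqVneq (g y) 0; first by rewrite mul0r.
by rewrite mulr0.
Qed.

End Data.

(** * Equations of the graph of a linear map over a locus *)

Section Graph.
Variables (T T' I : finType) (X : point C T -> Prop) (x : point C T).
Variables (F : I -> point C T -> C) (dF : I -> point C T -> point C T -> C).
Variable c : point C T -> point C T'.
Hypothesis lc : linmap c.

Lemma pdiff_fstp (f : point C T -> C) df : pdiff f df ->
  pdiff (fun z : point C (T + T')%type => f (fstp z)) (fun z u => df (fstp z) (fstp u)).
Proof.
elim/pdiff_ind: f df / => [k|t|f g df dg fP gP|f g df dg fP gP].
- exact: pdiff_const.
- have := @pdiff_coord C (T + T')%type (inl t); congr pdiff.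
    by apply: funext => z; rewrite ffunE.
  by apply: funext => z; apply: funext => u; rewrite ffunE.
- exact: pdiffD.
exact: pdiffM.
Qed.

Lemma pdiff_sndp (f : point C T' -> C) df : pdiff f df ->
  pdiff (fun z : point C (T + T')%type => f (sndp z)) (fun z u => df (sndp z) (sndp u)).
Proof.
elim/pdiff_ind: f df / => [k|t|f g df dg fP gP|f g df dg fP gP].
- exact: pdiff_const.
- have := @pdiff_coord C (T + T')%type (inr t); congr pdiff.
    by apply: funext => z; rewrite ffunE.
  by apply: funext => z; apply: funext => u; rewrite ffunE.
- exact: pdiffD.
exact: pdiffM.
Qed.

Definition graph_eqn (i : I + T') (z : point C (T + T')%type) : C :=
  match i with inl i => F i (fstp z) | inr t => z (inr t) - c (fstp z) t end.

Definition graph_deqn (i : I + T') (z u : point C (T + T')%type) : C :=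
  match i with inl i => dF i (fstp z) (fstp u) | inr t => u (inr t) - c (fstp u) t end.

Lemma graph_kernelP z u : (forall i, graph_deqn i z u = 0) <->
  (forall i, dF i (fstp z) (fstp u) = 0) /\ sndp u = c (fstp u).
Proof.
split=> [ker|[dFu cu] [i|t]] /=; last 2 first.
- exact: dFu.
- by rewrite -cu ffunE subrr.
split=> [i|]; first exact: (ker (inl i)).
by apply/ffunP => t; apply/eqP; rewrite -subr_eq0 ffunE; apply/eqP/(ker (inr t)).
Qed.

Lemma independent_graph z :
  independent (fun i => graph_deqn i z) -> independent (fun i => dF i (fstp z)).
Proof.
move=> ind lam lam0 i; pose lam' (s : I + T') := if s is inl i then lam i else 0.
apply: (ind lam' _ (inl i)) => u; rewrite big_sumType /= lam0 add0r big1 // => t _.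
by rewrite mul0r.
Qed.

Lemma cut_out_graph : cut_out X x F dF ->
  cut_out (fun z => X (fstp z) /\ sndp z = c (fstp z)) (joinp x (c x)) graph_eqn graph_deqn.
Proof.
case=> FP indF [g [gP gx gX]].
have fstK (y : point C T) (y' : point C T') : fstp (joinp y y') = y.
  by apply/ffunP => t; rewrite !ffunE.
split.
- case=> [i|t] /=; first exact: pdiff_fstp.
  apply: pdiffB; first exact: pdiff_coord.
  exact: pdiff_fstp (pdiff_linform (lc t)).
- move=> lam lam0.
  have lamr t : lam (inr t) = 0.
    have := lam0 (joinp 0 (unitp C t)); rewrite big_sumType /= !fstK.
    rewrite big1 => [|i _]; last by rewrite (linform0 (linform_pdiff _ (FP i))) mulr0.
    rewrite add0r (bigD1 t) //= big1 => [|t' neq_t].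
      by rewrite (linform0 (lc t)) !ffunE eqxx subr0 mulr1 addr0.
    by rewrite (linform0 (lc t')) !ffunE (negPf neq_t) subr0 mulr0.
  case=> // i; apply: (indF (fun i => lam (inl i))) => u.
  have := lam0 (joinp u 0); rewrite big_sumType /= !fstK => E; rewrite -[RHS]E.
  by rewrite [X in _ = _ + X]big1 ?addr0 // => t _; rewrite lamr mul0r.
exists (fun z => g (fstp z)); split; last 2 first.
- by rewrite fstK.
- move=> z /gX Xz; split=> [[/Xz Fz cz] [i|t] /=|Fz].
  + exact: Fz.
  + by rewrite -cz ffunE subrr.
  split; first by apply/Xz => i; apply: (Fz (inl i)).
  by apply/ffunP => t; apply/eqP; rewrite -subr_eq0 ffunE; apply/eqP/(Fz (inr t)).
by have [dg /pdiff_fstp/pfun_pdiff] := gP.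
Qed.

End Graph.
End SmoothPoints.

(** * Determinantal loci *)

Lemma row_free_complete (C : fieldType) (m r : nat) (A : 'M[C]_(r, m)) : row_free A ->
  exists e (B : 'M[C]_(e, m)), (r + e = m)%N /\ row_full (col_mx A B).
Proof.
move=> freeA; exists (\rank (A^C)%MS), (row_base (A^C)%MS); split.
  rewrite mxrank_compl (eqP freeA) subnKC // -(eqP freeA); exact: rank_leq_col.
rewrite -sub1mx -addsmxE (adds_eqmx (eqmx_refl A) (eq_row_base _)).
by rewrite sub1mx addsmx_compl_full.
Qed.

Lemma castmx_row_mul (C : fieldType) (r m k : nat) (E : r = m) (A : 'M[C]_(r, m)) (v : 'M_(m, k)) :
  castmx (E, erefl m) A *m v = castmx (E, erefl k) (A *m v).
Proof. by subst m; rewrite !castmx_id. Qed.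

Lemma castmx_row_full (C : fieldType) (r m : nat) (E : r = m) (A : 'M[C]_(r, m)) :
  row_full A -> castmx (E, erefl m) A \in unitmx.
Proof. by subst m; rewrite castmx_id -row_full_unit. Qed.

Section Determinantal.
Variable R : realType.
Local Notation C := R[i].
Variables (T J : finType) (m n q : nat) (X : point C T -> Prop) (x : point C T).
Variables (G : J -> point C T -> C) (dG : J -> point C T -> point C T -> C).
Variables (M : point C T -> 'M[C]_(m, n)) (s : point C T -> 'cV[C]_m).
Variables (dM : point C T -> point C T -> 'M[C]_(m, n)) (ds : point C T -> point C T -> 'cV[C]_m).
Variables (N : point C T -> 'M[C]_(q, m)) (zeta : 'cV[C]_n) (p : 'M[C]_(n, m)).
Hypothesis GP : forall j, pdiff (G j) (dG j).
Hypothesis MP : mdiff M dM.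
Hypothesis sP : mdiff s ds.
Hypothesis NP : mfun N.
Hypothesis pM : p *m M x = 1%:M.
(* By Cramer's rule, [M y *m xi = s y] is solvable when this vanishes and
   [p *m M y] is invertible. *)
Definition cramer_defect y :=
  \det (p *m M y) *: s y - M y *m (\adj (p *m M y) *m (p *m s y)).

Lemma cramer_defect_solvable y xi : M y *m xi = s y -> cramer_defect y = 0.
Proof.
move=> xiP; rewrite /cramer_defect -xiP [p *m (M y *m xi)]mulmxA.
rewrite [\adj _ *m _]mulmxA mul_adj_mx mul_scalar_mx -scalemxAr.
exact: subrr.
Qed.

Lemma cramer_defect_ker y : p *m cramer_defect y = 0.
Proof.
rewrite /cramer_defect mulmxBr -scalemxAr; rewrite !mulmxA mul_mx_adj mul_scalar_mx.
by rewrite -scalemxAl subrr.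
Qed.

(** The defect vanishes wherever the system is solvable, whether or not the minor [p *m M y] is
    invertible, hence on the closure; at [x] this minor is the identity and [p *m s x] is a
    solution. *)
Lemma solvable_closed :
  zariski_closure (fun y => exists xi, M y *m xi = s y) x -> exists xi, M x *m xi = s x.
Proof.
have dP : mfun cramer_defect.
  have pMP : mfun (fun y => p *m M y) by apply: mfunM (mfun_const _ _) (mdiff_mfun MP).
  have [dd ddP] := pfun_det pMP.
  have [|de deP] := @mfun_mdiff _ _ _ _ (fun y => \adj (p *m M y) *m (p *m s y)).
    apply: mfunM; first exact: mfun_adj.
    by apply: mfunM (mfun_const _ _) (mdiff_mfun sP).
  exact: mdiff_mfun (mdiffB (mdiffZ ddP sP) (mdiffM MP deP)).
move=> clx; exists (p *m s x); suff: cramer_defect x = 0.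
  rewrite /cramer_defect pM det1 adj1 mul1mx scale1r => /eqP; rewrite subr_eq0.
  by move=> /eqP.
apply/matrixP => i j; have [dH [F [FE _]]] := dP i j; rewrite FE [RHS]mxE.
apply: clx => y [xi xiP]; by rewrite -FE (cramer_defect_solvable xiP) mxE.
Qed.

Hypothesis zetaP : M x *m zeta = s x.

(** Because [s x = M x *m zeta], the derivatives of the determinant and of the adjugate contribute
    only vectors in the image of [M x]. They are absorbed in [xi] and never computed. *)
Lemma cramer_defect_diff : exists2 dH, mdiff cramer_defect dH &
  forall u, exists xi, dH x u = ds x u - dM x u *m zeta - M x *m xi.
Proof.
have pMP : mfun (fun y => p *m M y) by apply: mfunM (mfun_const _ _) (mdiff_mfun MP).
have [dd ddP] := pfun_det pMP.
have [|de deP] := @mfun_mdiff _ _ _ _ (fun y => \adj (p *m M y) *m (p *m s y)).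
  apply: mfunM; first exact: mfun_adj.
  by apply: mfunM (mfun_const _ _) (mdiff_mfun sP).
have := mdiffB (mdiffZ ddP sP) (mdiffM MP deP).
set dH := (X in mdiff _ X) => dHP; exists dH => // u.
exists (de x u - dd x u *: zeta); rewrite /dH pM det1 adj1 mul1mx -zetaP.
rewrite [p *m _]mulmxA pM mul1mx scale1r mulmxBr -scalemxAr.
move: (M x *m zeta) (M x *m de x u) (dM x u *m zeta) => a b c.
by apply/matrixP => i j; rewrite !mxE; ring.
Qed.

Hypothesis XP : exists h, [/\ pfun h, h x != 0 & forall y, h y != 0 ->
  (X y <-> (forall j, G j y = 0) /\ exists xi, M y *m xi = s y)].
Hypothesis Gx0 : forall j, G j x = 0.
Hypothesis N_free : row_free (N x).
Hypothesis N_rel : forall y, (forall j, G j y = 0) -> N y *m M y = 0 /\ N y *m s y = 0.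
Hypothesis N_drel : forall u, (forall j, dG j x u = 0) ->
  N x *m (ds x u - dM x u *m zeta) = 0.

Definition solvable_tangent u :=
  (forall j, dG j x u = 0) /\ exists xi, M x *m xi = ds x u - dM x u *m zeta.

(* The m equations [cramer_defect y = 0] are redundant: [p] annihilates the defect
   identically, and [N y] where [G y = 0].  Completing [p] and [N x] to a basis by
   [p'], the remaining ones are [p' *m cramer_defect y = 0]. *)
Lemma determinantal_cut_out :
  (forall e (phi : J + 'I_e -> point C T -> C), (n + q + e = m)%N ->
     (forall i, linform (phi i)) ->
     (forall u, (forall i, phi i u = 0) -> solvable_tangent u) -> independent phi) ->
  exists e (F : J + 'I_e -> point C T -> C) dF, [/\ (n + q + e = m)%N, cut_out X x F dF &
    forall u, (forall i, dF i x u = 0) -> solvable_tangent u].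
Proof.
(* The completion [p'] is not canonical, so [ind] speaks of every family of the right size whose
   kernel lies in [solvable_tangent]; isotropy will supply it. *)
move=> ind; have NM0 := (N_rel Gx0).1.
(* Multiplying a relation between the rows by [M x] isolates the coefficients of [p], since
   [p *m M x = 1] and [N x *m M x = 0]. *)
have free_pN : row_free (col_mx p (N x)).
  rewrite -kermx_eq0; apply/rowV0P => L /sub_kermxP.
  rewrite -[L]hsubmxK mul_row_col => L0.
  have l0 : lsubmx L = 0.
    have := congr1 (mulmx^~ (M x)) L0.
    by rewrite /= mulmxDl -!mulmxA pM NM0 mulmx1 mulmx0 addr0 mul0mx.
  move: L0; rewrite l0 mul0mx add0r => r0.
  by rewrite (row_free_inj N_free (etrans r0 (esym (mul0mx _ _)))) row_mx0.
have [e [p' [E full_pN]]] := row_free_complete free_pN.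
have [dH dHP dHE] := cramer_defect_diff.
pose sq y : 'M[C]_m := castmx (E, erefl m) (col_mx (col_mx p (N y)) p').
have sq_inj y k (v : 'M_(m, k)) : sq y \in unitmx ->
    p *m v = 0 -> N y *m v = 0 -> p' *m v = 0 -> v = 0.
  move=> sq_unit pv Nv p'v; rewrite -[v](mulKmx sq_unit).
  suff -> : sq y *m v = 0 by rewrite mulmx0.
  by rewrite castmx_row_mul !mul_col_mx pv Nv p'v !col_mx0 castmx_const.
have sqx : sq x \in unitmx by apply: castmx_row_full.
pose F (i : J + 'I_e) y := match i with inl j => G j y | inr a => (p' *m cramer_defect y) a 0 end.
pose dF (i : J + 'I_e) y u :=
  match i with inl j => dG j y u | inr a => (0 *m cramer_defect y + p' *m dH y u) a 0 end.
have FP i : pdiff (F i) (dF i).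
  case: i => [j|a] /=; first exact: GP.
  exact: (mdiffM (mdiff_const _ p') dHP a 0).
have ker u : (forall i, dF i x u = 0) -> solvable_tangent u.
  move=> dFu; have dGu j := dFu (inl j); split=> //.
  have [xi dHu] := dHE u; exists xi; apply/esym/eqP; rewrite -subr_eq0 -dHu; apply/eqP.
  (* The derivative of the defect is killed by [p], on differentiating the identity
     [cramer_defect_ker]; by [N x], because of [N_drel]; and by [p'], by the choice of [u]. *)
  apply: sq_inj sqx _ _ _.
  - have := mdiff_unique x u (mdiffM (mdiff_const _ p) dHP) cramer_defect_ker.
    by rewrite mul0mx add0r.
  - by rewrite dHu mulmxBr N_drel // mulmxA NM0 mul0mx subr0.
  apply/colP => a; have := dFu (inr a); rewrite /= mul0mx add0r => ->.
  by rewrite mxE.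
exists e, F, dF; split=> //; split=> //.
  by apply: ind => // i; apply: linform_pdiff (FP i).
have [h [hP hx hX]] := XP.
have pMP : mfun (fun y => p *m M y) by apply: mfunM (mfun_const _ _) (mdiff_mfun MP).
have sqP : mfun sq.
  apply: mfun_castmx; apply: mfun_col_mx; last exact: mfun_const.
  by apply: mfun_col_mx NP; apply: mfun_const.
(* The second factor makes the minor invertible, so that a zero defect gives a solution; the third
   makes [p], [N y] and [p'] jointly injective, so that the equations kept imply a zero defect. *)
exists (fun y => h y * (\det (p *m M y) * \det (sq y))); split.
- by apply: pfunM => //; apply: pfunM; apply: pfun_det.
- by rewrite !mulf_neq0 // ?pM ?det1 ?oner_eq0 // -unitfE -unitmxE.
move=> y; rewrite !mulf_eq0 !negb_or => /and3P[/hX hy d_neq0 sq_neq0].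
have sqy : sq y \in unitmx by rewrite unitmxE unitfE.
split=> [/hy[Gy [xi xiP]] [j|a] /=|Fy]; first exact: Gy.
  by rewrite (cramer_defect_solvable xiP) mulmx0 mxE.
have Gy j : G j y = 0 by apply: (Fy (inl j)).
have [NM Ns] := N_rel Gy; apply/hy; split=> //.
have: cramer_defect y = 0.
  apply: sq_inj sqy (cramer_defect_ker y) _ _.
    by rewrite /cramer_defect mulmxBr -scalemxAr Ns scaler0 mulmxA NM mul0mx subr0.
  by apply/colP => a; rewrite [RHS]mxE; apply: (Fy (inr a)).
rewrite /cramer_defect => /eqP; rewrite subr_eq0 => /eqP E1.
exists ((\det (p *m M y))^-1 *: (\adj (p *m M y) *m (p *m s y))).
by rewrite -scalemxAr -E1 scalerA mulVf ?scale1r.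
Qed.

End Determinantal.

(** * Linear algebra of framed representations *)

Section IsotropicKernel.
Variables (C : fieldType) (I S : finType) (phi : I -> point C S -> C).
Variable w : point C S -> point C S -> C.
Hypothesis lphi : forall i, linform (phi i).
Hypothesis lw : forall u, linform (w u).
Hypothesis rw : forall v, linform (w^~ v).
Hypothesis nondeg : forall u, (forall v, w u v = 0) -> u = 0.
Hypothesis isotropic : forall u v,
  (forall i, phi i u = 0) -> (forall i, phi i v = 0) -> w u v = 0.
Hypothesis half : #|S| = (2 * #|I|)%N.

Let W : 'M[C]_#|S| := \matrix_(a, b) w (unitp C (enum_val a)) (unitp C (enum_val b)).

Let wE u v : w u v = ((colp u)^T *m W *m colp v) 0 0.
Proof.
rewrite -mulmxA mxE (linform_sum (rw v)) (reindex (@enum_val S S)) /=; last first.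
  exact/onW_bij/enum_val_bij.
apply: eq_bigr => a _; rewrite !mxE; congr (_ * _).
rewrite (linform_sum (lw _)) (reindex (@enum_val S S)) /=; last exact/onW_bij/enum_val_bij.
by apply: eq_bigr => b _; rewrite !mxE mulrC.
Qed.

Let K := kermx (coef_mx phi)^T.
(** The row space of [L] is the orthogonal of that of [K] for [w]. *)
Let L := kermx (W *m K^T).

Let kerP u : ((colp u)^T <= K)%MS <-> forall i, phi i u = 0.
Proof.
rewrite (sameP sub_kermxP eqP) -trmx_mul coef_mxE //; split=> [/eqP|phi0].
  move=> /(congr1 trmx); rewrite trmxK trmx0 => /colp_eq0 phi0 i.
  by have := congr1 (fun f : point C I => f i) phi0; rewrite !ffunE.
by apply/eqP/matrixP => a b; rewrite !mxE ffunE.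
Qed.

Let KL : (K <= L)%MS.
Proof.
apply/row_subP => a; apply/sub_kermxP; rewrite mulmxA; apply/matrixP => z b.
have rowE c : row c K = (colp (pcol (row c K)^T))^T by rewrite pcolK trmxK.
have kerK c i : phi i (pcol (row c K)^T) = 0.
  by have /kerP -> // : ((colp (pcol (row c K)^T))^T <= K)%MS by rewrite -rowE row_sub.
have := isotropic (kerK a) (kerK b); rewrite wE -rowE => wab.
rewrite ord1 [RHS]mxE -[RHS]wab pcolK [LHS]mxE [RHS]mxE.
by apply: eq_bigr => c _; congr (_ * _); rewrite !mxE.
Qed.

Let W_unit : W \in unitmx.
Proof.
rewrite -row_free_unit -kermx_eq0; apply/rowV0P => v /sub_kermxP vW.
rewrite -[v]trmxK -[v^T]pcolK; suff -> : pcol v^T = 0.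
  by apply/matrixP => a b; rewrite !mxE ffunE.
by apply: nondeg => u; rewrite wE pcolK trmxK vW mul0mx mxE.
Qed.

Let rankL : \rank L = \rank (coef_mx phi).
Proof.
rewrite mxrank_ker eqmxMfull ?row_full_unit // mxrank_tr mxrank_ker mxrank_tr.
by rewrite subKn ?rank_leq_col.
Qed.

Let rank_phi : \rank (coef_mx phi) = #|I|.
Proof.
have := mxrankS KL; rewrite rankL mxrank_ker mxrank_tr.
have := rank_leq_row (coef_mx phi); move: (\rank _) => r r_le.
rewrite half leq_subLR addnn -mul2n leq_pmul2l // => n_le.
by apply/eqP; rewrite eqn_leq r_le.
Qed.

(* The common kernel is isotropic, hence of dimension at most half of #|S|, which
   is the number of functionals. *)
Lemma isotropic_independent : independent phi.
Proof. by apply/row_free_indep => //; rewrite /row_free rank_phi. Qed.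

(** The isotropic [K] lies in [L], and both have rank [#|I|], so they coincide. *)
Lemma isotropic_lagrangian u :
  (forall v, (forall i, phi i v = 0) -> w u v = 0) -> forall i, phi i u = 0.
Proof.
move=> wu0; apply/kerP.
have LK : (L <= K)%MS.
  have := mxrank_leqif_sup KL => /leqifP; case: ifP => // _.
  rewrite rankL mxrank_ker mxrank_tr; move: rank_phi; move: (\rank _) => r ->.
  by rewrite half mul2n -addnn addnK ltnn.
apply: submx_trans LK; apply/sub_kermxP; rewrite mulmxA; apply/matrixP => z b.
have := wu0 (pcol (row b K)^T); rewrite wE => wub; rewrite ord1 [RHS]mxE -[RHS]wub.
  by rewrite pcolK [LHS]mxE [RHS]mxE; apply: eq_bigr => c _; congr (_ * _); rewrite !mxE.
by apply/kerP; rewrite pcolK trmxK row_sub.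
Qed.

End IsotropicKernel.

Section LinearFacts.
Variable C : fieldType.

Lemma linmapP (T S : finType) (psi : point C T -> point C S) :
  (forall a u v, psi (lcomb a u v) = lcomb a (psi u) (psi v)) -> linmap psi.
Proof. by move=> lpsi s a u v; rewrite lpsi ffunE. Qed.

Lemma fstp_lcomb (T1 T2 : finType) a (u v : point C (T1 + T2)%type) :
  fstp (lcomb a u v) = lcomb a (fstp u) (fstp v).
Proof. by apply/ffunP => t; rewrite !ffunE. Qed.

Lemma sndp_lcomb (T1 T2 : finType) a (u v : point C (T1 + T2)%type) :
  sndp (lcomb a u v) = lcomb a (sndp u) (sndp v).
Proof. by apply/ffunP => t; rewrite !ffunE. Qed.

Lemma fstp_joinp (T1 T2 : finType) (x : point C T1) (y : point C T2) : fstp (joinp x y) = x.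
Proof. by apply/ffunP => t; rewrite !ffunE. Qed.

Lemma sndp_joinp (T1 T2 : finType) (x : point C T1) (y : point C T2) : sndp (joinp x y) = y.
Proof. by apply/ffunP => t; rewrite !ffunE. Qed.

Lemma joinpl (T1 T2 : finType) (x : point C T1) (y : point C T2) t : joinp x y (inl t) = x t.
Proof. by rewrite ffunE. Qed.

Lemma joinpr (T1 T2 : finType) (x : point C T1) (y : point C T2) t : joinp x y (inr t) = y t.
Proof. by rewrite ffunE. Qed.

Lemma joinpK (T1 T2 : finType) (z : point C (T1 + T2)%type) : joinp (fstp z) (sndp z) = z.
Proof. by apply/ffunP => -[t|t]; rewrite !ffunE. Qed.

End LinearFacts.

(** * The deformation complex and its symplectic duality *)

Section Representations.
Variables (C : fieldType) (Q : quiver) (eps : forall i j : Q, darrow i j -> C).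
Variable w : Q -> nat.
Hypothesis eps_neq0 : forall (i j : Q) (h : darrow i j), eps h != 0.
Hypothesis eps_bar : forall (i j : Q) (h : darrow i j), eps h + eps (bar h) = 0.

Lemma barK (i j : Q) (h : darrow i j) : bar (bar h) = h.
Proof. by case: h. Qed.

Lemma sum_bar (f : forall i j : Q, darrow i j -> C) :
  \sum_i \sum_j \sum_(h : darrow i j) f i j h
  = \sum_i \sum_j \sum_(h : darrow i j) f j i (bar h).
Proof.
rewrite exchange_big; apply: eq_bigr => i _; apply: eq_bigr => j _.
by rewrite (reindex (@bar Q i j)) //; exists (@bar Q j i) => h _; apply: barK.
Qed.

Section Pairs.
Variables va vb : Q -> nat.

(* Coordinates of E(V_a, V_b), the families of maps B_h : V_a -> V_b, i : W -> V_b
   and j : V_a -> W; [ecoord v v] is convertible to [adhm_coord w v]. *)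
Definition ecoord : finType :=
  ({i : Q & {j : Q & (darrow i j * ('I_(vb j) * 'I_(va i)))%type}}
   + {k : Q & ('I_(vb k) * 'I_(w k))%type}
   + {k : Q & ('I_(w k) * 'I_(va k))%type})%type.
Definition gcoord : finType := {k : Q & ('I_(vb k) * 'I_(va k))%type}.
Definition rep := point C ecoord.
Definition gmap := point C gcoord.
Implicit Types (e f : rep) (xi : gmap).

Definition Bm e (i j : Q) (h : darrow i j) : 'M[C]_(vb j, va i) :=
  \matrix_(a, b) e (inl (inl (existT _ i (existT _ j (h, (a, b)))))).
Definition im e (k : Q) : 'M[C]_(vb k, w k) :=
  \matrix_(a, b) e (inl (inr (existT _ k (a, b)))).
Definition jm e (k : Q) : 'M[C]_(w k, va k) :=
  \matrix_(a, b) e (inr (existT _ k (a, b))).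
Definition gm xi (k : Q) : 'M[C]_(vb k, va k) := \matrix_(a, b) xi (existT _ k (a, b)).

Definition mkrep (B : forall i j : Q, darrow i j -> 'M[C]_(vb j, va i))
    (I : forall k, 'M[C]_(vb k, w k)) (J : forall k, 'M[C]_(w k, va k)) : rep :=
  [ffun c : ecoord => match c with
   | inl (inl (existT i (existT j (h, (a, b))))) => B i j h a b
   | inl (inr (existT k (a, b))) => I k a b
   | inr (existT k (a, b)) => J k a b
   end].
Definition mkg (A : forall k, 'M[C]_(vb k, va k)) : gmap :=
  [ffun c : gcoord => match c with existT k (a, b) => A k a b end].

Lemma Bm_mk B I J (i j : Q) (h : darrow i j) : Bm (mkrep B I J) h = B i j h.
Proof. by apply/matrixP => a b; rewrite mxE ffunE. Qed.
Lemma im_mk B I J k : im (mkrep B I J) k = I k.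
Proof. by apply/matrixP => a b; rewrite mxE ffunE. Qed.
Lemma jm_mk B I J k : jm (mkrep B I J) k = J k.
Proof. by apply/matrixP => a b; rewrite mxE ffunE. Qed.
Lemma gm_mk A k : gm (mkg A) k = A k.
Proof. by apply/matrixP => a b; rewrite mxE ffunE. Qed.
Definition mkE := (Bm_mk, im_mk, jm_mk, gm_mk).

Lemma rep_eq e f : (forall i j (h : darrow i j), Bm e h = Bm f h) ->
  (forall k, im e k = im f k) -> (forall k, jm e k = jm f k) -> e = f.
Proof.
move=> eB ei ej; apply/ffunP => -[[[i [j [h [a b]]]]|[k [a b]]]|[k [a b]]].
- by have /matrixP/(_ a b) := eB i j h; rewrite !mxE.
- by have /matrixP/(_ a b) := ei k; rewrite !mxE.
by have /matrixP/(_ a b) := ej k; rewrite !mxE.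
Qed.

Lemma gmap_eq (xi xi' : gmap) : (forall k, gm xi k = gm xi' k) -> xi = xi'.
Proof.
by move=> E; apply/ffunP => -[k [a b]]; have /matrixP/(_ a b) := E k; rewrite !mxE.
Qed.

Lemma Bm_lcomb a e f (i j : Q) (h : darrow i j) : Bm (lcomb a e f) h = a *: Bm e h + Bm f h.
Proof. by apply/matrixP => s t; rewrite !mxE ffunE. Qed.
Lemma im_lcomb a e f k : im (lcomb a e f) k = a *: im e k + im f k.
Proof. by apply/matrixP => s t; rewrite !mxE ffunE. Qed.
Lemma jm_lcomb a e f k : jm (lcomb a e f) k = a *: jm e k + jm f k.
Proof. by apply/matrixP => s t; rewrite !mxE ffunE. Qed.
Lemma gm_lcomb a xi xi' k : gm (lcomb a xi xi') k = a *: gm xi k + gm xi' k.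
Proof. by apply/matrixP => s t; rewrite !mxE ffunE. Qed.
Definition lcombE := (Bm_lcomb, im_lcomb, jm_lcomb, gm_lcomb).

Lemma Bm0 (i j : Q) (h : darrow i j) : Bm 0 h = 0.
Proof. by apply/matrixP => s t; rewrite !mxE ffunE. Qed.
Lemma im0 k : im 0 k = 0.
Proof. by apply/matrixP => s t; rewrite !mxE ffunE. Qed.
Lemma jm0 k : jm 0 k = 0.
Proof. by apply/matrixP => s t; rewrite !mxE ffunE. Qed.
Lemma gm0 k : gm 0 k = 0.
Proof. by apply/matrixP => s t; rewrite !mxE ffunE. Qed.

Lemma BmB e f (i j : Q) (h : darrow i j) : Bm (e - f) h = Bm e h - Bm f h.
Proof. by apply/matrixP => s t; rewrite !mxE !ffunE. Qed.
Lemma imB e f k : im (e - f) k = im e k - im f k.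
Proof. by apply/matrixP => s t; rewrite !mxE !ffunE. Qed.
Lemma jmB e f k : jm (e - f) k = jm e k - jm f k.
Proof. by apply/matrixP => s t; rewrite !mxE !ffunE. Qed.
Definition repBE := (BmB, imB, jmB).

End Pairs.

(* The symplectic duality between E(V_a, V_b) and E(V_b, V_a). *)
Definition pairing va vb (e : rep va vb) (f : rep vb va) : C :=
  \sum_(i : Q) \sum_(j : Q) \sum_(h : darrow i j) eps h * \tr (Bm e h *m Bm f (bar h))
  + \sum_(k : Q) (\tr (im e k *m jm f k) - \tr (im f k *m jm e k)).

(** The moment map, polarised and extended to maps between different spaces: [mom x x] is
    [moment x], and [mom x u + mom u x] is the differential of the moment map at [x] along [u]. *)
Definition mom va vb vc (e : rep vb vc) (f : rep va vb) (k : Q) : 'M[C]_(vc k, va k) :=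
  \sum_(l : Q) \sum_(h : darrow l k) eps h *: (Bm e h *m Bm f (bar h)) + im e k *m jm f k.

(* The complex L(V_a, V_b) -> E(V_a, V_b) -> L(V_a, V_b) with maps alpha and beta;
   a morphism of representations from x to y is a solution of
   [alpha x y xi = sect x y]. *)
Definition alpha va vb (x : rep va va) (y : rep vb vb) (xi : gmap va vb) : rep va vb :=
  mkrep (fun i j h => Bm y h *m gm xi i - gm xi j *m Bm x h)
    (fun k => - (gm xi k *m im x k)) (fun k => jm y k *m gm xi k).

Definition sect va vb (x : rep va va) (y : rep vb vb) : rep va vb :=
  mkrep (fun i j h => 0) (fun k => - im y k) (fun k => jm x k).

Definition beta va vb (x : rep va va) (y : rep vb vb) (e : rep va vb) : gmap va vb :=
  mkg (fun k => mom y e k + mom e x k).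

Lemma bar_anti (f : forall i j : Q, darrow i j -> C) :
  \sum_i \sum_j \sum_(h : darrow i j) eps h * f i j h
  = - \sum_i \sum_j \sum_(h : darrow i j) eps h * f j i (bar h).
Proof.
rewrite (sum_bar (fun i j h => eps h * f i j h)) -sumrN; apply: eq_bigr => i _.
rewrite -sumrN; apply: eq_bigr => j _; rewrite -sumrN; apply: eq_bigr => h _.
by rewrite -mulNr; congr (_ * _); apply/eqP; rewrite -addr_eq0 addrC eps_bar.
Qed.

Lemma pairing_anti va vb (e : rep va vb) (f : rep vb va) : pairing e f = - pairing f e.
Proof.
rewrite /pairing (bar_anti (fun i j h => \tr (Bm e h *m Bm f (bar h)))) opprD; congr (- _ + _).
  apply: eq_bigr => i _; apply: eq_bigr => j _; apply: eq_bigr => h _.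
  by rewrite barK mxtrace_mulC.
by rewrite -sumrN; apply: eq_bigr => k _; rewrite opprB.
Qed.

Lemma tr_gmom va vb vc (xi : gmap vc va) (e : rep vb vc) (f : rep va vb) :
  \sum_k \tr (gm xi k *m mom e f k)
  = \sum_i \sum_j \sum_(h : darrow i j) eps h * \tr (gm xi j *m Bm e h *m Bm f (bar h))
    + \sum_k \tr (gm xi k *m im e k *m jm f k).
Proof.
rewrite exchange_big -big_split; apply: eq_bigr => k _ /=.
rewrite mulmxDr raddfD /= mulmxA; congr (_ + _).
rewrite mulmx_sumr raddf_sum; apply: eq_bigr => l _ /=.
rewrite mulmx_sumr raddf_sum; apply: eq_bigr => h _ /=.
by rewrite -scalemxAr mxtraceZ mulmxA.
Qed.

Lemma tr_mom v (e f : rep v v) :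
  \sum_k \tr (mom e f k)
  = \sum_i \sum_j \sum_(h : darrow i j) eps h * \tr (Bm e h *m Bm f (bar h))
    + \sum_k \tr (im e k *m jm f k).
Proof.
have := tr_gmom (mkg (fun k => 1%:M)) e f; congr (_ = _); last congr (_ + _).
- by apply: eq_bigr => k _; rewrite mkE mul1mx.
- by apply: eq_bigr => i _; apply: eq_bigr => j _; apply: eq_bigr => h _; rewrite mkE mul1mx.
by apply: eq_bigr => k _; rewrite mkE mul1mx.
Qed.

(** [alpha] from V_b to V_a is the transpose of [beta] from V_a to V_b. Surjectivity of [beta] is
    thereby reduced to injectivity of [alpha], which stability provides. *)
Lemma pairing_alpha va vb (x : rep va va) (y : rep vb vb) (e : rep va vb) (xi : gmap vb va) :
  pairing e (alpha y x xi) = \sum_k \tr (gm xi k *m gm (beta x y e) k).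
Proof.
under [RHS]eq_bigr => k _ do rewrite mkE mulmxDr raddfD.
rewrite big_split /= !tr_gmom.
rewrite (bar_anti (fun i j h => \tr (gm xi j *m Bm y h *m Bm e (bar h)))).
rewrite addrACA; congr (_ + _); last first.
  rewrite -big_split; apply: eq_bigr => k _ /=; rewrite !mkE mulNmx raddfN opprK addrC.
  by congr (_ + _); rewrite -mulmxA [RHS]mxtrace_mulC mulmxA mxtrace_mulC -?mulmxA // mulmxA.
rewrite addrC -sumrB; apply: eq_bigr => i _; rewrite -sumrB; apply: eq_bigr => j _.
rewrite -sumrB; apply: eq_bigr => h _; rewrite mkE barK -mulrBr mulmxBr raddfB /=.
congr (_ * (_ - _)); first by rewrite mulmxA mxtrace_mulC mulmxA.
by rewrite mxtrace_mulC.
Qed.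

Lemma pairing_sect va vb (x : rep va va) (y : rep vb vb) (e : rep va vb) :
  pairing e (sect y x) = \sum_k (\tr (im e k *m jm y k) + \tr (im x k *m jm e k)).
Proof.
rewrite /pairing big1 ?add0r => [|i _].
  by apply: eq_bigr => k _; rewrite !mkE mulNmx raddfN opprK.
by rewrite big1 // => j _; rewrite big1 // => h _; rewrite mkE mulmx0 mxtrace0 mulr0.
Qed.

Lemma beta_alpha va vb (x : rep va va) (y : rep vb vb) (xi : gmap va vb) k :
  gm (beta x y (alpha x y xi)) k = mom y y k *m gm xi k - gm xi k *m mom x x k.
Proof.
rewrite mkE /mom !mkE addrACA -!big_split /=.
rewrite mulmxDl mulmxDr mulNmx !mulmxA opprD [RHS]addrACA; congr (_ + _).
rewrite mulmx_suml mulmx_sumr -sumrB; apply: eq_bigr => l _ /=.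
rewrite -big_split mulmx_suml mulmx_sumr -sumrB; apply: eq_bigr => h _ /=.
rewrite !mkE mulmxBr mulmxBl !scalerBr -scalemxAl -scalemxAr !mulmxA addrA subrK.
by [].
Qed.

Lemma beta_sect va vb (x : rep va va) (y : rep vb vb) : beta x y (sect x y) = 0.
Proof.
apply: gmap_eq => k; rewrite mkE gm0 /mom !mkE.
rewrite big1 => [|l _]; last by rewrite big1 // => h _; rewrite mkE mulmx0 scaler0.
rewrite big1 => [|l _]; last by rewrite big1 // => h _; rewrite mkE mul0mx scaler0.
by rewrite !add0r mulNmx subrr.
Qed.

Lemma pairing_alpha_sect va vb (x : rep va va) (y : rep vb vb) (xi : gmap va vb) :
  pairing (alpha x y xi) (sect y x) = 0.
Proof.
rewrite pairing_anti pairing_alpha beta_sect big1 ?oppr0 // => k _.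
by rewrite gm0 mulmx0 mxtrace0.
Qed.

Lemma sum_tr_anti v (x u : rep v v) :
  \sum_k \tr (mom x u k + mom u x k) = \sum_k \tr (im x k *m jm u k + im u k *m jm x k).
Proof.
under eq_bigr => k _ do rewrite raddfD; rewrite big_split /= !tr_mom.
rewrite (bar_anti (fun i j h => \tr (Bm u h *m Bm x (bar h)))) addrACA.
under [RHS]eq_bigr => k _ do rewrite raddfD; rewrite big_split /= -[RHS]add0r.
congr (_ + _); rewrite -sumrB big1 // => i _; rewrite -sumrB big1 // => j _.
by rewrite -sumrB big1 // => h _; rewrite barK mxtrace_mulC subrr.
Qed.

(** Orbit directions are orthogonal to the kernel of the differential of the moment map, which is
    why the form descends to the quotient. *)
Lemma pairing_alphaN v (x u : rep v v) (xi : gmap v v) :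
  (forall k, mom x u k + mom u x k = 0) -> pairing u (alpha x x xi) = 0.
Proof.
by move=> u0; rewrite pairing_alpha big1 // => k _; rewrite mkE u0 mulmx0 mxtrace0.
Qed.

End Representations.

Section MatrixFacts.
Variable C : fieldType.

Lemma inj_row_free_tr (a b : nat) (z : 'M[C]_(a, b)) :
  (forall s : 'cV_b, z *m s = 0 -> s = 0) -> row_free z^T.
Proof.
move=> z_inj; rewrite -kermx_eq0; apply/rowV0P => v /sub_kermxP vz.
by rewrite -[v]trmxK (z_inj v^T) ?trmx0 // -[z]trmxK -trmx_mul vz trmx0.
Qed.

(* [r] and [c] identify the cokernel of [z] with a d-dimensional space. *)
Lemma cokernel_splitting (a b d : nat) (z : 'M[C]_(a, b)) : a = (b + d)%N ->
  (forall s : 'cV_b, z *m s = 0 -> s = 0) ->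
  exists (p : 'M_(b, a)) (r : 'M_(d, a)) (c : 'M_(a, d)),
    [/\ p *m z = 1%:M, r *m z = 0 & z *m p + c *m r = 1%:M].
Proof.
move=> aE z_inj; have free_z := inj_row_free_tr z_inj.
pose p : 'M_(b, a) := (pinvmx z^T)^T; have pz : p *m z = 1%:M.
  by rewrite -[z]trmxK -trmx_mul mulmxVp // trmx1.
pose e : 'M_a := 1%:M - z *m p.
have ez : e *m z = 0 by rewrite mulmxBl mul1mx -mulmxA pz mulmx1 subrr.
have ee : e *m e = e by rewrite {2}/e mulmxBr mulmxA ez mul0mx subr0 mulmx1.
have rank_e : (\rank e <= d)%N.
  have := mulmx0_rank_max ez; rewrite -[\rank z]mxrank_tr (eqP free_z).
  by rewrite {3}aE addnC leq_add2l.
pose c : 'M_(a, d) := col_ebase e *m pid_mx (\rank e).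
pose r : 'M_(d, a) := pid_mx (\rank e) *m row_ebase e.
have cr : c *m r = e.
  rewrite /c /r mulmxA -[_ *m pid_mx _ *m pid_mx _]mulmxA mul_pid_mx minnn.
  by rewrite (minn_idPr rank_e) mulmx_ebase.
exists p, (r *m e), c; split=> //; first by rewrite -mulmxA ez mulmx0.
by rewrite mulmxA cr ee /e addrC subrK.
Qed.

Lemma tr_mul_size1 (d : nat) (A B : 'M[C]_d) : d = 1%N -> \tr (A *m B) = \tr A * \tr B.
Proof.
by move=> d1; subst d; rewrite [A]mx11_scalar [B]mx11_scalar -scalar_mxM !mxtrace_scalar !mulr1n.
Qed.

End MatrixFacts.

(** * Consequences of stability for morphisms *)

Section Stability.
Variables (C : fieldType) (Q : quiver) (w v : Q -> nat).
Variable x : rep C w v v.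
Hypothesis x_stable : stable (w := w) x.

(** The images of the [xi k] form a subrepresentation contained in the kernel of [j]. *)
Lemma stable_image (n : Q -> nat) (xi : forall k, 'M[C]_(v k, n k))
    (f : forall i j : Q, darrow i j -> 'M[C]_(n j, n i)) :
  (forall (i j : Q) (h : darrow i j), Bm x h *m xi i = xi j *m f i j h) ->
  (forall k, jm x k *m xi k = 0) -> forall k, xi k = 0.
Proof.
move=> xB xj k; pose S k := limg (linfun (mulmx (xi k) : 'cV_(n k) -> 'cV_(v k))).
have memS l s : xi l *m s \in S l.
  by have := memv_img (linfun (mulmx (xi l) : 'cV_(n l) -> 'cV_(v l))) (memvf s); rewrite lfunE.
have := x_stable (S := S) _ _ k => S0.
have {}S0 : S k = 0%VS.
  apply: S0 => [i j h _ /memv_imgP[s _ ->]|l _ /memv_imgP[s _ ->]]; rewrite lfunE /=.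
    by rewrite mulmxA [Bmap x h *m _]xB -mulmxA memS.
  by rewrite mulmxA [jmap x l *m _]xj mul0mx.
apply/matrixP => a b; have := memS k (delta_mx b 0).
by rewrite S0 memv0 => /eqP/matrixP/(_ a 0); rewrite -colE !mxE.
Qed.

(** The kernels of the [z k] form a subrepresentation, contained in the kernel of [j] because [j]
    factors through [z]. *)
Lemma stable_kernel (n : Q -> nat) (z : forall k, 'M[C]_(n k, v k))
    (f : forall i j : Q, darrow i j -> 'M[C]_(n j, n i)) (g : forall k, 'M[C]_(w k, n k)) :
  (forall (i j : Q) (h : darrow i j), z j *m Bm x h = f i j h *m z i) ->
  (forall k, jm x k = g k *m z k) ->
  forall k (s : 'cV_(v k)), z k *m s = 0 -> s = 0.
Proof.
move=> zB zj k s zs0; pose S k := lker (linfun (mulmx (z k) : 'cV_(v k) -> 'cV_(n k))).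
have memS l t : (t \in S l) = (z l *m t == 0) by rewrite memv_ker lfunE.
have S0 : S k = 0%VS.
  apply: (x_stable (S := S)) => [i j h t|l t]; rewrite !memS => /eqP zt0.
    by rewrite mulmxA [z j *m Bmap x h]zB -mulmxA zt0 mulmx0.
  by rewrite [jmap x l]zj -mulmxA zt0 mulmx0.
by apply/eqP; rewrite -memv0 -S0 memS zs0.
Qed.

End Stability.

Lemma row_free_col_mx1 (C : fieldType) (k n : nat) (r : 'rV[C]_n) (A : 'M_(k, n)) :
  row_free A -> ~~ (r <= A)%MS -> row_free (col_mx r A).
Proof.
move=> freeA rA.
rewrite -kermx_eq0; apply/rowV0P => L /sub_kermxP.
rewrite -[L]hsubmxK mul_row_col => L0.
have l0 : lsubmx L = 0.
  have lE := mx11_scalar (lsubmx L); move: L0; rewrite lE mul_scalar_mx.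
  have [-> _|l0 /eqP] := eqVneq (lsubmx L 0 0) 0; first by rewrite -scalemx1 scale0r.
  rewrite addr_eq0 => /eqP lr; case/negP: rA.
  by rewrite -(eqmx_scale r l0) lr eqmx_opp submxMl.
move: L0; rewrite l0 mul0mx add0r => r0.
by rewrite (row_free_inj freeA (etrans r0 (esym (mul0mx _ _)))) row_mx0.
Qed.

(** Greedy choice: were it never to stop, there would be [n.+1] independent rows of length [n]. *)
Lemma spanning_rows (C : fieldType) (n : nat) (P : 'rV[C]_n -> Prop) :
  exists k (A : 'M_(k, n)),
    [/\ forall i, P (row i A), row_free A & forall r, P r -> (r <= A)%MS].
Proof.
apply: contrapT => noA.
suff /(_ n.+1)[A _ freeA] : forall k, exists2 A : 'M_(k, n), forall i, P (row i A) & row_free A.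
  by have := rank_leq_col A; rewrite (eqP freeA) ltnn.
elim=> [|k [A AP freeA]].
  by exists 0 => [[]//|]; rewrite /row_free mxrank0.
have [r rP rA] : exists2 r, P r & ~~ (r <= A)%MS.
  apply: contrapT => noP; apply: noA; exists k, A; split=> // r rP.
  by apply: contrapT => /negP rA; apply: noP; exists r.
exists (col_mx r A : 'M_(1 + k, n)).
  move=> a; case: (@split_ordP 1 k a) => b ->; last first.
    by rewrite (@rowKd _ 1 k n b r A); apply: AP.
  by rewrite (@rowKu _ 1 k n b r A) [b]ord1; have -> : row 0 r = r by apply/rowP => c; rewrite mxE.
exact: row_free_col_mx1.
Qed.

Lemma separating_rows (C : fieldType) (n : nat) (P : 'rV[C]_n -> Prop) :
  (forall s : 'cV_n, (forall r, P r -> r *m s = 0) -> s = 0) ->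
  exists2 A : 'M_n, forall i, P (row i A) & A \in unitmx.
Proof.
move=> sepP; have [k [A [AP freeA spanA]]] := spanning_rows P.
have kn : k = n.
  have free_tr : row_free A^T.
    apply: inj_row_free_tr => s As; apply: sepP => r /spanA /submxP[D ->].
    by rewrite -mulmxA As mulmx0.
  by rewrite -(eqP freeA) -mxrank_tr (eqP free_tr).
by subst k; exists A; rewrite // -row_free_unit.
Qed.

(** * Openness of stability *)

Section StabilityOpen.
Variables (C : fieldType) (Q : quiver) (w v : Q -> nat).

(* Matrix coefficients of the maps j B_{h_1} ... B_{h_m}, whose common kernel is
   the largest subrepresentation contained in ker j. *)
Inductive observable : forall l : Q, (rep C w v v -> 'rV[C]_(v l)) -> Prop :=
| observable_j l a : observable (fun x => row a (jm x l))
| observable_B (i j : Q) (h : darrow i j) phi :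
    observable (l := j) phi -> observable (fun x => phi x *m Bm x h).

Lemma observable_mfun l phi : @observable l phi -> mfun phi.
Proof.
elim=> {l phi} [l a|i j h phi _ phiP].
  move=> b c; have := @pfun_coord C (ecoord w v v) (inr (existT _ l (a, c))).
  by congr pfun; apply: funext => x; rewrite !mxE.
apply: mfunM => // a b.
have := @pfun_coord C (ecoord w v v) (inl (inl (existT _ i (existT _ j (h, (a, b)))))).
by congr pfun; apply: funext => x; rewrite !mxE.
Qed.

(** The common kernel of the observables is a subrepresentation in the kernel of [j].
    [spanning_rows] condenses the infinitely many conditions into one matrix at each vertex, which
    presents this kernel as a [{vspace}]. *)
Lemma stable_observable (x : rep C w v v) l (s : 'cV_(v l)) : stable (w := w) x ->
  (forall phi, observable phi -> phi x *m s = 0) -> s = 0.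
Proof.
move=> x_stable obs_s.
have /fin_all_exists[A AP] : forall k : Q, exists A : {n & 'M_(n, v k)}, forall t : 'cV_(v k),
    projT2 A *m t = 0 <-> forall phi, observable phi -> phi x *m t = 0.
  move=> k; pose P r := exists2 phi, @observable k phi & r = phi x.
  have [n [A [AP _ spanA]]] := spanning_rows P; exists (existT _ n A) => t /=.
  split=> [At phi phiP|obs_t].
    have /spanA/submxP[D ->] : P (phi x) by exists phi.
    by rewrite -mulmxA At mulmx0.
  apply/row_matrixP => a; rewrite row_mul row0; have [phi phiP ->] := AP a.
  exact: obs_t.
pose S k := lker (linfun (mulmx (projT2 (A k)) : 'cV_(v k) -> 'cV_(projT1 (A k)))).
have memS k t : t \in S k <-> forall phi, observable phi -> phi x *m t = 0.
  by rewrite memv_ker lfunE; apply: iff_trans (AP k t); split=> /eqP.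
have S0 : S l = 0%VS.
  apply: (x_stable S) => [i j h t /memS t0|k t /memS t0].
    apply/memS => phi phiP; rewrite mulmxA.
    exact: t0 _ (observable_B h phiP).
  apply/row_matrixP => a; rewrite row_mul row0; exact: t0 _ (observable_j a).
by apply/eqP; rewrite -memv0 -S0; apply/memS.
Qed.

Lemma observable_stable (x : rep C w v v) :
  (forall l (s : 'cV_(v l)), (forall phi, observable phi -> phi x *m s = 0) -> s = 0) ->
  stable (w := w) x.
Proof.
move=> obs0 S SB Sj k; apply/eqP; rewrite -subv0; apply/subvP => s sS.
rewrite memv0; apply/eqP/obs0 => phi phiP.
elim: phiP s sS => {k phi} [l a|i j h phi _ IH] s sS.
  by rewrite -row_mul Sj // row0.
by rewrite -mulmxA; apply/IH/SB.
Qed.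

(** At each vertex [l], stability at [z] yields [v l] observables that are independent at [z]; [g]
    is the product over the vertices of their determinants. *)
Lemma stable_open (z : rep C w v v) : stable (w := w) z ->
  exists g, [/\ pfun g, g z != 0 & forall x, g x != 0 -> stable (w := w) x].
Proof.
move=> z_stable.
have /choice[g gP] : forall l, exists g : rep C w v v -> C,
    [/\ pfun g, g z != 0 & forall x, g x != 0 ->
    forall s : 'cV_(v l), (forall phi, observable phi -> phi x *m s = 0) -> s = 0].
  move=> l; pose P r := exists2 phi, @observable l phi & r = phi z.
  have [|A AP A_unit] := @separating_rows _ _ P.
    move=> s sP; apply: (stable_observable z_stable) => phi phiP.
    by apply: sP; exists phi.
  have /choice[phi phiP] : forall a, exists phi, @observable l phi /\ row a A = phi z.
    by move=> a; have [phi ? ?] := AP a; exists phi.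
  exists (fun x => \det (\matrix_(a < v l) phi a x)); split.
  - apply: pfun_det => a b; have [/observable_mfun/(_ 0 b) + _] := phiP a.
    by congr pfun; apply: funext => x; rewrite mxE.
  - rewrite (_ : \matrix_a _ = A) -?unitfE -?unitmxE //.
    by apply/row_matrixP => a; rewrite rowK; have [_ ->] := phiP a.
  move=> x; rewrite -unitfE -unitmxE => unitx s sP; rewrite -[s](mulKmx unitx).
  suff -> : \matrix_a phi a x *m s = 0 by rewrite mulmx0.
  apply/row_matrixP => a; rewrite row_mul rowK row0; apply: sP.
  by have [] := phiP a.
exists (fun x => \prod_l g l x); split.
- by apply: pfun_prod => l; have [] := gP l.
- by apply/prodf_neq0 => l _; have [] := gP l.
move=> x /prodf_neq0 gx; apply: observable_stable => l.
by have [_ _] := gP l; apply; apply: gx.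
Qed.

End StabilityOpen.

(** * Nondegeneracy of the pairing *)

Section PairingNondegenerate.
Variables (C : numClosedFieldType) (Q : quiver).
Variables (eps : forall i j : Q, darrow i j -> C) (w : Q -> nat).
Hypothesis eps_neq0 : forall (i j : Q) (h : darrow i j), eps h != 0.
Hypothesis eps_bar : forall (i j : Q) (h : darrow i j), eps h + eps (bar h) = 0.

Definition adjm (m n : nat) (A : 'M[C]_(m, n)) : 'M_(n, m) := \matrix_(a, b) (A b a)^*.

Lemma tr_adjm m n (A : 'M[C]_(m, n)) : \tr (A *m adjm A) = \sum_a \sum_b `|A a b| ^+ 2.
Proof.
by apply: eq_bigr => a _; rewrite mxE; apply: eq_bigr => b _; rewrite mxE normCK.
Qed.

Lemma tr_adjm_ge0 m n (A : 'M[C]_(m, n)) : 0 <= \tr (A *m adjm A).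
Proof. by rewrite tr_adjm; apply: sumr_ge0 => a _; apply: sumr_ge0 => b _; rewrite exprn_ge0. Qed.

Lemma tr_adjm_eq0 m n (A : 'M[C]_(m, n)) : \tr (A *m adjm A) = 0 -> A = 0.
Proof.
rewrite tr_adjm => A0; apply/matrixP => a b; rewrite mxE; apply/eqP; rewrite -normr_eq0 -sqrf_eq0.
have sq0 c d : 0 <= `|A c d| ^+ 2 by rewrite exprn_ge0.
have /psumr_eq0P row0 : forall c, true -> 0 <= \sum_d `|A c d| ^+ 2 by move=> c _; apply: sumr_ge0.
have /psumr_eq0P := row0 A0 a isT; move=> /(_ (fun d _ => sq0 a d)).
by move=> /(_ b isT) ->.
Qed.

(** Against its own conjugate transpose, with arrows rescaled by [eps] and a sign on one framing
    map, [e] pairs to its squared Hermitian norm. *)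
Lemma pairing_nondegenerate va vb (e : rep C w va vb) :
  (forall f : rep C w vb va, pairing eps e f = 0) -> e = 0.
Proof.
pose f : rep C w vb va := mkrep (fun i j h => (eps (bar h))^-1 *: adjm (Bm e (bar h)))
  (fun k => - adjm (jm e k)) (fun k => adjm (im e k)).
move=> /(_ f).
have -> : pairing eps e f = \sum_i \sum_j \sum_(h : darrow i j) \tr (Bm e h *m adjm (Bm e h))
    + \sum_k (\tr (im e k *m adjm (im e k)) + \tr (jm e k *m adjm (jm e k))).
  congr (_ + _); last first.
    apply: eq_bigr => k _; rewrite !mkE mulNmx raddfN /= opprK; congr (_ + _).
    exact: mxtrace_mulC.
  apply: eq_bigr => i _; apply: eq_bigr => j _; apply: eq_bigr => h _.
  by rewrite mkE barK -scalemxAr mxtraceZ mulrA mulfV ?mul1r.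
have arrow_ge0 i j (h : darrow i j) : 0 <= \tr (Bm e h *m adjm (Bm e h)) := tr_adjm_ge0 _.
have hom_ge0 i j : 0 <= \sum_(h : darrow i j) \tr (Bm e h *m adjm (Bm e h)) by apply: sumr_ge0.
have out_ge0 i : 0 <= \sum_j \sum_(h : darrow i j) \tr (Bm e h *m adjm (Bm e h)) by apply: sumr_ge0.
have frame_ge0 k : 0 <= \tr (im e k *m adjm (im e k)) + \tr (jm e k *m adjm (jm e k)).
  by rewrite addr_ge0 // tr_adjm_ge0.
move=> /eqP; rewrite paddr_eq0 ?sumr_ge0 // => /andP[/eqP B0 /eqP IJ0].
have {}IJ0 k : \tr (im e k *m adjm (im e k)) = 0 /\ \tr (jm e k *m adjm (jm e k)) = 0.
  have /eqP := (psumr_eq0P (fun k _ => frame_ge0 k)) IJ0 k isT.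
  by rewrite paddr_eq0 ?tr_adjm_ge0 // => /andP[/eqP ? /eqP ?].
apply: rep_eq => [i j h|k|k]; rewrite ?Bm0 ?im0 ?jm0; apply: tr_adjm_eq0; last 2 first.
- by have [] := IJ0 k.
- by have [] := IJ0 k.
have Bi := (psumr_eq0P (fun i _ => out_ge0 i)) B0 i isT.
have Bj := (psumr_eq0P (fun j _ => hom_ge0 i j)) Bi j isT.
exact: (psumr_eq0P (fun h _ => arrow_ge0 i j h)) Bj h isT.
Qed.

Lemma sum_gcoord (va vb : Q -> nat) (lam : gcoord va vb -> C) (g : gmap C va vb) :
  \sum_c lam c * g c
  = \sum_k \tr (gm (mkg (fun k => \matrix_(a, b) lam (existT _ k (b, a))) : gmap C vb va) k
                *m gm g k).
Proof.
transitivity (\sum_(k : Q) \sum_(ab : 'I_(vb k) * 'I_(va k))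
    lam (existT _ k ab) * g (existT _ k ab)).
  rewrite [RHS]sig_big_dep /=.
  by apply: eq_bigr => -[k ab] _.
apply: eq_bigr => k _; rewrite mkE mxtrace_mulC.
transitivity (\sum_a \sum_b lam (existT _ k (a, b)) * g (existT _ k (a, b))).
  by rewrite pair_bigA; apply: eq_bigr => -[a b] _.
apply: eq_bigr => a _; rewrite mxE; apply: eq_bigr => b _.
by rewrite !mxE mulrC.
Qed.

Lemma gmap_tr_eq0 (va vb : Q -> nat) (lam : gcoord va vb -> C) :
  mkg (fun k => \matrix_(a, b) lam (existT _ k (b, a))) = 0 :> gmap C vb va -> forall c, lam c = 0.
Proof.
move=> lam0 [k [a b]]; have := congr1 (fun g : gmap C vb va => gm g k b a) lam0.
by rewrite mkE gm0 !mxE.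
Qed.

End PairingNondegenerate.

Section Linearity.
Variables (C : fieldType) (Q : quiver) (eps : forall i j : Q, darrow i j -> C) (w : Q -> nat).

Lemma pairing_linl va vb (f : rep C w vb va) : linform (fun e : rep C w va vb => pairing eps e f).
Proof.
move=> a u v; rewrite /pairing mulrDr addrACA; congr (_ + _).
  rewrite mulr_sumr -big_split; apply: eq_bigr => i _ /=.
  rewrite mulr_sumr -big_split; apply: eq_bigr => j _ /=.
  rewrite mulr_sumr -big_split; apply: eq_bigr => h _ /=.
  by rewrite lcombE mulmxDl -scalemxAl mxtraceD mxtraceZ; ring.
rewrite mulr_sumr -big_split; apply: eq_bigr => k _ /=.
by rewrite !lcombE mulmxDl mulmxDr -scalemxAl -scalemxAr !mxtraceD !mxtraceZ; ring.
Qed.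

Lemma mom_linl va vb vc a (u v : rep C w vb vc) (f : rep C w va vb) k :
  mom eps (lcomb a u v) f k = a *: mom eps u f k + mom eps v f k.
Proof.
rewrite /mom scalerDr addrACA; congr (_ + _); last by rewrite !lcombE mulmxDl -scalemxAl.
rewrite scaler_sumr -big_split; apply: eq_bigr => l _ /=.
rewrite scaler_sumr -big_split; apply: eq_bigr => h _ /=.
by rewrite lcombE mulmxDl -scalemxAl scalerDr !scalerA mulrC.
Qed.

Lemma mom_linr va vb vc a (u v : rep C w va vb) (e : rep C w vb vc) k :
  mom eps e (lcomb a u v) k = a *: mom eps e u k + mom eps e v k.
Proof.
rewrite /mom scalerDr addrACA; congr (_ + _); last by rewrite !lcombE mulmxDr -scalemxAr.
rewrite scaler_sumr -big_split; apply: eq_bigr => l _ /=.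
rewrite scaler_sumr -big_split; apply: eq_bigr => h _ /=.
by rewrite lcombE mulmxDr -scalemxAr scalerDr !scalerA mulrC.
Qed.

Lemma alpha_lin (va vb : Q -> nat) (x : rep C w va va) (y : rep C w vb vb) a
    (xi xi' : gmap C va vb) :
  alpha x y (lcomb a xi xi') = lcomb a (alpha x y xi) (alpha x y xi').
Proof.
apply: rep_eq => [i j h|k|k]; rewrite lcombE !mkE !lcombE.
- by rewrite mulmxDl mulmxDr -scalemxAl -scalemxAr scalerBr opprD addrACA.
- by rewrite mulmxDl -scalemxAl opprD scalerN.
by rewrite mulmxDr -scalemxAr.
Qed.

Lemma alpha_lin_base va vb a (x x' : rep C w va va) (y y' : rep C w vb vb) (xi : gmap C va vb) :
  alpha (lcomb a x x') (lcomb a y y') xi = lcomb a (alpha x y xi) (alpha x' y' xi).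
Proof.
apply: rep_eq => [i j h|k|k]; rewrite lcombE !mkE !lcombE.
- by rewrite mulmxDl mulmxDr -scalemxAl -scalemxAr scalerBr opprD addrACA.
- by rewrite mulmxDr -scalemxAr opprD scalerN.
by rewrite mulmxDl -scalemxAl.
Qed.

Lemma sect_lin va vb a (x x' : rep C w va va) (y y' : rep C w vb vb) :
  sect (lcomb a x x') (lcomb a y y') = lcomb a (sect x y) (sect x' y').
Proof.
apply: rep_eq => [i j h|k|k]; rewrite lcombE !mkE ?lcombE //.
  by rewrite scaler0 addr0.
by rewrite scalerN opprD.
Qed.

Lemma beta_lin va vb (x : rep C w va va) (y : rep C w vb vb) a (u v : rep C w va vb) :
  beta eps x y (lcomb a u v) = lcomb a (beta eps x y u) (beta eps x y v).
Proof.
by apply: gmap_eq => k; rewrite lcombE !mkE mom_linl mom_linr addrACA -scalerDr.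
Qed.

Lemma beta_lin_base va vb a (x x' : rep C w va va) (y y' : rep C w vb vb) (e : rep C w va vb) :
  beta eps (lcomb a x x') (lcomb a y y') e = lcomb a (beta eps x y e) (beta eps x' y' e).
Proof.
by apply: gmap_eq => k; rewrite lcombE !mkE mom_linl mom_linr addrACA -scalerDr.
Qed.

End Linearity.

Lemma addr_regroup (V : zmodType) (a b c d e f g h : V) :
  a - b + (c - d) + (e - f + (g - h)) = a + c + (e + g) - (b + d + (f + h)).
Proof. by rewrite !opprD [LHS](AC ((2*2)*(2*2)) ((1*3*(5*7))*(2*4*(6*8))))%AC. Qed.

(** * The Hecke correspondence *)

Section HeckePair.
Variables (C : numClosedFieldType) (Q : quiver).
Variables (eps : forall i j : Q, darrow i j -> C) (w : Q -> nat).
Hypothesis eps_neq0 : forall (i j : Q) (h : darrow i j), eps h != 0.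
Hypothesis eps_bar : forall (i j : Q) (h : darrow i j), eps h + eps (bar h) = 0.

Lemma alpha_inj (va vb : Q -> nat) (x : rep C w va va) (y : rep C w vb vb) xi :
  stable (w := w) y -> alpha x y xi = 0 -> xi = 0.
Proof.
move=> y_stable xi0; apply: gmap_eq => k; rewrite gm0.
apply: (stable_image y_stable (xi := gm xi) (f := fun i j h => Bm x h)) => [i j h|l].
  apply/eqP; rewrite -subr_eq0; apply/eqP.
  by have := congr1 (fun e => Bm e h) xi0; rewrite mkE Bm0.
have := congr1 (fun e => jm e l) xi0.
by rewrite mkE jm0.
Qed.

Variables (v1 v2 : Q -> nat) (k : Q).
Hypothesis v2E : forall l : Q, v2 l = (v1 l + (l == k))%N.
Variables (x : rep C w v1 v1) (y : rep C w v2 v2) (zeta : gmap C v1 v2).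
Hypothesis x_stable : stable (w := w) x.
Hypothesis y_stable : stable (w := w) y.
Hypothesis y_moment : forall l, mom eps y y l = 0.
Hypothesis zetaP : alpha x y zeta = sect x y.
Let z := gm zeta.

Let zB (i j : Q) (h : darrow i j) : Bm y h *m z i = z j *m Bm x h.
Proof.
by apply/eqP; rewrite -subr_eq0; have := congr1 (fun e => Bm e h) zetaP; rewrite !mkE => ->.
Qed.
Let zi l : im y l = z l *m im x l.
Proof. by have := congr1 (fun e => im e l) zetaP; rewrite !mkE => /oppr_inj. Qed.
Let zj l : jm y l *m z l = jm x l.
Proof. by have := congr1 (fun e => jm e l) zetaP; rewrite !mkE. Qed.

(** By duality, an annihilator of the image of the second map is a pair with
    [c *: sect y x + alpha y x xi = 0]. Such a [xi] commutes with the arrows, and its failure to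
    respect the framing is measured by [c]. *)
Lemma hecke_surjective (xi : gmap C v2 v1) (c : C) :
  (forall e, \sum_l \tr (gm xi l *m gm (beta eps x y e) l) + c * pairing eps e (sect y x) = 0) ->
  xi = 0 /\ c = 0.
Proof.
move=> ann; pose f := lcomb c (sect y x) (alpha y x xi).
have {ann} f0 : f = 0.
  apply: (pairing_nondegenerate eps_neq0 (eps := eps)) => e; rewrite /f pairing_linl.
  rewrite [pairing _ (sect _ _) _]pairing_anti // [pairing _ (alpha _ _ _) _]pairing_anti //.
  by rewrite pairing_alpha // mulrN -opprD addrC ann oppr0.
have xB (i j : Q) (h : darrow i j) : Bm x h *m gm xi i = gm xi j *m Bm y h.
  have := congr1 (fun e => Bm e h) f0; rewrite Bm0 /f lcombE !mkE scaler0 add0r => /eqP.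
  by rewrite subr_eq0 => /eqP.
have xii l : gm xi l *m im y l = - (c *: im x l).
  have := congr1 (fun e => im e l) f0; rewrite im0 /f lcombE !mkE => /eqP.
  by rewrite subr_eq0 scalerN eq_sym => /eqP.
have xj l : jm x l *m gm xi l = - (c *: jm y l).
  have := congr1 (fun e => jm e l) f0; rewrite jm0 /f lcombE !mkE => /eqP.
  by rewrite addrC addr_eq0 => /eqP.
(* Composing with [zeta] gives an endomorphism of the arrows of [y]; the scalar [c] corrects it so
   that its image lies in the kernel of [j]. *)
have zxi l : z l *m gm xi l + c%:M = 0.
  apply: (stable_image y_stable (xi := fun l => z l *m gm xi l + c%:M)
    (f := fun i j h => Bm y h)) => [i j h|l'].
    by rewrite mulmxDr mulmxDl mulmxA zB -!mulmxA xB -scalar_mxC.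
  by rewrite mulmxDr mulmxA zj xj mul_mx_scalar addNr.
have c0 : c = 0.
  (* For [c] nonzero, an invertible scalar of V^2_k would factor through V^1_k, which has one
     dimension less. *)
  apply: contrapT => /eqP c_neq0; have := zxi k => /eqP; rewrite addr_eq0 => /eqP zxi_k.
  have : (v2 k <= v1 k)%N.
    rewrite -[leqLHS](mxrank1 C) -(mxrank_scale_nz 1%:M (_ : - c != 0)) ?oppr_eq0 //.
    rewrite scaleNr scalemx1 -zxi_k; apply: leq_trans (mxrankM_maxl _ _) _.
    exact: rank_leq_col.
  by rewrite v2E eqxx addn1 ltnn.
split=> //; apply: gmap_eq => l; rewrite gm0.
apply: (stable_image x_stable (xi := gm xi) (f := fun i j h => Bm y h)) => // l'.
by rewrite xj c0 scale0r oppr0.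
Qed.

Section Tangents.

Definition moment_tangent v (a u : rep C w v v) := forall l, mom eps a u l + mom eps u a l = 0.

(** This is the condition [N_drel] of the determinantal criterion. Moving [zeta] across the arrows
    of [x] and [y], the first expression becomes [z] times the differential of the moment map at
    [x], minus the one at [y] times [z]; the second becomes the difference of the traces of these
    differentials. *)
Lemma hecke_relation (u1 : rep C w v1 v1) (u2 : rep C w v2 v2) :
  moment_tangent x u1 -> moment_tangent y u2 ->
  beta eps x y (sect u1 u2 - alpha u1 u2 zeta) = 0 /\
  pairing eps (sect u1 u2 - alpha u1 u2 zeta) (sect y x) = 0.
Proof.
move=> u1_tan u2_tan; set d := sect _ _ - _.
have dB (i j : Q) (h : darrow i j) : Bm d h = z j *m Bm u1 h - Bm u2 h *m z i.
  by rewrite repBE !mkE sub0r opprB.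
have di l : im d l = z l *m im u1 l - im u2 l by rewrite repBE !mkE opprK addrC.
have dj l : jm d l = jm u1 l - jm u2 l *m z l by rewrite repBE !mkE.
clearbody d z; split.
  apply: gmap_eq => l; rewrite mkE gm0.
  transitivity (z l *m (mom eps x u1 l + mom eps u1 x l)
      - (mom eps y u2 l + mom eps u2 y l) *m z l); last first.
    by rewrite u1_tan u2_tan mulmx0 mul0mx subrr.
  rewrite /mom !mulmxDr !mulmxDl !mulmx_sumr !mulmx_suml.
  rewrite (_ : \sum_l' \sum_(h : darrow l' l) eps h *: (Bm y h *m Bm d (bar h)) =
    \sum_l' z l *m (\sum_(h : darrow l' l) eps h *: (Bm x h *m Bm u1 (bar h)))
    - \sum_l' (\sum_(h : darrow l' l) eps h *: (Bm y h *m Bm u2 (bar h))) *m z l); last first.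
    rewrite -sumrB; apply: eq_bigr => l' _; rewrite mulmx_sumr mulmx_suml -sumrB.
    apply: eq_bigr => h _; rewrite dB mulmxBr scalerBr -scalemxAr -scalemxAl; congr (_ - _).
      by rewrite mulmxA zB -mulmxA.
    by rewrite mulmxA.
  rewrite (_ : \sum_l' \sum_(h : darrow l' l) eps h *: (Bm d h *m Bm x (bar h)) =
    \sum_l' z l *m (\sum_(h : darrow l' l) eps h *: (Bm u1 h *m Bm x (bar h)))
    - \sum_l' (\sum_(h : darrow l' l) eps h *: (Bm u2 h *m Bm y (bar h))) *m z l); last first.
    rewrite -sumrB; apply: eq_bigr => l' _; rewrite mulmx_sumr mulmx_suml -sumrB.
    apply: eq_bigr => h _; rewrite dB mulmxBl scalerBr -scalemxAr -scalemxAl; congr (_ - _).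
      by rewrite mulmxA.
    by rewrite -mulmxA -zB mulmxA.
  rewrite di dj mulmxBr mulmxBl -!mulmxA zj !mulmxA -zi.
  exact: addr_regroup.
rewrite pairing_sect; transitivity (\sum_l \tr (mom eps x u1 l + mom eps u1 x l)
    - \sum_l \tr (mom eps y u2 l + mom eps u2 y l)); last first.
  by rewrite !big1 ?subrr // => l _; rewrite ?u1_tan ?u2_tan mxtrace0.
rewrite !sum_tr_anti // -sumrB; apply: eq_bigr => l _.
rewrite di dj mulmxBl mulmxBr !raddfB /= !mxtraceD.
have -> : \tr (z l *m im u1 l *m jm y l) = \tr (im u1 l *m jm x l).
  by rewrite mxtrace_mulC mulmxA zj mxtrace_mulC.
have -> : \tr (im x l *m (jm u2 l *m z l)) = \tr (im y l *m jm u2 l).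
  by rewrite mulmxA mxtrace_mulC mulmxA -zi.
ring.
Qed.

Lemma hecke_inj l (s : 'cV_(v1 l)) : z l *m s = 0 -> s = 0.
Proof.
by apply: (stable_kernel x_stable (f := fun i j h => Bm y h) (g := jm y)) => [i j h|l'];
  rewrite ?zB ?zj.
Qed.

Definition intertwined (u1 : rep C w v1 v1) (u2 : rep C w v2 v2) :=
  [/\ forall (i j : Q) (h : darrow i j), Bm u2 h *m z i = z j *m Bm u1 h,
      forall l, im u2 l = z l *m im u1 l & forall l, jm u2 l *m z l = jm u1 l].

Definition trd (u1 : rep C w v1 v1) (u2 : rep C w v2 v2) (l : darrow k k) :=
  \tr (Bm u2 l) - \tr (Bm u1 l).

(* Only the traces on the line V^2_k / V^1_k contribute to the difference. *)
Lemma intertwined_pairing u1 u2 w1 w2 : intertwined u1 u2 -> intertwined w1 w2 ->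
  pairing eps u2 w2 - pairing eps u1 w1 = \sum_l eps l * trd u1 u2 l * trd w1 w2 (bar l).
Proof.
move=> [uB ui uj] [wB wi wj].
(* The cokernel of [z l] is modelled on a space of dimension [(l == k : nat)]: a line at [k], zero
   elsewhere. *)
have /fin_all_exists[p pP] : forall l : Q, exists p : 'M_(v1 l, v2 l),
    exists (r : 'M_((l == k : nat), v2 l)) (c : 'M_(v2 l, (l == k : nat))),
    [/\ p *m z l = 1%:M, r *m z l = 0 & z l *m p + c *m r = 1%:M].
  by move=> l; apply: cokernel_splitting (v2E l) _; apply: hecke_inj.
have /fin_all_exists[r rP] := pP; have /fin_all_exists[c {pP rP}cP] := rP.
have pz l : p l *m z l = 1%:M by have [] := cP l.
have rz l : r l *m z l = 0 by have [] := cP l.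
have zpcr l : z l *m p l + c l *m r l = 1%:M by have [] := cP l.
have trE l (A : 'M_(v2 l)) (B : 'M_(v1 l)) : A *m z l = z l *m B ->
    \tr A - \tr B = \tr (r l *m A *m c l).
  move=> AB; rewrite -[A in \tr A]mulmx1 -(zpcr l) mulmxDr mxtraceD !mulmxA AB.
  rewrite [X in X + _ - _]mxtrace_mulC mulmxA pz mul1mx addrAC subrr add0r.
  by rewrite mxtrace_mulC mulmxA.
(* An intertwined [A] preserves the image of [z], hence induces the map [r j *m A *m c i] of
   cokernels. *)
have rB (i j : Q) (A : 'M_(v2 j, v2 i)) (B : 'M_(v1 j, v1 i)) : A *m z i = z j *m B ->
    r j *m A = r j *m A *m c i *m r i.
  move=> AB; rewrite -[RHS]mulmxA (_ : c i *m r i = 1%:M - z i *m p i).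
    by rewrite mulmxBr mulmx1 mulmxA -[r j *m A *m z i]mulmxA AB !mulmxA rz !mul0mx subr0.
  by rewrite -(zpcr i) addrAC subrr add0r.
pose X i j (h : darrow i j) := r j *m Bm u2 h *m c i.
pose Y i j (h : darrow i j) := r j *m Bm w2 h *m c i.
have arrowE i j (h : darrow i j) :
    \tr (Bm u2 h *m Bm w2 (bar h)) - \tr (Bm u1 h *m Bm w1 (bar h))
    = \tr (X i j h *m Y j i (bar h)).
  rewrite (trE j _ (Bm u1 h *m Bm w1 (bar h))); last first.
    by rewrite -mulmxA wB mulmxA uB mulmxA.
  by rewrite mulmxA (rB i j _ _ (uB i j h)) /X /Y !mulmxA.
have size0 (i j : Q) (A : 'M[C]_((i == k : nat), (j == k : nat)))
    (B : 'M_((j == k : nat), (i == k : nat))) :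
    (i != k) || (j != k) -> \tr (A *m B) = 0.
  case/orP => /negPf ne.
    rewrite /mxtrace big1 // => a; exfalso; have := leq_ltn_trans (leq0n a) (ltn_ord a).
    by rewrite lt0b ne.
  suff -> : A = 0 by rewrite mul0mx mxtrace0.
  apply/matrixP => a b; exfalso; have := leq_ltn_trans (leq0n b) (ltn_ord b).
  by rewrite lt0b ne.
(* The framing terms cancel: [i] of the large space factors through [z], and [j] restricts along [z]
   to that of the small one. *)
rewrite /pairing opprD addrACA -[X in _ + X]sumrB [X in _ + X]big1 ?addr0 => [|l _]; last first.
  rewrite ui wi -!mulmxA -uj -wj; apply/eqP; rewrite subr_eq0; apply/eqP; congr (_ - _).
    by rewrite mxtrace_mulC !mulmxA.
  by rewrite mxtrace_mulC !mulmxA.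
rewrite -sumrB (bigD1 k) //= [X in _ + X]big1 ?addr0 => [|i neq_i]; last first.
  rewrite -sumrB big1 // => j _; rewrite -sumrB big1 // => h _.
  by rewrite -mulrBr arrowE size0 ?mulr0 // neq_i orbT.
rewrite -sumrB (bigD1 k) //= [X in _ + X]big1 ?addr0 => [|j neq_j]; last first.
  by rewrite -sumrB big1 // => h _; rewrite -mulrBr arrowE size0 ?mulr0 // neq_j.
rewrite -sumrB; apply: eq_bigr => h _; rewrite -mulrBr arrowE -mulrA; congr (_ * _).
by rewrite tr_mul_size1 ?eqxx // /trd (trE k _ _ (uB k k h)) (trE k _ _ (wB k k (bar h))).
Qed.

(** [xi] is the derivative of [zeta] in the equation [alpha x y zeta = sect x y], differentiated
    along [(u1, u2)]. *)
Definition hecke_tangent u1 u2 := [/\ moment_tangent x u1, moment_tangent y u2 &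
  exists xi, alpha x y xi = sect u1 u2 - alpha u1 u2 zeta].

Lemma moment_tangent_alpha v (a : rep C w v v) xi : (forall l, mom eps a a l = 0) ->
  moment_tangent a (alpha a a xi).
Proof.
move=> a0 l; have := beta_alpha eps a a xi l.
by rewrite mkE => ->; rewrite a0 mulmx0 mul0mx subrr.
Qed.

(* An infinitesimal gauge transformation of V^2 makes the tangent vector
   intertwined. *)
Lemma hecke_tangent_intertwined u1 u2 : hecke_tangent u1 u2 ->
  exists eta, intertwined u1 (lcomb 1 u2 (alpha y y eta)).
Proof.
move=> [_ _ [xi xiP]].
have /fin_all_exists[p pz] : forall l : Q, exists p : 'M_(v1 l, v2 l), p *m z l = 1%:M.
  move=> l; have [p [r [c [pz _ _]]]] := cokernel_splitting (v2E l) (@hecke_inj l).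
  by exists p.
(* This [eta] restricts to [xi] along [z], so the gauge transformation absorbs the variation of
   [zeta]. *)
exists (mkg (fun l => gm xi l *m p l)); split=> [i j h|l|l]; rewrite lcombE scale1r !mkE.
- rewrite mulmxDl mulmxBl -!mulmxA zB [p j *m _]mulmxA !pz !mul1mx mulmx1.
  rewrite [z j *m Bm u1 h](_ : _ = Bm u2 h *m z i + (Bm y h *m gm xi i - gm xi j *m Bm x h)) //.
  have := congr1 (fun e => Bm e h) xiP; rewrite repBE !mkE sub0r opprB => ->.
  by rewrite addrC subrK.
- have := congr1 (fun e => im e l) xiP; rewrite repBE !mkE opprK zi => E.
  by rewrite -!mulmxA [p l *m _]mulmxA pz mul1mx E addrA subrr add0r.
have := congr1 (fun e => jm e l) xiP; rewrite repBE !mkE => E.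
by rewrite mulmxDl -!mulmxA pz mulmx1 E addrC subrK.
Qed.

Lemma pairing_gauge v (a u w' : rep C w v v) eta theta : (forall l, mom eps a a l = 0) ->
  moment_tangent a u -> moment_tangent a w' ->
  pairing eps (lcomb 1 u (alpha a a eta)) (lcomb 1 w' (alpha a a theta)) = pairing eps u w'.
Proof.
move=> a0 u_tan w_tan.
have alpha0 b (t : gmap C v v) : moment_tangent a b -> pairing eps b (alpha a a t) = 0.
  exact: pairing_alphaN.
have alpha0' b (t : gmap C v v) : moment_tangent a b -> pairing eps (alpha a a t) b = 0.
  by move=> b_tan; rewrite pairing_anti // alpha0 // oppr0.
have linr (e f g : rep C w v v) : pairing eps e (lcomb 1 f g) = pairing eps e f + pairing eps e g.
  rewrite pairing_anti // pairing_linl mul1r opprD.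
  by rewrite -[- pairing eps f e]pairing_anti // -[- pairing eps g e]pairing_anti.
rewrite pairing_linl mul1r !linr [pairing eps u (alpha _ _ _)]alpha0 // alpha0' // alpha0.
  by rewrite !addr0.
exact: moment_tangent_alpha.
Qed.

Lemma trd_gauge u1 u2 eta l : trd u1 (lcomb 1 u2 (alpha y y eta)) l = trd u1 u2 l.
Proof.
rewrite /trd lcombE scale1r mxtraceD mkE raddfB /= [\tr (gm _ _ *m _)]mxtrace_mulC.
by rewrite subrr addr0.
Qed.

Lemma hecke_isotropic u1 u2 w1 w2 : hecke_tangent u1 u2 -> hecke_tangent w1 w2 ->
  pairing eps u1 w1 - pairing eps u2 w2
  + \sum_l eps l * trd u1 u2 l * trd w1 w2 (bar l) = 0.
Proof.
move=> uP wP; have [eta etaP] := hecke_tangent_intertwined uP.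
have [theta thetaP] := hecke_tangent_intertwined wP.
have := intertwined_pairing etaP thetaP.
have [_ u2_tan _] := uP; have [_ w2_tan _] := wP.
rewrite pairing_gauge // => E.
rewrite -opprB E addrC; apply/eqP; rewrite subr_eq0; apply/eqP; apply: eq_bigr => l _.
by rewrite !trd_gauge.
Qed.

End Tangents.
End HeckePair.

(** * Dimension counts *)

Section Dimensions.
Variables (Q : quiver) (w : Q -> nat).

Lemma card_gcoord (va vb : Q -> nat) : #|gcoord va vb| = (\sum_k vb k * va k)%N.
Proof.
rewrite card_tagged sumnE big_map big_enum; apply: eq_bigr => k _.
by rewrite card_prod !card_ord.
Qed.

Lemma card_ecoord (va vb : Q -> nat) : #|ecoord w va vb|
  = (\sum_i \sum_j #|darrow i j| * (vb j * va i) + \sum_k vb k * w k + \sum_k w k * va k)%N.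
Proof.
rewrite !card_sum; congr (_ + _ + _)%N; rewrite card_tagged sumnE big_map big_enum.
- apply: eq_bigr => i _; rewrite card_tagged sumnE big_map big_enum; apply: eq_bigr => j _.
  by rewrite card_prod card_prod !card_ord.
- by apply: eq_bigr => k _; rewrite card_prod !card_ord.
by apply: eq_bigr => k _; rewrite card_prod !card_ord.
Qed.

Lemma card_darrowC (i j : Q) : #|darrow i j| = #|darrow j i|.
Proof. by rewrite !card_sum addnC. Qed.

(** Arrows pair with their reversals and [i] with [j]. *)
Lemma card_ecoord_even v : ~~ odd #|ecoord w v v|.
Proof.
rewrite card_ecoord -addnA oddD [X in _ (+) odd X](_ : _ = (\sum_k v k * w k).*2); last first.
  by rewrite -addnn; congr (_ + _)%N; apply: eq_bigr => k _; rewrite mulnC.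
rewrite odd_double addbF; set S := (\sum_i _)%N.
suff -> : S = (\sum_i \sum_j #|edge i j| * (v j * v i)).*2 by rewrite odd_double.
rewrite -addnn [X in (_ + X)%N]exchange_big -big_split; apply: eq_bigr => i _.
rewrite -big_split; apply: eq_bigr => j _ /=.
by rewrite card_sum mulnDl (mulnC (v j) (v i)).
Qed.

Variables (v1 v2 : Q -> nat) (k : Q).
Hypothesis v2E : forall l : Q, v2 l = (v1 l + (l == k))%N.

Lemma sum_delta (f : Q -> nat) : (\sum_l f l * (l == k) = f k)%N.
Proof.
rewrite (bigD1 k) //= eqxx muln1 big1 ?addn0 // => l /negPf ->.
by rewrite muln0.
Qed.

(** The sum of squares of [v2 - v1] is 1; this unit matches the [unit] coordinate of [hecke_rel]. *)
Lemma card_gcoord_hecke :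
  (#|gcoord v1 v1| + #|gcoord v2 v2| = 2 * #|gcoord v1 v2| + 1)%N.
Proof.
have sum1 : (\sum_l (l == k) * (l == k) = 1)%N by rewrite (sum_delta (fun l => l == k)) eqxx.
rewrite !card_gcoord -[X in _ = (_ + X)%N]sum1.
rewrite big_distrr -!big_split; apply: eq_bigr => l _ /=; rewrite v2E.
move: (v1 l) (nat_of_bool (l == k)) => a b; nia.
Qed.

(** The form [q] is bilinear and symmetric, so the arrow terms differ by [q d d], where [d] is
    [v2 - v1]; the framing terms are linear and balance. *)
Lemma card_ecoord_hecke :
  (#|ecoord w v1 v1| + #|ecoord w v2 v2| = 2 * #|ecoord w v1 v2| + #|darrow k k|)%N.
Proof.
rewrite !card_ecoord.
pose q (va vb : Q -> nat) := (\sum_i \sum_j #|darrow i j| * (vb j * va i))%N.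
rewrite -![(\sum_i \sum_j _)%N]/(q _ _).
pose d (l : Q) : nat := (l == k).
have qC va vb : q va vb = q vb va.
  rewrite /q exchange_big; apply: eq_bigr => i _; apply: eq_bigr => j _.
  by rewrite card_darrowC (mulnC (vb i)).
have qDl va vb vc : (forall l, va l = vb l + vc l)%N -> forall v, q va v = (q vb v + q vc v)%N.
  move=> E v; rewrite -big_split; apply: eq_bigr => i _; rewrite -big_split; apply: eq_bigr => j _.
  by rewrite /= E !mulnDr.
have qdd : q d d = #|darrow k k|.
  transitivity (\sum_i (\sum_j (#|darrow i j| * (i == k)) * (j == k)))%N.
    by apply: eq_bigr => i _; apply: eq_bigr => j _; rewrite /d mulnAC mulnA.
  by under eq_bigr => i _ do rewrite sum_delta; rewrite sum_delta.
have q2 v : q v2 v = (q v1 v + q d v)%N by apply: qDl.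
have wE : (\sum_l v2 l * w l = \sum_l v1 l * w l + w k)%N.
  rewrite -(sum_delta w) -big_split; apply: eq_bigr => l _ /=; rewrite v2E; nia.
have wE' : (\sum_l w l * v2 l = \sum_l w l * v1 l + w k)%N.
  rewrite -(sum_delta w) -big_split; apply: eq_bigr => l _ /=; rewrite v2E; nia.
rewrite wE wE' (qC v1 v2) !q2 (qC v1 v2) (qC d v2) !q2 qdd (qC v1 d); lia.
Qed.

End Dimensions.

Lemma mxof_comp0 (C : fieldType) (T1 T2 T3 : finType) (f : point C T1 -> point C T2)
    (g : point C T2 -> point C T3) : linmap f -> linmap g -> (forall u, g (f u) = 0) ->
  mxof g *m mxof f = 0.
Proof.
move=> lf lg gf0; apply/matrixP => a b.
have E : (mxof g *m colp (f (unitp C (enum_val b)))) a 0 = 0 by rewrite mxofE // gf0 mxE ffunE.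
by rewrite [RHS]mxE -[RHS]E !mxE; apply: eq_bigr => c _; rewrite !mxE.
Qed.

Lemma colp0 (C : fieldType) (T : finType) : colp (0 : point C T) = 0.
Proof. by apply/matrixP => a b; rewrite !mxE ffunE. Qed.

Lemma colpB (C : fieldType) (T : finType) (u v : point C T) : colp (u - v) = colp u - colp v.
Proof. by apply/matrixP => a b; rewrite !mxE !ffunE. Qed.

(** * Exactness properties at stable points *)

Section HeckeRelation.
Variables (C : numClosedFieldType) (Q : quiver).
Variables (eps : forall i j : Q, darrow i j -> C) (w : Q -> nat).
Hypothesis eps_neq0 : forall (i j : Q) (h : darrow i j), eps h != 0.
Hypothesis eps_bar : forall (i j : Q) (h : darrow i j), eps h + eps (bar h) = 0.

Lemma pairing_linr va vb (e : rep C w va vb) : linform (fun f : rep C w vb va => pairing eps e f).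
Proof. by move=> a u v; rewrite !(pairing_anti eps_bar e) pairing_linl; ring. Qed.

Lemma sum_tr_frame v (x : rep C w v v) : (forall l, mom eps x x l = 0) ->
  \sum_l \tr (im x l *m jm x l) = 0.
Proof.
move=> x0; have := sum_tr_anti eps_bar x x; rewrite big1 => [|l _]; last first.
  by rewrite x0 addr0 mxtrace0.
under eq_bigr => l _ do rewrite mxtraceD; rewrite big_split /= => /esym/eqP.
by rewrite -mulr2n mulrn_eq0 /= => /eqP.
Qed.

(** A relation between the differentials is a [xi] trace-orthogonal to the image of [beta]; by
    duality [alpha x x xi = 0], and stability gives [xi = 0]. *)
Lemma quiver_variety_indep v (x : rep C w v v) : stable (w := w) x ->
  independent (fun (c : gcoord v v) (u : rep C w v v) => beta eps x x u c).
Proof.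
move=> x_stable lam lam0; apply: gmap_tr_eq0; set xi := mkg _.
apply: (alpha_inj x_stable (x := x)); apply: (pairing_nondegenerate eps_neq0 (eps := eps)) => u.
by rewrite pairing_anti // pairing_alpha // -sum_gcoord lam0 oppr0.
Qed.

(** In the complex L -> E -> L the first map is injective and the second onto. The bound makes the
    natural-number subtraction in the dimension formula a genuine one. *)
Lemma card_gcoord_le v (x : rep C w v v) : stable (w := w) x -> (forall l, mom eps x x l = 0) ->
  (#|gcoord v v| + #|gcoord v v| <= #|ecoord w v v|)%N.
Proof.
move=> x_stable x0; have lalpha : linmap (alpha x x) := linmapP (alpha_lin x x).
have lbeta : linmap (beta eps x x) := linmapP (beta_lin eps x x).
have ba : mxof (beta eps x x) *m mxof (alpha x x) = 0.
  apply: mxof_comp0 => // xi; apply: gmap_eq => l.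
  by rewrite beta_alpha x0 mulmx0 mul0mx subrr gm0.
have := mulmx0_rank_max ba; congr (_ + _ <= _)%N.
  have /(row_free_indep _) : independent
      (fun (c : gcoord v v) (u : rep C w v v) => beta eps x x u c).
    exact: quiver_variety_indep.
  by move=> /(_ lbeta)/eqP.
rewrite -mxrank_tr; apply/eqP; apply: inj_row_free_tr => s.
rewrite -[s]pcolK mxofE // => /colp_eq0/(alpha_inj x_stable) ->.
exact: colp0.
Qed.

Section Pair.
Variables (v1 v2 : Q -> nat).
Implicit Types (x : rep C w v1 v1) (y : rep C w v2 v2) (e : rep C w v1 v2).

(* On the zero locus of the moment maps, both alpha and sect take values in the
   kernel of this extension of beta, which is onto at the points of the
   correspondence. *)
Definition hecke_rel x y e : point C (gcoord v1 v2 + unit)%type :=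
  joinp (beta eps x y e) [ffun=> pairing eps e (sect y x)].

Lemma hecke_rel_lin x y : linmap (hecke_rel x y).
Proof.
move=> [c|[]] a e f; first by rewrite !joinpl beta_lin [LHS]ffunE.
by rewrite !joinpr ![in LHS]ffunE ![in RHS]ffunE pairing_linl.
Qed.

Lemma hecke_rel_lin_base e s :
  linform (fun z : point C (ecoord w v1 v1 + ecoord w v2 v2)%type =>
    hecke_rel (fstp z) (sndp z) e s).
Proof.
case: s => [c|[]] a z z'; rewrite fstp_lcomb sndp_lcomb.
  by rewrite !joinpl beta_lin_base [LHS]ffunE.
rewrite !joinpr ![in LHS]ffunE ![in RHS]ffunE sect_lin; exact: pairing_linr.
Qed.

Lemma hecke_rel0 x y e : beta eps x y e = 0 -> pairing eps e (sect y x) = 0 -> hecke_rel x y e = 0.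
Proof. by move=> b0 p0; apply/ffunP => -[c|[]]; rewrite ?joinpl ?joinpr ?b0 ?ffunE ?p0. Qed.

Lemma hecke_rel_alpha x y xi : (forall l, mom eps x x l = 0) -> (forall l, mom eps y y l = 0) ->
  hecke_rel x y (alpha x y xi) = 0.
Proof.
move=> x0 y0; apply: hecke_rel0; last exact: pairing_alpha_sect.
by apply: gmap_eq => l; rewrite beta_alpha x0 y0 mulmx0 mul0mx subrr gm0.
Qed.

Lemma hecke_rel_sect x y : (forall l, mom eps x x l = 0) -> (forall l, mom eps y y l = 0) ->
  hecke_rel x y (sect x y) = 0.
Proof.
move=> x0 y0; apply: hecke_rel0; first exact: beta_sect.
rewrite pairing_sect big_split /=.
under eq_bigr => l _ do rewrite mkE mulNmx raddfN.
rewrite sumrN sum_tr_frame // oppr0 add0r.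
by under eq_bigr => l _ do rewrite mkE; rewrite sum_tr_frame.
Qed.

End Pair.

Variables (v1 v2 : Q -> nat) (k : Q).
Hypothesis v2E : forall l : Q, v2 l = (v1 l + (l == k))%N.
Variables (x : rep C w v1 v1) (y : rep C w v2 v2) (zeta : gmap C v1 v2).
Hypothesis x_stable : stable (w := w) x.
Hypothesis y_stable : stable (w := w) y.
Hypothesis zetaP : alpha x y zeta = sect x y.

Lemma hecke_rel_free : row_free (mxof (hecke_rel x y)).
Proof.
apply/(row_free_indep (phi := fun s e => hecke_rel x y e s)) => [s|]; first exact: hecke_rel_lin.
move=> lam lam0.
pose xi : gmap C v2 v1 := mkg (fun l => \matrix_(a, b) lam (inl (existT _ l (b, a)))).
have [|xi0 c0] := @hecke_surjective C Q eps w eps_neq0 eps_bar v1 v2 k v2E x y zeta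
    x_stable y_stable zetaP xi (lam (inr tt)).
  move=> e; have := lam0 e; rewrite big_sumType /= => E; rewrite -[RHS]E; congr (_ + _).
    rewrite -(sum_gcoord (fun c => lam (inl c))); by apply: eq_bigr => c _; rewrite joinpl.
  by rewrite (bigD1 tt) //= big1 ?addr0 => [|[]] //; rewrite joinpr ffunE.
case=> [c|[]] //; exact: (gmap_tr_eq0 (lam := fun c => lam (inl c))).
Qed.

End HeckeRelation.

(** * The ambient form and the incidence equations in coordinates *)

Section HeckeMatrices.
Variables (C : numClosedFieldType) (Q : quiver).
Variables (eps : forall i j : Q, darrow i j -> C) (w : Q -> nat).
Hypothesis eps_neq0 : forall (i j : Q) (h : darrow i j), eps h != 0.
Hypothesis eps_bar : forall (i j : Q) (h : darrow i j), eps h + eps (bar h) = 0.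

Lemma OmegaE v (x y : adhm C w v) : Omega eps x y = pairing eps (x : rep C w v v) y.
Proof. by congr (_ + _); apply: eq_bigr => l _; rewrite raddfB. Qed.

Lemma mdiff_lin (T : finType) m n (A : point C T -> 'M[C]_(m, n)) :
  (forall i j, linform (fun z => A z i j)) -> mdiff A (fun _ => A).
Proof. by move=> lA i j; apply: pdiff_linform. Qed.

Definition mu_eqn v (c : gcoord v v) (x : rep C w v v) : C :=
  (mkg (fun l => mom eps x x l) : gmap C v v) c.

Lemma mu_eqnP v (x : rep C w v v) : (forall c, mu_eqn c x = 0) <-> forall l, mom eps x x l = 0.
Proof.
split=> [mu0 l|x0 [l [a b]]]; last first.
  by rewrite /mu_eqn ffunE x0 mxE.
apply/matrixP => a b; have := mu0 (existT _ l (a, b)); rewrite /mu_eqn ffunE => ->.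
by rewrite [RHS]mxE.
Qed.

Lemma mu_pdiff v (c : gcoord v v) :
  pdiff (@mu_eqn v c) (fun x u : rep C w v v => beta eps x x u c).
Proof.
case: c => l [a b].
have := @pdiff_bilin C (ecoord w v v) (fun x y => mom eps x y l a b) _ _; rewrite /mu_eqn.
have -> : (fun x : rep C w v v => (mkg (fun l => mom eps x x l) : gmap C v v) (existT _ l (a, b)))
    = (fun x => mom eps x x l a b) by apply: funext => x; rewrite ffunE.
have -> : (fun x u : rep C w v v => beta eps x x u (existT _ l (a, b)))
    = (fun x u => mom eps u x l a b + mom eps x u l a b).
  by apply: funext => x; apply: funext => u; rewrite ffunE mxE addrC.
by apply=> [x s u u'|y s u u']; rewrite ?mom_linl ?mom_linr [LHS]mxE [X in X + _]mxE.
Qed.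

Lemma moment_tangentP v (x u : rep C w v v) :
  (forall c, beta eps x x u c = 0) -> moment_tangent eps x u.
Proof.
move=> bu l; apply/matrixP => a b; have := bu (existT _ l (a, b)).
by rewrite ffunE [LHS]mxE => E; rewrite [LHS]mxE E [RHS]mxE.
Qed.

Section TargetForm.
Variables (v1 v2 : Q -> nat) (k : Q).
Notation T := (ecoord w v1 v1 + ecoord w v2 v2 + darrow k k)%type.
Implicit Types u v : point C T.

Lemma target_formE u v : target_form eps w v1 v2 k u v
  = pairing eps (fstp (fstp u) : rep C w v1 v1) (fstp (fstp v))
    - pairing eps (sndp (fstp u) : rep C w v2 v2) (sndp (fstp v))
    + \sum_(l : darrow k k) eps l * sndp u l * sndp v (bar l).
Proof. by rewrite /target_form !OmegaE. Qed.

Lemma target_form_linl v : linform (fun u => target_form eps w v1 v2 k u v).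
Proof.
move=> a u u'; rewrite !target_formE !fstp_lcomb !sndp_lcomb !pairing_linl.
rewrite (_ : \sum_l eps l * lcomb a (sndp u) (sndp u') l * sndp v (bar l) =
  a * (\sum_l eps l * sndp u l * sndp v (bar l))
  + \sum_l eps l * sndp u' l * sndp v (bar l)); first by ring.
by rewrite mulr_sumr -big_split; apply: eq_bigr => l _ /=; rewrite [lcomb _ _ _ _]ffunE; ring.
Qed.

Lemma target_form_linr u : linform (target_form eps w v1 v2 k u).
Proof.
move=> a v v'; rewrite !target_formE !fstp_lcomb !sndp_lcomb !pairing_linr //.
rewrite (_ : \sum_l eps l * sndp u l * lcomb a (sndp v) (sndp v') (bar l) =
  a * (\sum_l eps l * sndp u l * sndp v (bar l))
  + \sum_l eps l * sndp u l * sndp v' (bar l)); first by ring.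
by rewrite mulr_sumr -big_split; apply: eq_bigr => l _ /=; rewrite [lcomb _ _ _ _]ffunE; ring.
Qed.

Lemma target_form_nondegenerate u : (forall v, target_form eps w v1 v2 k u v = 0) -> u = 0.
Proof.
move=> u0; have pairing0 (va vb : Q -> nat) (e : rep C w va vb) : pairing eps e 0 = 0.
  exact: (linform0 (pairing_linr eps_bar e)).
have sum0 (a : point C (darrow k k)) :
    \sum_(l : darrow k k) eps l * a l * (0 : point C (darrow k k)) (bar l) = 0.
  by rewrite big1 // => l _; rewrite ffunE mulr0.
have u1 : fstp (fstp u) = 0.
  apply: (pairing_nondegenerate eps_neq0 (eps := eps) (va := v1) (vb := v1)) => f.
  have := u0 (joinp (joinp f 0) 0); rewrite target_formE !fstp_joinp !sndp_joinp.
  by rewrite sum0 pairing0 subr0 addr0.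
have u2 : sndp (fstp u) = 0.
  apply: (pairing_nondegenerate eps_neq0 (eps := eps) (va := v2) (vb := v2)) => f.
  have := u0 (joinp (joinp 0 f) 0); rewrite target_formE !fstp_joinp !sndp_joinp.
  by rewrite sum0 pairing0 sub0r addr0 => /eqP; rewrite oppr_eq0 => /eqP.
have u3 : sndp u = 0.
  apply/ffunP => l; have := u0 (joinp 0 (unitp C (bar l))).
  rewrite target_formE fstp_joinp sndp_joinp [fstp 0](_ : _ = 0); last first.
    by apply/ffunP => t; rewrite !ffunE.
  rewrite [sndp 0](_ : _ = 0); last by apply/ffunP => t; rewrite !ffunE.
  rewrite !pairing0 subr0 add0r (bigD1 l) //= big1 => [|l' neq_l].
    rewrite [unitp _ _ _]ffunE eqxx mulr1 addr0 => /eqP; rewrite mulf_eq0 (negPf (eps_neq0 l)) /=.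
    by move=> /eqP ->; rewrite ffunE.
  rewrite [unitp _ _ _]ffunE (can_eq (@barK Q k k)) (negPf neq_l) mulr0 //.
by rewrite -[u]joinpK -[fstp u]joinpK u1 u2 u3; apply/ffunP => -[[t|t]|t]; rewrite !ffunE.
Qed.

End TargetForm.

Section Pair.
Variables (v1 v2 : Q -> nat).

Lemma sub_adhmP (x : rep C w v1 v1) (y : rep C w v2 v2) :
  sub_adhm (w := w) (v1 := v1) (v2 := v2) x y <-> exists zeta, alpha x y zeta = sect x y.
Proof.
split=> [[z [zB zi zj]]|[zeta zetaP]].
  exists (mkg z); apply: rep_eq => [i j h|l|l]; rewrite !mkE.
  - by apply/eqP; rewrite subr_eq0 eq_sym; apply/eqP/zB.
  - by congr (- _); apply: zi.
  by rewrite [RHS]zj.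
exists (gm zeta); split=> [i j h|l|l].
- have := congr1 (fun e => Bm e h) zetaP; rewrite !mkE => /eqP; rewrite subr_eq0 => /eqP.
  by move=> <-.
- by have := congr1 (fun e => im e l) zetaP; rewrite !mkE => /oppr_inj.
by have := congr1 (fun e => jm e l) zetaP; rewrite !mkE.
Qed.

Notation T := (ecoord w v1 v1 + ecoord w v2 v2)%type.
Implicit Types z u : point C T.

Definition alpha_mx z := mxof (alpha (fstp z) (sndp z)).
Definition sect_col z := colp (sect (fstp z) (sndp z)).
Definition rel_mx z := mxof (hecke_rel eps (fstp z) (sndp z)).

Lemma alpha_mxE z xi : alpha_mx z *m colp xi = colp (alpha (fstp z) (sndp z) xi).
Proof. by rewrite mxofE //; apply: linmapP => a u v; rewrite alpha_lin. Qed.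

Lemma alpha_mx_diff : mdiff alpha_mx (fun _ => alpha_mx).
Proof.
apply: mdiff_lin => a b s z z'; rewrite !mxE fstp_lcomb sndp_lcomb alpha_lin_base.
by rewrite [LHS]ffunE.
Qed.

Lemma sect_col_diff : mdiff sect_col (fun _ => sect_col).
Proof.
apply: mdiff_lin => a b s z z'; rewrite !mxE fstp_lcomb sndp_lcomb sect_lin.
by rewrite [LHS]ffunE.
Qed.

Lemma rel_mx_fun : mfun rel_mx.
Proof.
move=> a b; have := pfun_linform (hecke_rel_lin_base eps_bar (unitp C (enum_val b)) (enum_val a)).
by congr pfun; apply: funext => z; rewrite mxE.
Qed.

Lemma alpha_mx_solvable z : (exists zeta, alpha (fstp z) (sndp z) zeta = sect (fstp z) (sndp z)) <->
  exists xi, alpha_mx z *m xi = sect_col z.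
Proof.
split=> [[zeta zetaP]|[xi]]; first by exists (colp zeta); rewrite alpha_mxE zetaP.
rewrite -[xi]pcolK alpha_mxE => E; exists (pcol xi).
by rewrite -[LHS]colpK E colpK.
Qed.

Lemma alpha_mx_inverse z : stable (w := w) (sndp z) -> exists p, p *m alpha_mx z = 1%:M.
Proof.
move=> y_stable; have free_alpha : row_free (alpha_mx z)^T.
  apply: inj_row_free_tr => s; rewrite -[s]pcolK alpha_mxE => /colp_eq0/(alpha_inj y_stable) ->.
  exact: colp0.
exists (pinvmx (alpha_mx z)^T)^T.
by have := congr1 trmx (mulmxVp free_alpha); rewrite trmx_mul trmxK trmx1.
Qed.

End Pair.
End HeckeMatrices.

(** * Invariance under the gauge group *)

Section GaugeInvariance.
Variables (C : fieldType) (Q : quiver) (eps : forall i j : Q, darrow i j -> C) (w : Q -> nat).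

Lemma gauge_locus v (x y : adhm C w v) : gauge_equiv x y ->
  locus (quiver_variety eps w v) x -> locus (quiver_variety eps w v) y.
Proof.
move=> [g [g_unit gB gi gj]] [x0 x_stable]; split=> [k|S SB Sj k].
  transitivity (g k *m moment eps x k *m invmx (g k)); last by rewrite x0 mulmx0 mul0mx.
  rewrite /moment mulmxDr mulmxDl gi gj !mulmxA; congr (_ + _).
  rewrite mulmx_sumr mulmx_suml; apply: eq_bigr => l _.
  rewrite mulmx_sumr mulmx_suml; apply: eq_bigr => h _.
  rewrite !gB -scalemxAr -scalemxAl; congr (_ *: _).
  by rewrite -!mulmxA [invmx _ *m (g l *m _)]mulmxA mulVmx // mul1mx.
pose L k := linfun (mulmx (invmx (g k)) : 'cV_(v k) -> 'cV_(v k)).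
have LE l s : L l s = invmx (g l) *m s by rewrite lfunE.
have S0 : (L k @: S k)%VS = 0%VS.
  apply: (x_stable (fun l => (L l @: S l)%VS)) =>
      [i j h _ /memv_imgP[s sS ->]|l _ /memv_imgP[s sS ->]].
    apply/memv_imgP; exists (Bmap y h *m s); first exact: SB.
    by rewrite !LE gB !mulmxA mulVmx // mul1mx.
  by rewrite LE mulmxA -gj Sj.
apply/eqP; rewrite -subv0; apply/subvP => s sS; rewrite memv0.
have : L k s \in (L k @: S k)%VS by apply: memv_img.
rewrite S0 memv0 LE => /eqP E.
by rewrite -[s](mulKVmx (g_unit k)) E mulmx0.
Qed.

Lemma gauge_sub_adhm v1 v2 (x x' : adhm C w v1) (y y' : adhm C w v2) :
  gauge_equiv x x' -> gauge_equiv y y' -> sub_adhm x y -> sub_adhm x' y'.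
Proof.
move=> [g [g_unit gB gi gj]] [h [h_unit hB hi hj]] [z [zB zi zj]].
exists (fun k => h k *m z k *m invmx (g k)); split=> [i j e|k|k].
- by rewrite gB hB !mulmxA !mulmxKV // -[h j *m z j *m _]mulmxA zB !mulmxA.
- by rewrite gi hi mulmxA mulmxKV // -mulmxA zi.
by rewrite gj hj !mulmxA mulmxKV // zj.
Qed.

Lemma gauge_trace v (x y : adhm C w v) k (l : darrow k k) :
  gauge_equiv x y -> \tr (Bmap y l) = \tr (Bmap x l).
Proof. by move=> [g [g_unit gB _ _]]; rewrite gB mxtrace_mulC mulmxA mulVmx // mul1mx. Qed.

End GaugeInvariance.

(** * Local equations of the correspondence *)

Section HeckeCorrespondence.
Variables (R : realType) (Q : quiver).
Local Notation C := R[i].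
Variables (eps : forall i j : Q, darrow i j -> C) (w : Q -> nat).
Hypothesis eps_neq0 : forall (i j : Q) (h : darrow i j), eps h != 0.
Hypothesis eps_bar : forall (i j : Q) (h : darrow i j), eps h + eps (bar h) = 0.

Lemma quiver_variety_cut_out v (x : rep C w v v) : stable (w := w) x ->
  cut_out (locus (quiver_variety eps w v)) x (mu_eqn eps (v := v))
    (fun c (x u : rep C w v v) => beta eps x x u c).
Proof.
move=> x_stable; split; [exact: mu_pdiff | exact: quiver_variety_indep |].
have [g [gP gx gX]] := stable_open x_stable; exists g; split=> // y /gX y_stable.
split=> [[y0 _]|/mu_eqnP y0]; last by split.
by apply/mu_eqnP.
Qed.

(** One copy of [#|gcoord v v|] counts the moment equations, the other is the dimension of the gauge
    group. *)
Lemma quiver_variety_smooth v :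
  smooth_of_dim (quiver_variety eps w v) (#|ecoord w v v| - 2 * #|gcoord v v|).
Proof.
move=> x [x0 x_stable].
apply: cut_out_smooth (quiver_variety_cut_out x_stable) _.
have := card_gcoord_le eps_neq0 eps_bar x_stable x0.
have -> : group_dim (quiver_variety eps w v) = #|gcoord v v|.
  by rewrite card_gcoord; apply: eq_bigr => l _; rewrite mulnn.
have -> : #|coords (quiver_variety eps w v)| = #|ecoord w v v| by [].
lia.
Qed.

Section Pair.
Variables (v1 v2 : Q -> nat).
Notation T := (ecoord w v1 v1 + ecoord w v2 v2)%type.
Implicit Types z u : point C T.

Lemma sub_adhm_closed z (X : point C T -> Prop) :
  (forall y, X y -> sub_adhm (w := w) (v1 := v1) (v2 := v2) (fstp y) (sndp y)) ->
  stable (w := w) (sndp z) -> zariski_closure X z ->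
  sub_adhm (w := w) (v1 := v1) (v2 := v2) (fstp z) (sndp z).
Proof.
move=> XS y_stable clz; apply/sub_adhmP/alpha_mx_solvable.
have [p pM] := alpha_mx_inverse y_stable.
have closed := @solvable_closed R _ _ _ _ _ _ _ _ _ (@alpha_mx_diff _ _ w v1 v2)
  (@sect_col_diff _ _ w v1 v2) pM.
apply: closed => f f0; apply: clz => y Xy.
by apply: f0; apply/alpha_mx_solvable/sub_adhmP/XS.
Qed.

Variable k : Q.
Hypothesis v2E : forall l : Q, v2 l = (v1 l + (l == k))%N.

Definition pair_eqn (j : gcoord v1 v1 + gcoord v2 v2) z : C :=
  match j with inl c => mu_eqn eps c (fstp z) | inr c => mu_eqn eps c (sndp z) end.

Definition pair_deqn (j : gcoord v1 v1 + gcoord v2 v2) z u : C :=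
  match j with
  | inl c => beta eps (fstp z) (fstp z) (fstp u) c
  | inr c => beta eps (sndp z) (sndp z) (sndp u) c
  end.

Lemma pair_pdiff j : pdiff (pair_eqn j) (pair_deqn j).
Proof.
by case: j => c; [exact: (pdiff_fstp _ (mu_pdiff eps w c))
                |exact: (pdiff_sndp _ (mu_pdiff eps w c))].
Qed.

Definition trace_map z : point C (darrow k k) :=
  trace_diff (eps := eps) (w := w) (v1 := v1) (v2 := v2) k z.

Lemma trace_mapE z l : trace_map z l = trd (fstp z) (sndp z) l.
Proof. by rewrite ffunE. Qed.

Lemma trace_map_lin : linmap trace_map.
Proof.
move=> l a z z'; rewrite !trace_mapE fstp_lcomb sndp_lcomb /trd !Bm_lcomb !mxtraceD !mxtraceZ.
ring.
Qed.

Section AtPoint.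
Variables (z : point C T) (zeta : gmap C v1 v2).
Hypothesis x_stable : stable (w := w) (fstp z).
Hypothesis y_stable : stable (w := w) (sndp z).
Hypothesis y_moment : forall l, mom eps (sndp z) (sndp z) l = 0.
Hypothesis zetaP : alpha (fstp z) (sndp z) zeta = sect (fstp z) (sndp z).

Let tangent_at u := solvable_tangent z pair_deqn (@alpha_mx _ _ w v1 v2)
  (fun _ => @alpha_mx _ _ w v1 v2) (fun _ => @sect_col _ _ w v1 v2) (colp zeta) u.

Lemma hecke_tangentP u : tangent_at u ->
  hecke_tangent eps (fstp z) (sndp z) zeta (fstp u) (sndp u).
Proof.
case=> du [xi xiP]; split.
- by apply: moment_tangentP => c; apply: (du (inl c)).
- by apply: moment_tangentP => c; apply: (du (inr c)).
exists (pcol xi); move: xiP; rewrite -[xi]pcolK !alpha_mxE pcolK -colpB => E.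
by rewrite -[LHS]colpK E colpK.
Qed.

Lemma target_form_isotropic (u u' : point C (T + darrow k k)%type) :
  tangent_at (fstp u) -> tangent_at (fstp u') ->
  sndp u = trace_map (fstp u) -> sndp u' = trace_map (fstp u') ->
  target_form eps w v1 v2 k u u' = 0.
Proof.
move=> /hecke_tangentP uT /hecke_tangentP u'T uE u'E; rewrite target_formE uE u'E.
have := hecke_isotropic eps_bar v2E x_stable y_moment zetaP uT u'T.
by move=> E; rewrite -[RHS]E; congr (_ + _); apply: eq_bigr => l _; rewrite !trace_mapE.
Qed.

End AtPoint.

Lemma pair_eqnP z : (forall j, pair_eqn j z = 0) <->
  (forall l, mom eps (fstp z) (fstp z) l = 0) /\ (forall l, mom eps (sndp z) (sndp z) l = 0).
Proof.
split=> [z0|[x0 y0] [c|c]]; last 2 first.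
- by move: c; apply/mu_eqnP.
- by move: c; apply/mu_eqnP.
by split; apply/mu_eqnP => c; [apply: (z0 (inl c)) | apply: (z0 (inr c))].
Qed.

Lemma hecke_open z : stable (w := w) (fstp z) -> stable (w := w) (sndp z) ->
  exists h, [/\ pfun h, h z != 0 & forall y, h y != 0 ->
    (locus (hecke eps w v1 v2) y <-> (forall j, pair_eqn j y = 0) /\
      exists xi, alpha_mx y *m xi = sect_col y)].
Proof.
move=> x_stable y_stable.
have [g1 [[dg1 g1P] g1z g1X]] := stable_open x_stable.
have [g2 [[dg2 g2P] g2z g2X]] := stable_open y_stable.
exists (fun z => g1 (fstp z) * g2 (sndp z)); split.
- exact: pfunM (pfun_pdiff (pdiff_fstp _ g1P)) (pfun_pdiff (pdiff_sndp _ g2P)).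
- exact: mulf_neq0.
move=> y; rewrite mulf_eq0 negb_or => /andP[/g1X y1 /g2X y2].
split=> [[[[m1 _] [m2 _]] /sub_adhmP/alpha_mx_solvable sol]|[/pair_eqnP[m1 m2]]].
  by split=> //; apply/pair_eqnP.
by move=> /alpha_mx_solvable/sub_adhmP sub; split=> //; split; split.
Qed.

Lemma rel_mx_rel z : (forall j, pair_eqn j z = 0) ->
  rel_mx eps z *m alpha_mx z = 0 /\ rel_mx eps z *m sect_col z = 0.
Proof.
move=> /pair_eqnP[x0 y0]; split.
  apply: mxof_comp0 => [||xi]; last exact: hecke_rel_alpha.
  - by apply: linmapP => a u v; rewrite alpha_lin.
  - exact: hecke_rel_lin.
by rewrite mxofE; [rewrite hecke_rel_sect // colp0 | apply: hecke_rel_lin].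
Qed.

Lemma rel_mx_drel z zeta u : alpha (fstp z) (sndp z) zeta = sect (fstp z) (sndp z) ->
  (forall j, pair_deqn j z u = 0) ->
  rel_mx eps z *m (sect_col u - alpha_mx u *m colp zeta) = 0.
Proof.
move=> zetaP du; rewrite alpha_mxE -colpB mxofE; last exact: hecke_rel_lin.
have [||b0 p0] := hecke_relation eps_bar zetaP (u1 := fstp u) (u2 := sndp u).
- by apply: moment_tangentP => c; apply: (du (inl c)).
- by apply: moment_tangentP => c; apply: (du (inr c)).
by rewrite hecke_rel0 // colp0.
Qed.

Lemma hecke_cut_out z : locus (hecke eps w v1 v2) z ->
  exists (I : finType) (F : I -> point C T -> C) dF,
    [/\ cut_out (locus (hecke eps w v1 v2)) z F dF,
        #|{: T + darrow k k}| = (2 * #|{: I + darrow k k}|)%N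
      & forall u u' : point C (T + darrow k k)%type,
          (forall i, graph_deqn dF trace_map i (joinp z (trace_map z)) u = 0) ->
          (forall i, graph_deqn dF trace_map i (joinp z (trace_map z)) u' = 0) ->
          target_form eps w v1 v2 k u u' = 0].
Proof.
case=> -[[x_moment x_stable] [y_moment y_stable]] /sub_adhmP[zeta zetaP].
have [p pM] := alpha_mx_inverse y_stable.
have half e : (#|gcoord v1 v2| + #|{: gcoord v1 v2 + unit}| + e = #|ecoord w v1 v2|)%N ->
    #|{: T + darrow k k}| = (2 * #|{: gcoord v1 v1 + gcoord v2 v2 + 'I_e + darrow k k}|)%N.
  have cardD (A B : finType) : #|{: A + B}| = (#|A| + #|B|)%N by rewrite card_sum.
  rewrite (cardD (ecoord w v1 v1 + ecoord w v2 v2)%type (darrow k k)).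
  rewrite (cardD (gcoord v1 v1 + gcoord v2 v2 + 'I_e)%type (darrow k k)).
  rewrite (cardD (gcoord v1 v1 + gcoord v2 v2)%type 'I_e) card_ord.
  rewrite (cardD (ecoord w v1 v1) (ecoord w v2 v2)) (cardD (gcoord v1 v1) (gcoord v2 v2)).
  rewrite (cardD (gcoord v1 v2) unit) card_unit.
  have := card_gcoord_hecke v2E; have := card_ecoord_hecke w v2E.
  lia.
have iso (u u' : point C (T + darrow k k)%type) :=
  target_form_isotropic x_stable y_moment zetaP (u := u) (u' := u').
have zE : alpha_mx z *m colp zeta = sect_col z by rewrite alpha_mxE zetaP.
have openX := hecke_open x_stable y_stable.
have Gz : forall j, pair_eqn j z = 0 by apply/pair_eqnP.
have N_free := hecke_rel_free eps_neq0 eps_bar v2E x_stable y_stable zetaP.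
have [e phi eE lphi ker|e [F [dF [eE cutF kerF]]]] := @determinantal_cut_out R T _ _ _ _
  (locus (hecke eps w v1 v2)) z
  pair_eqn pair_deqn (@alpha_mx _ _ w v1 v2) (@sect_col _ _ w v1 v2)
  (fun _ => @alpha_mx _ _ w v1 v2) (fun _ => @sect_col _ _ w v1 v2)
  (@rel_mx _ _ eps w v1 v2) (colp zeta) p
  pair_pdiff (@alpha_mx_diff _ _ w v1 v2) (@sect_col_diff _ _ w v1 v2)
  (rel_mx_fun eps_bar (v2 := v2)) pM zE openX Gz N_free rel_mx_rel
  (fun u => rel_mx_drel (u := u) zetaP).
  (* Isotropy holds only after the loop coordinates are adjoined, so independence is proved for the
     graph and then restricted. The forms [phi i] are constant in the base point, whence the
     arbitrary base point [0]. *)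
  have : independent (fun i => graph_deqn (fun i _ => phi i) trace_map i 0).
    apply: (isotropic_independent (w := target_form eps w v1 v2 k)) => [[i|l] a u v|u|v|u|u v|].
    - by rewrite /= fstp_lcomb lphi.
    - by rewrite /= fstp_lcomb trace_map_lin [lcomb _ _ _ _]ffunE; ring.
    - exact: target_form_linr.
    - exact: target_form_linl.
    - exact: target_form_nondegenerate.
    - by move=> /graph_kernelP[ku uE] /graph_kernelP[kv vE]; apply: iso => //; apply: ker.
    exact: half.
  exact: independent_graph.
exists _, F, dF; split=> //; first exact: half.
move=> u u' /graph_kernelP[]; rewrite fstp_joinp => ku uE /graph_kernelP[].
rewrite fstp_joinp => ku' u'E; apply: iso => //; exact: kerF.
Qed.

End Pair.
End HeckeCorrespondence.

(** * The embedding and its Lagrangian image *)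

Section HeckeEmbedding.
Variables (R : realType) (Q : quiver).
Local Notation C := R[i].
Variables (eps : forall i j : Q, darrow i j -> C) (w : Q -> nat).
Hypothesis eps_neq0 : forall (i j : Q) (h : darrow i j), eps h != 0.
Hypothesis eps_bar : forall (i j : Q) (h : darrow i j), eps h + eps (bar h) = 0.
Variables (v1 v2 : Q -> nat) (k : Q).
Hypothesis v2E : forall l : Q, v2 l = (v1 l + (l == k))%N.

Local Notation T := (ecoord w v1 v1 + ecoord w v2 v2)%type.
Local Notation H := (hecke eps w v1 v2).
Local Notation N := (hecke_target eps w v1 v2 k).
Local Notation f := (hecke_embedding eps w v1 v2 k).
Local Notation Z := (embedded_image H N f).
Local Notation tr := (@trace_map R Q eps w v1 v2 k).

Lemma hecke_embeddingE (x : point C T) : f x = joinp x (tr x).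
Proof. by []. Qed.

Lemma hecke_imageE (z : point C (T + darrow k k)%type) :
  Z z <-> locus H (fstp z) /\ sndp z = tr (fstp z).
Proof.
split=> [[x Hx ->]|[Hz zE]]; first by rewrite hecke_embeddingE fstp_joinp sndp_joinp.
by exists (fstp z) => //; rewrite hecke_embeddingE -zE joinpK.
Qed.

Lemma trace_map_gauge (x y : point C T) :
  orbit_rel (variety_pair eps w v1 v2) x y -> tr x = tr y.
Proof.
case=> o1 o2; apply/ffunP => l; rewrite [LHS]ffunE [RHS]ffunE.
by rewrite (gauge_trace l o1) (gauge_trace l o2).
Qed.

Lemma hecke_gauge (x y : point C T) : orbit_rel H x y -> locus H x -> locus H y.
Proof.
move=> [o1 o2] [[l1 l2] sub]; split; last exact: gauge_sub_adhm o1 o2 sub.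
by split; [apply: gauge_locus l1 | apply: gauge_locus l2].
Qed.

Lemma hecke_image_gauge z z' : Z z -> orbit_rel N z z' -> Z z'.
Proof.
move=> /hecke_imageE[Hz zE] [o oE]; apply/hecke_imageE; split.
  exact: hecke_gauge o Hz.
by rewrite -(trace_map_gauge o) -zE; apply: esym.
Qed.

Lemma hecke_image_closed : closed_subvariety N Z.
Proof.
split=> [z z' Zz _ /(hecke_image_gauge Zz)//|].
split=> [z /hecke_imageE[[Hz _] _]|z [[l1 l2] _] clz].
  by split.
apply/hecke_imageE; split.
  split; first by split.
  case: l2 => _ y_stable; apply: (sub_adhm_closed (X := locus H)) => // [y []//|g g0].
  have [G [GE _]] := pdiff_fstp (darrow k k) (pdiff_evalp g).
  by rewrite GE; apply: clz => y /hecke_imageE[/g0 + _]; rewrite -GE.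
apply/ffunP => l; have [G [GE _]] := pdiffB (@pdiff_coord C (T + darrow k k)%type (inr l))
  (pdiff_fstp (darrow k k) (pdiff_linform (@trace_map_lin R Q eps w v1 v2 k l))).
apply/eqP; rewrite ffunE -subr_eq0 GE; apply/eqP/clz => y /hecke_imageE[_ yE].
by rewrite -GE -yE ffunE subrr.
Qed.

Lemma regular_mapP (T1 T2 : finType) (g : point C T1 -> point C T2) :
  (forall t, pfun (fun x => g x t)) -> regular_map g.
Proof.
move=> gP; have /choice[G GP] : forall t, exists G : polyfun C T1, forall x, g x t = evalp G x.
  by move=> t; have [dg [G [GE _]]] := gP t; exists G.
by exists G.
Qed.

Lemma hecke_closed_embedding : closed_embedding H N f.
Proof.
split.
- apply: regular_mapP => -[t|l].
    have := pfun_coord C t; congr pfun.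
    by apply: funext => x; rewrite hecke_embeddingE joinpl.
  have := pfun_linform (@trace_map_lin R Q eps w v1 v2 k l); congr pfun.
  by apply: funext => x; rewrite hecke_embeddingE joinpr.
- move=> x y _ _; rewrite !hecke_embeddingE; split=> [o|[]]; last by rewrite !fstp_joinp.
  by split; [rewrite !fstp_joinp | rewrite /= !sndp_joinp; apply: trace_map_gauge].
- exact: hecke_image_closed.
exists (fun z : point C (T + darrow k k)%type => fstp z).
  apply: regular_mapP => t; have := @pfun_coord C (T + darrow k k)%type (inl t); congr pfun.
  by apply: funext => z; rewrite ffunE.
by move=> x _; rewrite hecke_embeddingE fstp_joinp.
Qed.

(** The tangent space of [Z] upstairs is its own orthogonal for the nondegenerate form of the whole
    affine space. It contains the orbit directions, so the equality passes to the quotient. *)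
Lemma hecke_lagrangian : lagrangian N (target_form eps w v1 v2 k) Z.
Proof.
split=> [|z Zz]; first exact: hecke_image_closed.
have [Hz zE] := iffLR (hecke_imageE z) Zz.
have [I [F [dF [cutF half iso]]]] := hecke_cut_out eps_neq0 eps_bar v2E Hz.
have cutZ := cut_out_graph (@trace_map_lin R Q eps w v1 v2 k) cutF.
have ZE : (fun z : point C (T + darrow k k)%type => locus H (fstp z) /\ sndp z = tr (fstp z)) = Z.
  by apply: funext => y; apply: propext; split=> /hecke_imageE.
rewrite ZE -zE joinpK in cutZ; rewrite -zE joinpK in iso.
have TZ u := cut_out_tangent u cutZ Zz.
split=> [|u _].
  exists #|{: I + darrow k k}|; apply: cut_out_smooth cutZ _.
  by rewrite addnn -mul2n -half.
split=> [[o To Tuo] u' Tu'|Zperp].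
  apply: iso; last exact/TZ.
  have {}To : tangent Z z o.
    by move=> g g0; apply: To => y zy; apply/g0/(hecke_image_gauge Zz zy).
  apply/TZ => g g0; have := Tuo g g0; rewrite linformD; last exact: linform_pdiff (pdiff_evalp g).
  by rewrite (To g g0) addr0.
(* The directions of the orbit are tangent to Z, so that o = 0 will do. *)
exists 0 => [g _|]; first by rewrite linform0 //; apply: linform_pdiff (pdiff_evalp g).
rewrite addr0; apply/TZ.
have [GP _ _] := cutZ.
apply: (isotropic_lagrangian (phi := fun i => graph_deqn dF tr i z)
  (w := target_form eps w v1 v2 k)) => [i|u'|u'|u'|u' u''||u' ku'].
- exact: linform_pdiff (GP i).
- exact: target_form_linr.
- exact: target_form_linl.
- exact: target_form_nondegenerate.
- exact: iso.
- exact: half.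
by apply: Zperp; apply/TZ.
Qed.

Lemma hecke_smooth :
  smooth_of_dim H ((#|ecoord w v1 v1| - 2 * #|gcoord v1 v1|
    + (#|ecoord w v2 v2| - 2 * #|gcoord v2 v2|))./2 + loops k).
Proof.
move=> z Hz; have [I [F [dF [cutF half _]]]] := hecke_cut_out eps_neq0 eps_bar v2E Hz.
apply: cut_out_smooth cutF _.
case: Hz => -[[x0 x_stable] [y0 y_stable]] _.
have := card_gcoord_le eps_neq0 eps_bar x_stable x0.
have := card_gcoord_le eps_neq0 eps_bar y_stable y0.
have gE v : (\sum_k v k ^ 2)%N = #|gcoord v v|.
  by rewrite card_gcoord; apply: eq_bigr => l _; rewrite mulnn.
have -> : group_dim H = (#|gcoord v1 v1| + #|gcoord v2 v2|)%N by rewrite -!gE.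
have -> : #|coords H| = (#|ecoord w v1 v1| + #|ecoord w v2 v2|)%N.
  exact: (card_sum (ecoord w v1 v1) (ecoord w v2 v2)).
have := half; rewrite (card_sum T (darrow k k)) (card_sum (ecoord w v1 v1) (ecoord w v2 v2)).
rewrite (card_sum I (darrow k k)) (card_sum (edge k k) (edge k k)) -/(loops k).
move: #|ecoord w v1 v1| #|ecoord w v2 v2| #|gcoord v1 v1| #|gcoord v2 v2| => e1 e2 g1 g2.
move: #|I| (loops k) => n g.
lia.
Qed.

End HeckeEmbedding.

Theorem theorem4p8 (R : realType) (Q : quiver)
    (eps : forall i j : Q, darrow i j -> R[i])
    (eps_neq0 : forall (i j : Q) (h : darrow i j), eps i j h != 0)
    (eps_bar : forall (i j : Q) (h : darrow i j),
       eps i j h + eps j i (bar h) = 0)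
    (w : Q -> nat) (w_neq0 : exists l : Q, w l <> 0%N)
    (v1 v2 : Q -> nat) (k : Q)
    (v2E : forall l : Q, v2 l = (v1 l + (l == k))%N) :
  [/\ closed_embedding (hecke eps w v1 v2) (hecke_target eps w v1 v2 k)
        (hecke_embedding eps w v1 v2 k),
      lagrangian (hecke_target eps w v1 v2 k)
        (target_form eps w v1 v2 k)
        (embedded_image (hecke eps w v1 v2) (hecke_target eps w v1 v2 k)
           (hecke_embedding eps w v1 v2 k))
    & exists d1 d2 d : nat,
      [/\ smooth_of_dim (quiver_variety eps w v1) d1,
          smooth_of_dim (quiver_variety eps w v2) d2,
          smooth_of_dim (hecke eps w v1 v2) d
        & (d * 2 = d1 + d2 + 2 * loops k)%N]].
Proof.
split; [exact: hecke_closed_embedding | exact: hecke_lagrangian |].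
exists (#|ecoord w v1 v1| - 2 * #|gcoord v1 v1|)%N.
exists (#|ecoord w v2 v2| - 2 * #|gcoord v2 v2|)%N; eexists; split.
- exact: quiver_variety_smooth.
- exact: quiver_variety_smooth.
- exact: hecke_smooth.
(* The varieties may be empty, so no point is at hand to bound [2 * g] by [e]; parity of [e] alone
   makes the possibly truncated difference even and the halving exact. *)
have := card_ecoord_even w v1; have := card_ecoord_even w v2.
move: #|ecoord w v1 v1| #|ecoord w v2 v2| #|gcoord v1 v1| #|gcoord v2 v2| => e1 e2 g1 g2.
lia.
Qed.
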